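(* Let $\mathscr{A}$ and $\mathscr{B}$ be abelian categories with enough projective and injective objects, let $T:\mathscr{B}\to\mathscr{A}$ be a right exact functor, and let $(T\downarrow\mathscr{A})$ be the comma category of $T$. Let $\mathcal{W}$ and $\mathcal{X}$ be subcategories of $\mathscr{A}$ and let $\mathcal{V}$ and $\mathcal{Y}$ be subcategories of $\mathscr{B}$. Assume that $T(\mathcal{V})\subseteq\mathcal{W}$, $T(\mathcal{Y})\subseteq\mathcal{X}$ and $(\mathrm{L}_nT)\mathcal{Y}=0$ for all $n\geq1$. (1) If $(\mathcal{X},\mathcal{W})$ and $(\mathcal{Y},\mathcal{V})$ are left Frobenius pairs in $\mathscr{A}$ and $\mathscr{B}$, respectively, then there exists a recollement of right triangulated categories, with middle term $\mathfrak{B}^{\mathcal{X}}_{\mathcal{Y}}/\mathfrak{B}^{\mathcal{W}}_{\mathcal{V}}$, left term $\mathcal{X}/\mathcal{W}$ and right term $\mathcal{Y}/\mathcal{V}$, $$\mathcal{X}/\mathcal{W}\xrightarrow{\ i\ }\mathfrak{B}^{\mathcal{X}}_{\mathcal{Y}}/\mathfrak{B}^{\mathcal{W}}_{\mathcal{V}}\xrightarrow{\ e\ }\mathcal{Y}/\mathcal{V},$$ where all functors are explicit: $i=\overline{Z_{\mathscr{A}}}$, its left adjoint is $\overline{q}$ and its right adjoint is $\overline{U_{\mathscr{A}}}$; $e=\overline{U_{\mathscr{B}}}$, its left adjoint is $\overline{T_{\mathscr{B}}}$ and its right adjoint is $\overline{s}$. (2) If $(\mathcal{X},\mathcal{W})$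 and $(\mathcal{Y},\mathcal{V})$ are strong left Frobenius pairs in $\mathscr{A}$ and $\mathscr{B}$, respectively, then the recollement in (1) is a recollement of triangulated categories.
   Context: Conventions. Subcategories are full, closed under isomorphisms, and contain the zero object. Comma category. $(T\downarrow\mathscr{A})$ has as objects the triples $\left(\begin{smallmatrix}A\\ B\end{smallmatrix}\right)_{\varphi}$ with $A\in\mathscr{A}$, $B\in\mathscr{B}$ and $\varphi:T(B)\to A$ a morphism in $\mathscr{A}$; a morphism $\left(\begin{smallmatrix}A\\ B\end{smallmatrix}\right)_{\varphi}\to\left(\begin{smallmatrix}A'\\ B'\end{smallmatrix}\right)_{\varphi'}$ is a pair $\left(\begin{smallmatrix}a\\ b\end{smallmatrix}\right)$ with $a:A\to A'$, $b:B\to B'$ and $\varphi'T(b)=a\varphi$. Since $T$ is right exact, it is abelian. Put $$\mathfrak{B}^{\mathcal{X}}_{\mathcal{Y}}=\{\left(\begin{smallmatrix}X\\ Y\end{smallmatrix}\right)_{\varphi}\in(T\downarrow\mathscr{A}) : Y\in\mathcal{Y},\ \varphi \text{ is monic and } \mathrm{Coker}\,\varphi\in\mathcal{X}\}.$$ Frobenius pairs. For a subcategory $\mathcal{X}$ of an abelian category $\mathscr{C}$, let $\mathcal{X}^{\perp}=\{M:\mathrm{Ext}^i_{\mathscr{C}}(X,M)=0 \text{ for all } X\in\mathcal{X},\ i\geq1\}$ and ${}^{\perp}\mathcal{X}=\{M:\mathrm{Ext}^i_{\mathscr{C}}(M,X)=0\text{ for all }X\in\mathcal{X},\ i\geq1\}$.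 $\mathcal{W}$ is an injective cogenerator for $\mathcal{X}$ if $\mathcal{W}\subseteq\mathcal{X}\cap\mathcal{X}^{\perp}$ and every $X\in\mathcal{X}$ has an exact sequence $0\to X\to W\to X'\to0$ with $W\in\mathcal{W}$, $X'\in\mathcal{X}$. Dually, $\mathcal{W}$ is a projective generator for $\mathcal{X}$ if $\mathcal{W}\subseteq\mathcal{X}\cap{}^{\perp}\mathcal{X}$ and every $X\in\mathcal{X}$ has an exact sequence $0\to X'\to W\to X\to0$ with $W\in\mathcal{W}$, $X'\in\mathcal{X}$. $(\mathcal{X},\mathcal{W})$ is a left Frobenius pair in $\mathscr{C}$ if (i) $\mathcal{X}$ is closed under extensions, kernels of epimorphisms and direct summands; (ii) $\mathcal{W}$ is closed under direct summands in $\mathscr{C}$; (iii) $\mathcal{W}$ is an injective cogenerator for $\mathcal{X}$. It is strong if in addition $\mathcal{W}$ is a projective generator for $\mathcal{X}$. Under the hypotheses of (1) (resp. (2)), $(\mathfrak{B}^{\mathcal{X}}_{\mathcal{Y}},\mathfrak{B}^{\mathcal{W}}_{\mathcal{V}})$ is a left (resp. strong left) Frobenius pair in $(T\downarrow\mathscr{A})$. $\mathrm{L}_nT$ is the $n$-th left derived functor of $T$; $(\mathrm{L}_nT)\mathcal{Y}=0$ means $(\mathrm{L}_nT)Y=0$ for all $Y\in\mathcal{Y}$. Right triangulated categories. Let $\mathscr{C}$ be an additive category with an additive endofunctor $\Sigma$. A right triangulation of $(\mathscr{C},\Sigma)$ is a class $\Delta$ of diagrams $A\to B\to C\to\Sigma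 A$ (right triangles; morphisms are the evident commutative diagrams) satisfying all axioms of a triangulated category except that $\Sigma$ need not be an equivalence; $(\mathscr{C},\Sigma,\Delta)$ is then a right triangulated category. A right triangle functor $(\mathscr{C},\Sigma,\Delta)\to(\mathscr{C}',\Sigma',\Delta')$ is a functor $F$ with a natural isomorphism $\varphi:F\Sigma\to\Sigma'F$ such that for every right triangle $A\xrightarrow{f}B\xrightarrow{g}C\xrightarrow{h}\Sigma A$ in $\Delta$, $F(A)\xrightarrow{F(f)}F(B)\xrightarrow{F(g)}F(C)\xrightarrow{\varphi_AF(h)}\Sigma'F(A)$ is in $\Delta'$. Stable category. For a left Frobenius pair $(\mathcal{X},\mathcal{W})$, $\overline{\mathcal{X}}=\mathcal{X}/\mathcal{W}$ has the objects of $\mathcal{X}$ and $\mathrm{Hom}_{\overline{\mathcal{X}}}(X,Y)$ is $\mathrm{Hom}(X,Y)$ modulo the subgroup of morphisms factoring through objects of $\mathcal{W}$. It is right triangulated as follows: $\Sigma X=X'$ where $0\to X\to W\to X'\to0$ is a chosen exact sequence with $W\in\mathcal{W}$, $X'\in\mathcal{X}$; for an exact sequence $0\to X_1\xrightarrow{f}X_2\xrightarrow{g}X_3\to0$ with all terms in $\mathcal{X}$, and the chosen sequence $0\to X_1\to W_1\to\Sigma X_1\to0$, the identity of $X_1$ extends to a morphism of exact sequences with components $a:X_2\to W_1$ and $b:X_3\to\Sigma X_1$, and $X_1\xrightarrow{\overline f}X_2\xrightarrow{\overline g}X_3\xrightarrow{\overline b}\Sigma X_1$ is a distinguished right triangle;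 right triangles are the sequences isomorphic to distinguished ones. If $(\mathcal{X},\mathcal{W})$ is strong, $\mathcal{X}$ is a Frobenius category with class of projective-injective objects $\mathcal{W}$ and $\overline{\mathcal{X}}$ is triangulated. Recollement. A recollement of right triangulated categories $\mathscr{C}$ relative to $\mathscr{A}',\mathscr{B}'$ consists of right triangle functors $i:\mathscr{A}'\to\mathscr{C}$, $e:\mathscr{C}\to\mathscr{B}'$, $q,p:\mathscr{C}\to\mathscr{A}'$, $l,r:\mathscr{B}'\to\mathscr{C}$ such that (1) $(q,i)$, $(i,p)$, $(l,e)$, $(e,r)$ are adjoint pairs; (2) $i,l,r$ are fully faithful; (3) $\mathrm{Im}\,i=\mathrm{Ker}\,e$ (essential image). It is a recollement of triangulated categories if the three categories are triangulated (the functors are then triangle functors). Functors. On objects: $\overline{Z_{\mathscr{A}}}(X)=\left(\begin{smallmatrix}X\\0\end{smallmatrix}\right)$, $\overline{q}\left(\begin{smallmatrix}X\\ Y\end{smallmatrix}\right)_{\varphi}=\mathrm{Coker}\,\varphi$, $\overline{U_{\mathscr{A}}}\left(\begin{smallmatrix}X\\ Y\end{smallmatrix}\right)_{\varphi}=X$, $\overline{U_{\mathscr{B}}}\left(\begin{smallmatrix}X\\ Y\end{smallmatrix}\right)_{\varphi}=Y$, $\overline{T_{\mathscr{B}}}(Y)=\left(\begin{smallmatrix}T(Y)\\ Y\end{smallmatrix}\right)_{\mathrm{id}}$, with the evident actions on morphisms; and $\overline{s}(Y)=\left(\begin{smallmatrix}W\\ Y\end{smallmatrix}\right)_{\sigma}$,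 where $0\to T(Y)\xrightarrow{\sigma}W\to\mathrm{Coker}\,\sigma\to0$ is a chosen exact sequence with $W\in\mathcal{W}$ and $\mathrm{Coker}\,\sigma\in\mathcal{X}$; for $g:Y\to Y'$, $\overline{s}(\overline{g})$ is the class of $\left(\begin{smallmatrix}f\\ g\end{smallmatrix}\right)$, where $f:W\to W'$ is any morphism with $f\sigma=\sigma'T(g)$. *)

(* Defs.v *)
From HB Require Import structures.
From mathcomp Require Import all_boot all_order all_algebra.
From mathcomp Require Import boolp.

Set Implicit Arguments.
Unset Strict Implicit.
Unset Printing Implicit Defensive.

Import GRing.Theory.
Local Open Scope ring_scope.
Local Open Scope quotient_scope.

Record precat := Precat {
  ob :> Type;
  hom : ob -> ob -> zmodType;
  idm : forall x, hom x x;
  comp : forall x y z, hom y z -> hom x y -> hom x z;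
  compA : forall x y z t (h : hom z t) (g : hom y z) (f : hom x y),
    comp h (comp g f) = comp (comp h g) f;
  comp1m : forall x y (f : hom x y), comp (idm y) f = f;
  compm1 : forall x y (f : hom x y), comp f (idm x) = f;
  compDl : forall x y z (g g' : hom y z) (f : hom x y),
    comp (g + g') f = comp g f + comp g' f;
  compDr : forall x y z (g : hom y z) (f f' : hom x y),
    comp g (f + f') = comp g f + comp g f'
}.

Notation "g ∘ f" := (comp g f) (at level 40, left associativity).
Notation "\id" := (idm _) (at level 0).

Lemma compBl (C : precat) (x y z : C) (g g' : hom y z) (f : hom x y) :
  (g - g') ∘ f = g ∘ f - g' ∘ f.
Proof. by apply/eqP; rewrite eq_sym subr_eq -compDl subrK. Qed.

Lemma compBr (C : precat) (x y z : C) (g : hom y z) (f f' : hom x y) :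
  g ∘ (f - f') = g ∘ f - g ∘ f'.
Proof. by apply/eqP; rewrite eq_sym subr_eq -compDr subrK. Qed.

Lemma comp0m (C : precat) (x y z : C) (f : hom x y) : (0 : hom y z) ∘ f = 0.
Proof. by rewrite -(subrr (0 : hom y z)) compBl subrr. Qed.

Lemma compm0 (C : precat) (x y z : C) (g : hom y z) : g ∘ (0 : hom x y) = 0.
Proof. by rewrite -(subrr (0 : hom x y)) compBr subrr. Qed.

(* All functors between preadditive categories are taken to be additive. *)
Record functor (C D : precat) := Functor {
  fob :> C -> D;
  fmap : forall x y : C, hom x y -> hom (fob x) (fob y);
  fmap1 : forall x : C, fmap (idm x) = idm (fob x);
  fmapM : forall (x y z : C) (g : hom y z) (f : hom x y),
    fmap (g ∘ f) = fmap g ∘ fmap f;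
  fmapD : forall (x y : C) (f g : hom x y), fmap (f + g) = fmap f + fmap g
}.
Arguments fmap {C D} _ {x y}.

Lemma fmapB (C D : precat) (F : functor C D) (x y : C) (f g : hom x y) :
  fmap F (f - g) = fmap F f - fmap F g.
Proof. by apply/eqP; rewrite eq_sym subr_eq -fmapD subrK. Qed.

Lemma fmap0 (C D : precat) (F : functor C D) (x y : C) :
  fmap F (0 : hom x y) = 0.
Proof. by rewrite -(subrr (0 : hom x y)) fmapB subrr. Qed.

Section Morphisms.
Variable C : precat.
Implicit Types x y z : C.

Definition mono x y (f : hom x y) : Prop :=
  forall z (u v : hom z x), f ∘ u = f ∘ v -> u = v.

Definition epi x y (f : hom x y) : Prop :=
  forall z (u v : hom y z), u ∘ f = v ∘ f -> u = v.

Definition is_iso x y (f : hom x y) : Prop :=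
  exists g : hom y x, g ∘ f = \id /\ f ∘ g = \id.

Definition isomorphic x y : Prop := exists f : hom x y, is_iso f.

Definition is_zero x : Prop :=
  (forall y (f : hom x y), f = 0) /\ (forall y (f : hom y x), f = 0).

Definition is_kernel x y k (f : hom x y) (m : hom k x) : Prop :=
  f ∘ m = 0 /\
  forall z (u : hom z x), f ∘ u = 0 -> exists! v : hom z k, m ∘ v = u.

Definition is_cokernel x y c (f : hom x y) (p : hom y c) : Prop :=
  p ∘ f = 0 /\
  forall z (u : hom y z), u ∘ f = 0 -> exists! v : hom c z, v ∘ p = u.

Definition short_exact x y z (f : hom x y) (g : hom y z) : Prop :=
  is_kernel g f /\ is_cokernel f g.

Definition is_biproduct x y b (i1 : hom x b) (i2 : hom y b)
    (p1 : hom b x) (p2 : hom b y) : Prop :=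
  [/\ p1 ∘ i1 = \id, p2 ∘ i2 = \id, p1 ∘ i2 = 0, p2 ∘ i1 = 0
    & i1 ∘ p1 + i2 ∘ p2 = \id].

Definition direct_sum x y b : Prop :=
  exists (i1 : hom x b) (i2 : hom y b) (p1 : hom b x) (p2 : hom b y),
    is_biproduct i1 i2 p1 p2.

Definition projective p : Prop :=
  forall x y (e : hom x y) (f : hom p y), epi e ->
    exists g : hom p x, e ∘ g = f.

Definition injective_ob i : Prop :=
  forall x y (m : hom x y) (f : hom x i), mono m ->
    exists g : hom y i, g ∘ m = f.

End Morphisms.

Definition additive_category (C : precat) : Prop :=
  (exists z : C, is_zero z) /\ (forall x y : C, exists b, direct_sum x y b).

(* A zero object, kernels and cokernels are part of the data, so that
   expressions such as Coker φ denote objects. *)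
Record abelian := Abelian {
  acat :> precat;
  zob : acat;
  zobP : is_zero zob;
  dsumP : forall x y : acat, exists b, direct_sum x y b;
  ker : forall (x y : acat), hom x y -> acat;
  kerm : forall (x y : acat) (f : hom x y), hom (ker f) x;
  kerP : forall (x y : acat) (f : hom x y), is_kernel f (kerm f);
  coker : forall (x y : acat), hom x y -> acat;
  cokerm : forall (x y : acat) (f : hom x y), hom y (coker f);
  cokerP : forall (x y : acat) (f : hom x y), is_cokernel f (cokerm f);
  mono_is_kernel : forall (x y : acat) (f : hom x y), mono f ->
    exists (z : acat) (g : hom y z), is_kernel g f;
  epi_is_cokernel : forall (x y : acat) (f : hom x y), epi f ->
    exists (z : acat) (g : hom z x), is_cokernel g f
}.
Arguments zob : clear implicits.

Definition enough_projectives (C : precat) : Prop :=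
  forall x : C, exists (p : C) (e : hom p x), projective p /\ epi e.

Definition enough_injectives (C : precat) : Prop :=
  forall x : C, exists (i : C) (m : hom x i), injective_ob i /\ mono m.

(* h is the homology of x -> y -> z at y, that is, the cokernel of the
   corestriction x -> Ker g of f. *)
Definition is_homology (C : abelian) (x y z : C) (f : hom x y) (g : hom y z)
    (h : C) : Prop :=
  exists u : hom x (ker g), kerm g ∘ u = f /\
  exists p : hom (ker g) h, is_cokernel u p.

Definition exact (C : abelian) (x y z : C) (f : hom x y) (g : hom y z) : Prop :=
  is_homology f g (zob C).

Definition right_exact (C D : abelian) (F : functor C D) : Prop :=
  forall (x y z : C) (f : hom x y) (g : hom y z), short_exact f g ->
    exact (fmap F f) (fmap F g) /\ epi (fmap F g).

Record projective_resolution (C : abelian) (x : C) := ProjectiveResolution {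
  pr_ob :> nat -> C;
  pr_d : forall n, hom (pr_ob n.+1) (pr_ob n);
  pr_aug : hom (pr_ob 0) x;
  pr_projective : forall n, projective (pr_ob n);
  pr_aug_epi : epi pr_aug;
  pr_exact0 : exact (pr_d 0) pr_aug;
  pr_exactS : forall n, exact (pr_d n.+1) (pr_d n)
}.

(* Ext^n(x,m) = H^n(Hom(P,m)) and (L_n F)(y) = H_n(F(P)) do not depend on the
   projective resolution P, so they are computed from an arbitrary one. *)
Definition Ext_vanishes (C : abelian) (n : nat) (x m : C) : Prop :=
  exists P : projective_resolution x,
  match n with
  | 0 => forall f : hom (P 0) m, f ∘ pr_d P 0 = 0 -> f = 0
  | n'.+1 => forall f : hom (P n'.+1) m, f ∘ pr_d P n'.+1 = 0 ->
             exists g : hom (P n') m, f = g ∘ pr_d P n'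
  end.

(* h is, up to isomorphism, the value (L_n F)(y). *)
Definition left_derived (C D : abelian) (F : functor C D) (n : nat)
    (y : C) (h : D) : Prop :=
  exists P : projective_resolution y,
  match n with
  | 0 => is_homology (fmap F (pr_d P 0)) (0 : hom (F (P 0)) (zob D)) h
  | n'.+1 => is_homology (fmap F (pr_d P n'.+1)) (fmap F (pr_d P n')) h
  end.

(* A (full) subcategory is given by its class of objects. *)
Definition subcategory (C : precat) (X : C -> Prop) : Prop :=
  (forall x y, isomorphic x y -> X x -> X y) /\ (forall z, is_zero z -> X z).

Definition right_orth (C : abelian) (X : C -> Prop) (m : C) : Prop :=
  forall (x : C) (n : nat), X x -> (1 <= n)%N -> Ext_vanishes n x m.

Definition left_orth (C : abelian) (X : C -> Prop) (m : C) : Prop :=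
  forall (x : C) (n : nat), X x -> (1 <= n)%N -> Ext_vanishes n m x.

Definition closed_ext (C : precat) (X : C -> Prop) : Prop :=
  forall (x y z : C) (f : hom x y) (g : hom y z),
    short_exact f g -> X x -> X z -> X y.

Definition closed_ker_epi (C : precat) (X : C -> Prop) : Prop :=
  forall (x y z : C) (f : hom x y) (g : hom y z),
    short_exact f g -> X y -> X z -> X x.

Definition closed_summands (C : precat) (X : C -> Prop) : Prop :=
  forall x y b : C, direct_sum x y b -> X b -> X x.

Definition injective_cogenerator (C : abelian) (W X : C -> Prop) : Prop :=
  (forall w, W w -> X w /\ right_orth X w) /\
  (forall x, X x -> exists (w x' : C) (f : hom x w) (g : hom w x'),
     [/\ short_exact f g, W w & X x']).

Definition projective_generator (C : abelian) (W X : C -> Prop) : Prop :=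
  (forall w, W w -> X w /\ left_orth X w) /\
  (forall x, X x -> exists (x' w : C) (f : hom x' w) (g : hom w x),
     [/\ short_exact f g, W w & X x']).

Definition left_Frobenius_pair (C : abelian) (X W : C -> Prop) : Prop :=
  [/\ closed_ext X, closed_ker_epi X, closed_summands X,
      closed_summands W & injective_cogenerator W X].

Definition strong_left_Frobenius_pair (C : abelian) (X W : C -> Prop) : Prop :=
  left_Frobenius_pair X W /\ projective_generator W X.

Section Comma.
Variables (B A : precat) (T : functor B A).

Record comma_ob := CommaOb {
  cA : A;
  cB : B;
  cphi : hom (T cB) cA
}.

Definition comma_sq (M N : comma_ob)
    : {pred (hom (cA M) (cA N) * hom (cB M) (cB N))%type} :=
  fun m => cphi N ∘ fmap T m.2 == m.1 ∘ cphi M.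
Arguments comma_sq : clear implicits.

Fact comma_sq_zmod_closed (M N : comma_ob) : zmod_closed (comma_sq M N).
Proof.
split=> [|u v]; rewrite !unfold_in /comma_sq.
  by rewrite fmap0 compm0 comp0m.
by move=> /eqP uP /eqP vP; rewrite /= fmapB compBr compBl uP vP.
Qed.
HB.instance Definition _ (M N : comma_ob) :=
  GRing.isZmodClosed.Build _ (comma_sq M N) (comma_sq_zmod_closed M N).

Record comma_hom (M N : comma_ob) := CommaHom {
  comma_val : (hom (cA M) (cA N) * hom (cB M) (cB N))%type;
  _ : comma_val \in comma_sq M N
}.
HB.instance Definition _ (M N : comma_ob) := [isSub for @comma_val M N].
HB.instance Definition _ (M N : comma_ob) := [Choice of comma_hom M N by <:].
HB.instance Definition _ (M N : comma_ob) :=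
  [SubChoice_isSubZmodule of comma_hom M N by <:].

Definition homA (M N : comma_ob) (m : comma_hom M N) := (comma_val m).1.
Definition homB (M N : comma_ob) (m : comma_hom M N) := (comma_val m).2.

Lemma comma_homP (M N : comma_ob) (m : comma_hom M N) :
  cphi N ∘ fmap T (homB m) = homA m ∘ cphi M.
Proof. by case: m => v vP; apply/eqP. Qed.

Lemma comma_hom_eq (M N : comma_ob) (m n : comma_hom M N) :
  homA m = homA n -> homB m = homB n -> m = n.
Proof.
move=> eA eB; apply/val_inj => /=.
by rewrite [comma_val m]surjective_pairing [comma_val n]surjective_pairing;
   congr pair.
Qed.

Fact comma_id_subproof (M : comma_ob) :
  (idm (cA M), idm (cB M)) \in comma_sq M M.
Proof. by rewrite unfold_in /comma_sq /= fmap1 compm1 comp1m. Qed.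

Fact comma_comp_subproof (M N P : comma_ob) (g : comma_hom N P)
    (f : comma_hom M N) :
  (homA g ∘ homA f, homB g ∘ homB f) \in comma_sq M P.
Proof.
by rewrite unfold_in /comma_sq /= fmapM compA comma_homP -!compA comma_homP.
Qed.

Program Definition comma : precat := @Precat comma_ob
  (fun M N => (comma_hom M N : zmodType))
  (fun M => CommaHom (comma_id_subproof M))
  (fun M N P g f => CommaHom (comma_comp_subproof g f))
  _ _ _ _ _.
Next Obligation. by apply: comma_hom_eq; apply: compA. Qed.
Next Obligation. by apply: comma_hom_eq; apply: comp1m. Qed.
Next Obligation. by apply: comma_hom_eq; apply: compm1. Qed.
Next Obligation. by apply: comma_hom_eq; apply: compDl. Qed.
Next Obligation. by apply: comma_hom_eq; apply: compDr. Qed.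

End Comma.

Definition frakB (B A : abelian) (T : functor B A)
    (X : A -> Prop) (Y : B -> Prop) (M : comma T) : Prop :=
  [/\ Y (cB M), mono (cphi M) & X (coker (cphi M))].
Arguments frakB {B A} T X Y M.

(* The subgroup generated by the morphisms that factor through W. For a left
   Frobenius pair W is closed under finite direct sums, and these morphisms
   already form a subgroup. *)
Inductive null (C : precat) (W : C -> Prop) (x y : C) : hom x y -> Prop :=
| null_factor w (g : hom w y) (f : hom x w) : W w -> null W (g ∘ f)
| null_zero : null W 0
| null_sub f g : null W f -> null W g -> null W (f - g).

Section Stable.
Variables (C : precat) (X W : C -> Prop).

Definition nullb (x y : C) : {pred hom x y} := fun f => `[< null W f >].

Fact nullb_zmod_closed (x y : C) : zmod_closed (@nullb x y).
Proof.
split=> [|f g]; rewrite !unfold_in; first exact/asboolP/null_zero.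
by move=> /asboolP fP /asboolP gP; apply/asboolP/null_sub.
Qed.
HB.instance Definition _ (x y : C) :=
  GRing.isZmodClosed.Build _ (@nullb x y) (@nullb_zmod_closed x y).

Definition stable_hom (x y : C) : zmodType := Quotient.quot (@nullb x y).

Definition cls (x y : C) (f : hom x y) : stable_hom x y :=
  \pi_(stable_hom x y) f.

Lemma clsP (x y : C) (f g : hom x y) : cls f = cls g <-> null W (f - g).
Proof.
split=> [/eqP|fgP]; first by rewrite -Quotient.idealrBE => /asboolP.
by apply/eqP; rewrite -Quotient.idealrBE; apply/asboolP.
Qed.

Lemma cls_surj (x y : C) (q : stable_hom x y) : exists f, cls f = q.
Proof. by exists (repr q); rewrite /cls reprK. Qed.

Lemma clsD (x y : C) (f g : hom x y) : cls (f + g) = cls f + cls g.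
Proof. by rewrite /cls !piE. Qed.

Lemma null_compl (x y z : C) (g : hom y z) (f : hom x y) :
  null W f -> null W (g ∘ f).
Proof.
elim=> [w h k Ww||h k _ IHh _ IHk]; first by rewrite compA; apply: null_factor.
  by rewrite compm0; apply: null_zero.
by rewrite compBr; apply: null_sub.
Qed.

Lemma null_compr (x y z : C) (g : hom y z) (f : hom x y) :
  null W g -> null W (g ∘ f).
Proof.
elim=> [w h k Ww||h k _ IHh _ IHk]; first by rewrite -compA; apply: null_factor.
  by rewrite comp0m; apply: null_zero.
by rewrite compBl; apply: null_sub.
Qed.

Lemma null_opp (x y : C) (f : hom x y) : null W f -> null W (- f).
Proof. by rewrite -sub0r; apply: null_sub => //; apply: null_zero. Qed.

Lemma null_add (x y : C) (f g : hom x y) :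
  null W f -> null W g -> null W (f + g).
Proof. by move=> fP gP; rewrite -[g]opprK; apply/null_sub/null_opp. Qed.

Definition stable_comp (x y z : C) (g : stable_hom y z) (f : stable_hom x y)
  : stable_hom x z := cls (repr g ∘ repr f).

Lemma stable_compE (x y z : C) (g : hom y z) (f : hom x y) :
  stable_comp (cls g) (cls f) = cls (g ∘ f).
Proof.
apply/clsP.
have gP : null W (repr (cls g) - g) by apply/clsP; rewrite /cls reprK.
have fP : null W (repr (cls f) - f) by apply/clsP; rewrite /cls reprK.
have -> : repr (cls g) ∘ repr (cls f) - g ∘ f =
  (repr (cls g) - g) ∘ repr (cls f) + g ∘ (repr (cls f) - f).
  by rewrite compBl compBr addrA subrK.
by apply: null_add; [apply: null_compr | apply: null_compl].
Qed.

Program Definition stable : precat := @Precat {x : C | X x}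
  (fun x y => stable_hom (sval x) (sval y))
  (fun x => cls (idm (sval x)))
  (fun x y z g f => stable_comp g f)
  _ _ _ _ _.
Next Obligation.
have [[h0 <-] [g0 <-] [f0 <-]] := And3 (cls_surj h) (cls_surj g) (cls_surj f).
by rewrite !stable_compE compA.
Qed.
Next Obligation. by have [f0 <-] := cls_surj f; rewrite stable_compE comp1m. Qed.
Next Obligation. by have [f0 <-] := cls_surj f; rewrite stable_compE compm1. Qed.
Next Obligation.
have [[g0 <-] [h0 <-] [f0 <-]] := And3 (cls_surj g) (cls_surj g') (cls_surj f).
by rewrite -clsD !stable_compE compDl clsD.
Qed.
Next Obligation.
have [[g0 <-] [h0 <-] [f0 <-]] := And3 (cls_surj g) (cls_surj f) (cls_surj f').
by rewrite -clsD !stable_compE compDr clsD.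
Qed.

Definition scls (x y : stable) (f : hom (sval x) (sval y)) : hom x y := cls f.

End Stable.
Arguments cls {C} W {x y} f.
Arguments scls {C} X W {x y} f.

(* The functor X/W -> X'/W' induced by an assignment F0 on the objects of X and
   a relation R between morphisms in X and morphisms in D: it sends x to F0 x
   and the class of f to the class of any g with R f g. Since F0 and R do
   not see the membership proofs, the fact that F0 takes its values in X' is a
   field. *)
Record induced_functor (C D : precat) (X W : C -> Prop) (X' W' : D -> Prop)
    (F0 : {x : C | X x} -> D)
    (R : forall x y : {x : C | X x},
           hom (sval x) (sval y) -> hom (F0 x) (F0 y) -> Prop)
  := InducedFunctor {
  if_mem : forall x, X' (F0 x);
  if_ob := fun x : stable X W => exist X' (F0 x) (if_mem x) : stable X' W';
  if_map : forall x y : stable X W, hom x y -> hom (if_ob x) (if_ob y);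
  if_map1 : forall x, if_map (idm x) = idm (if_ob x);
  if_mapM : forall (x y z : stable X W) (g : hom y z) (f : hom x y),
    if_map (g ∘ f) = if_map g ∘ if_map f;
  if_mapD : forall (x y : stable X W) (f g : hom x y),
    if_map (f + g) = if_map f + if_map g;
  if_exists : forall (x y : stable X W) (f : hom (sval x) (sval y)),
    exists g, R x y f g;
  if_cls : forall (x y : stable X W) (f : hom (sval x) (sval y))
      (g : hom (F0 x) (F0 y)),
    R x y f g -> if_map (scls X W f) = scls X' W' (x := if_ob x) (y := if_ob y) g
}.

Definition induced (C D : precat) (X W : C -> Prop) (X' W' : D -> Prop) F0 R
    (F : @induced_functor C D X W X' W' F0 R)
    : functor (stable X W) (stable X' W') :=
  Functor (if_map1 F) (if_mapM F) (if_mapD F).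
Coercion induced : induced_functor >-> functor.

Record candidate := Candidate {
  ccat :> precat;
  Susp : functor ccat ccat;
  Delta : forall a b c : ccat, hom a b -> hom b c -> hom c (Susp a) -> Prop
}.
Arguments Susp : clear implicits.
Arguments Delta {c} {a b c} _ _ _ : rename.

Section Triangles.
Variable C : candidate.
Local Notation S := (Susp C).

Definition tr_iso : Prop :=
  forall (a b c a' b' c' : C)
    (f : hom a b) (g : hom b c) (h : hom c (S a))
    (f' : hom a' b') (g' : hom b' c') (h' : hom c' (S a'))
    (u : hom a a') (v : hom b b') (w : hom c c'),
  is_iso u -> is_iso v -> is_iso w ->
  f' ∘ u = v ∘ f -> g' ∘ v = w ∘ g -> h' ∘ w = fmap S u ∘ h ->
  Delta f g h -> Delta f' g' h'.

Definition tr_id : Prop :=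
  forall a z : C, is_zero z ->
  Delta (idm a) (0 : hom a z) (0 : hom z (S a)).

Definition tr_cone : Prop :=
  forall (a b : C) (f : hom a b),
  exists (c : C) (g : hom b c) (h : hom c (S a)), Delta f g h.

(* Only this direction of the rotation axiom makes sense for a suspension that
   is not an equivalence; the converse is part of [triangulated]. *)
Definition tr_rotate : Prop :=
  forall (a b c : C) (f : hom a b) (g : hom b c) (h : hom c (S a)),
  Delta f g h -> Delta g h (- fmap S f).

Definition tr_rotate_back : Prop :=
  forall (a b c : C) (f : hom a b) (g : hom b c) (h : hom c (S a)),
  Delta g h (- fmap S f) -> Delta f g h.

Definition tr_morphism : Prop :=
  forall (a b c a' b' c' : C)
    (f : hom a b) (g : hom b c) (h : hom c (S a))
    (f' : hom a' b') (g' : hom b' c') (h' : hom c' (S a'))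
    (u : hom a a') (v : hom b b'),
  Delta f g h -> Delta f' g' h' -> f' ∘ u = v ∘ f ->
  exists w : hom c c', g' ∘ v = w ∘ g /\ h' ∘ w = fmap S u ∘ h.

Definition tr_octahedron : Prop :=
  forall (a b c z y x : C)
    (f : hom a b) (j : hom b z) (k : hom z (S a))
    (g : hom b c) (l : hom c x) (i : hom x (S b))
    (m : hom c y) (n : hom y (S a)),
  Delta f j k -> Delta g l i -> Delta (g ∘ f) m n ->
  exists (p : hom z y) (q : hom y x),
    [/\ Delta p q (fmap S j ∘ i),
        p ∘ j = m ∘ g, n ∘ p = k, q ∘ m = l & i ∘ q = fmap S f ∘ n].

Definition right_triangulated : Prop :=
  additive_category C /\
  [/\ tr_iso, tr_id /\ tr_cone, tr_rotate, tr_morphism & tr_octahedron].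

End Triangles.

Definition equivalence (C D : precat) (F : functor C D) : Prop :=
  exists (G : functor D C)
    (eta : forall x : C, hom x (G (F x)))
    (eps : forall y : D, hom (F (G y)) y),
  [/\ forall x, is_iso (eta x), forall y, is_iso (eps y),
      forall (x x' : C) (f : hom x x'), eta x' ∘ f = fmap G (fmap F f) ∘ eta x
    & forall (y y' : D) (g : hom y y'), eps y' ∘ fmap F (fmap G g) = g ∘ eps y].

Definition triangulated (C : candidate) : Prop :=
  [/\ right_triangulated C, equivalence (Susp C) & tr_rotate_back C].

Definition right_triangle_functor (C D : candidate) (F : functor C D) : Prop :=
  exists phi : forall x : C, hom (F (Susp C x)) (Susp D (F x)),
  [/\ forall x, is_iso (phi x),
      forall (x y : C) (f : hom x y),
        phi y ∘ fmap F (fmap (Susp C) f) = fmap (Susp D) (fmap F f) ∘ phi x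
    & forall (a b c : C) (f : hom a b) (g : hom b c) (h : hom c (Susp C a)),
        Delta f g h -> Delta (fmap F f) (fmap F g) (phi a ∘ fmap F h)].

Definition adjoint (C D : precat) (L : functor C D) (R : functor D C) : Prop :=
  exists (eta : forall x : C, hom x (R (L x)))
         (eps : forall y : D, hom (L (R y)) y),
  [/\ forall (x x' : C) (f : hom x x'), eta x' ∘ f = fmap R (fmap L f) ∘ eta x,
      forall (y y' : D) (g : hom y y'), eps y' ∘ fmap L (fmap R g) = g ∘ eps y,
      forall x, eps (L x) ∘ fmap L (eta x) = \id
    & forall y, fmap R (eps y) ∘ eta (R y) = \id].

Definition fully_faithful (C D : precat) (F : functor C D) : Prop :=
  forall x y : C, bijective (fun f : hom x y => fmap F f).

Definition recollement (A' C B' : candidate)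
    (i : functor A' C) (q p : functor C A')
    (e : functor C B') (l r : functor B' C) : Prop :=
  [/\ [/\ right_triangulated A', right_triangulated C & right_triangulated B'],
      [/\ right_triangle_functor i, right_triangle_functor e,
          right_triangle_functor q /\ right_triangle_functor p
        & right_triangle_functor l /\ right_triangle_functor r],
      [/\ adjoint q i, adjoint i p, adjoint l e & adjoint e r],
      [/\ fully_faithful i, fully_faithful l & fully_faithful r]
    & forall c : C, (exists a : A', isomorphic (i a) c) <-> is_zero (e c)].

Definition triangulated_recollement (A' C B' : candidate)
    (i : functor A' C) (q p : functor C A')
    (e : functor C B') (l r : functor B' C) : Prop :=
  recollement i q p e l r /\
  [/\ triangulated A', triangulated C & triangulated B'].

(* A choice of an exact sequence 0 -> x -> W -> Σ x -> 0 for each x in X. *)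
Record cosyzygies (C : precat) (X W : C -> Prop) := Cosyzygies {
  cs_W : {x : C | X x} -> C;
  cs_S : {x : C | X x} -> C;
  cs_i : forall x, hom (sval x) (cs_W x);
  cs_p : forall x, hom (cs_W x) (cs_S x);
  cs_exact : forall x, short_exact (cs_i x) (cs_p x);
  cs_inW : forall x, W (cs_W x);
  cs_inX : forall x, X (cs_S x)
}.

Section StableTriangles.
Variables (C : precat) (X W : C -> Prop) (ch : cosyzygies X W).

(* The class of f is sent to the class of any b that fits into a morphism
   (f, a, b) between the chosen sequences. *)
Definition shift_rel (x y : {x : C | X x}) (f : hom (sval x) (sval y))
    (b : hom (cs_S ch x) (cs_S ch y)) : Prop :=
  exists a : hom (cs_W ch x) (cs_W ch y),
    a ∘ cs_i ch x = cs_i ch y ∘ f /\ b ∘ cs_p ch x = cs_p ch y ∘ a.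

Definition stable_shift := @induced_functor C C X W X W (cs_S ch) shift_rel.

Variable S : stable_shift.

(* The triangle is isomorphic to the one given by a short exact sequence
   0 -> x1 -> x2 -> x3 -> 0 with terms in X. *)
Definition stable_Delta (a b c : stable X W)
    (f : hom a b) (g : hom b c) (h : hom c (S a)) : Prop :=
  exists (x1 x2 x3 : stable X W)
    (f0 : hom (sval x1) (sval x2)) (g0 : hom (sval x2) (sval x3))
    (a0 : hom (sval x2) (cs_W ch x1)) (b0 : hom (sval x3) (cs_S ch x1)),
  [/\ short_exact f0 g0, a0 ∘ f0 = cs_i ch x1 & b0 ∘ g0 = cs_p ch x1 ∘ a0] /\
  exists (u : hom x1 a) (v : hom x2 b) (w : hom x3 c),
  [/\ [/\ is_iso u, is_iso v & is_iso w],
      f ∘ u = v ∘ scls X W f0, g ∘ v = w ∘ scls X W g0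
    & h ∘ w = fmap S u ∘ scls X W (x := x3) (y := S x1) b0].

Definition stableT : candidate := Candidate stable_Delta.

End StableTriangles.

(* A choice of an exact sequence 0 -> T y -> W -> Coker σ -> 0 for y in Y. *)
Record s_choice (B A : abelian) (T : functor B A) (X W : A -> Prop)
    (Y : B -> Prop) := SChoice {
  s_W : {y : B | Y y} -> A;
  s_sigma : forall y, hom (T (sval y)) (s_W y);
  s_mono : forall y, mono (s_sigma y);
  s_inW : forall y, W (s_W y);
  s_coker : forall y, X (coker (s_sigma y))
}.

Section Functors.
Variables (B A : abelian) (T : functor B A) (W X : A -> Prop) (V Y : B -> Prop).
Variable sc : s_choice T X W Y.

Let BXY := frakB T X Y.
Let BWV := frakB T W V.

Definition Z_functor :=
  @induced_functor A (comma T) X W BXY BWV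
    (fun x => @CommaOb B A T (sval x) (zob B) 0)
    (fun _ _ f m => homA m = f).

Definition q_functor :=
  @induced_functor (comma T) A BXY BWV X W
    (fun M => coker (cphi (sval M)))
    (fun M N m c => c ∘ cokerm (cphi (sval M)) = cokerm (cphi (sval N)) ∘ homA m).

Definition UA_functor :=
  @induced_functor (comma T) A BXY BWV X W
    (fun M => cA (sval M)) (fun _ _ m a => a = homA m).

Definition UB_functor :=
  @induced_functor (comma T) B BXY BWV Y V
    (fun M => cB (sval M)) (fun _ _ m b => b = homB m).

Definition TB_functor :=
  @induced_functor B (comma T) Y V BXY BWV
    (fun y => @CommaOb B A T (T (sval y)) (sval y) \id)
    (fun _ _ g m => homA m = fmap T g /\ homB m = g).

(* Being a morphism of the comma category, m satisfies homA m ∘ σ = σ' ∘ T g. *)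
Definition s_functor :=
  @induced_functor B (comma T) Y V BXY BWV
    (fun y => @CommaOb B A T (s_W sc y) (sval y) (s_sigma sc y))
    (fun _ _ g m => homB m = g).

End Functors.

(* Main.v *)
From mathcomp Require Import all_boot ssralg boolp.
Require Import Defs.

Set Implicit Arguments.
Unset Strict Implicit.
Unset Printing Implicit Defensive.

Import GRing.Theory.
Local Open Scope ring_scope.

(** The stable category X/W of a Frobenius pair, and each of the six functors,
    can be handled with few properties of the pair: X is closed under
    extensions, and W is injective relative to X, that is, morphisms into
    objects of W extend along monomorphisms with cokernel in X. These are
    collected in the record cogenerated.

    Relative injectivity makes the connecting morphism of a short exact sequence
    well defined and natural in the stable category (connecting_natural). The
    axioms of a right triangulated category then come down to pushouts, to
    pullbacks and to the third isomorphism theorem in an abelian category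
    (stable_right_triangulated). For a strong pair W is also projective relative
    to X, so that morphisms between suspensions come from morphisms between the
    original objects: the suspension is an equivalence, and triangles can be
    rotated back (stable_triangulated).

    To apply this to the comma category, one shows that it is abelian with
    componentwise exactness (comma_seP), which uses that T is right exact, and
    that the pair of subcategories 𝔅 inherits relative injectivity, relative
    projectivity and enough embeddings or covers (frakB_cogenerated,
    frakB_embedding, frakB_WV_projective, frakB_generated). Extensions are
    constructed directly on the two components, so Ext in the comma category is
    never computed. The vanishing of the first left derived functor enters
    through T_exact: T preserves short exact sequences whose last term is in 𝒴.

    An exact functor that maps W to W' induces a right triangle functor
    (exact_functor_triangle). This covers five of the six functors. The sixth,
    the right adjoint s of e = U_B, depends on choices and is treated formally:
    an object lies in its essential image as soon as p = U_A kills it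
    (UB_s_unit_iso), and as e and p preserve right triangles, so does s
    (right_adjoint_triangle). The adjunctions hold already at the level of the
    comma category, except for the pair (e, s), where two morphisms into an
    object with first component in W are equal in the stable category when they
    agree on the second component (homB_null). *)

(** * Monomorphisms, epimorphisms and isomorphisms *)

Section Preadditive.
Variable C : precat.

Lemma comp_post (x y z t : C) (g : hom y z) (f : hom x y) (h : hom x z)
    (k : hom t x) : g ∘ f = h -> g ∘ (f ∘ k) = h ∘ k.
Proof. by move=> <-; rewrite compA. Qed.

Lemma compNl (x y z : C) (g : hom y z) (f : hom x y) : (- g) ∘ f = - (g ∘ f).
Proof. by rewrite -[- g]sub0r compBl comp0m sub0r. Qed.

Lemma compNr (x y z : C) (g : hom y z) (f : hom x y) : g ∘ (- f) = - (g ∘ f).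
Proof. by rewrite -[- f]sub0r compBr compm0 sub0r. Qed.

Lemma fmapN (D : precat) (F : functor C D) (x y : C) (f : hom x y) :
  fmap F (- f) = - fmap F f.
Proof. by rewrite -[- f]sub0r fmapB fmap0 sub0r. Qed.

Lemma mono0P (x y : C) (f : hom x y) :
  mono f <-> (forall z (u : hom z x), f ∘ u = 0 -> u = 0).
Proof.
split=> [fm z u fu0|f0 z u v fuv]; first by apply: fm; rewrite fu0 compm0.
by apply/subr0_eq/f0; rewrite compBr fuv subrr.
Qed.

Lemma epi0P (x y : C) (f : hom x y) :
  epi f <-> (forall z (u : hom y z), u ∘ f = 0 -> u = 0).
Proof.
split=> [fe z u fu0|f0 z u v fuv]; first by apply: fe; rewrite fu0 comp0m.
by apply/subr0_eq/f0; rewrite compBl fuv subrr.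
Qed.

Lemma mono_comp (x y z : C) (g : hom y z) (f : hom x y) :
  mono g -> mono f -> mono (g ∘ f).
Proof. by move=> gm fm t u v; rewrite -!compA => /gm/fm. Qed.

Lemma epi_comp (x y z : C) (g : hom y z) (f : hom x y) :
  epi g -> epi f -> epi (g ∘ f).
Proof. by move=> ge fe t u v; rewrite !compA => /fe/ge. Qed.

Lemma epi_left (x y z : C) (g : hom y z) (f : hom x y) :
  epi (g ∘ f) -> epi g.
Proof. by move=> ge t u v uv; apply: ge; rewrite !compA uv. Qed.

Lemma mono_right (x y z : C) (g : hom y z) (f : hom x y) :
  mono (g ∘ f) -> mono f.
Proof. by move=> ge t u v uv; apply: ge; rewrite -!compA uv. Qed.

Lemma epi_id (x : C) : epi (idm x).
Proof. by move=> t u v; rewrite !compm1. Qed.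

Lemma mono_id (x : C) : mono (idm x).
Proof. by move=> t u v; rewrite !comp1m. Qed.

Lemma kernel_mono (x y k : C) (f : hom x y) (m : hom k x) :
  is_kernel f m -> mono m.
Proof.
move=> [fm0 fK] z u v muv.
have [|w [_ wU]] := fK z (m ∘ v); first by rewrite compA fm0 comp0m.
by rewrite -(wU u muv) (wU v erefl).
Qed.

Lemma cokernel_epi (x y c : C) (f : hom x y) (p : hom y c) :
  is_cokernel f p -> epi p.
Proof.
move=> [pf0 pK] z u v upv.
have [|w [_ wU]] := pK z (v ∘ p); first by rewrite -compA pf0 compm0.
by rewrite -(wU u upv) (wU v erefl).
Qed.

Lemma is_iso_id (x : C) : is_iso (idm x).
Proof. by exists (idm x); rewrite comp1m. Qed.

Lemma is_iso_comp (x y z : C) (g : hom y z) (f : hom x y) :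
  is_iso g -> is_iso f -> is_iso (g ∘ f).
Proof.
move=> [g' [g'g gg']] [f' [f'f ff']]; exists (f' ∘ g'); split.
  by rewrite -compA (comp_post _ g'g) comp1m.
by rewrite -compA (comp_post _ ff') comp1m.
Qed.

Lemma iso_mono (x y : C) (f : hom x y) : is_iso f -> mono f.
Proof.
by move=> [g [gf _]] z u v fuv; rewrite -[u]comp1m -[v]comp1m -gf -!compA fuv.
Qed.

Lemma iso_epi (x y : C) (f : hom x y) : is_iso f -> epi f.
Proof.
by move=> [g [_ fg]] z u v fuv; rewrite -[u]compm1 -[v]compm1 -fg !compA fuv.
Qed.

Lemma fmap_iso (D : precat) (F : functor C D) (x y : C) (f : hom x y) :
  is_iso f -> is_iso (fmap F f).
Proof.
by move=> [g [gf fg]]; exists (fmap F g); rewrite -!fmapM gf fg !fmap1.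
Qed.

Lemma is_zeroP (x : C) : is_zero x <-> idm x = 0.
Proof.
split=> [[x0 _]|x0]; first exact: x0.
split=> y f; first by rewrite -[f]compm1 x0 compm0.
by rewrite -[f]comp1m x0 comp0m.
Qed.

Lemma is_zero_iso (x y : C) (f : hom x y) : is_iso f -> is_zero x -> is_zero y.
Proof.
move=> [g [_ fg]] /is_zeroP x0; apply/is_zeroP.
by rewrite -fg -[g]comp1m x0 comp0m compm0.
Qed.

Lemma se_mono (x y z : C) (f : hom x y) (g : hom y z) :
  short_exact f g -> mono f.
Proof. by case=> /kernel_mono. Qed.

Lemma se_epi (x y z : C) (f : hom x y) (g : hom y z) :
  short_exact f g -> epi g.
Proof. by case=> _ /cokernel_epi. Qed.

Lemma se_comp0 (x y z : C) (f : hom x y) (g : hom y z) :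
  short_exact f g -> g ∘ f = 0.
Proof. by case=> [[]]. Qed.

Lemma se_lift (x y z : C) (f : hom x y) (g : hom y z) t (u : hom t y) :
  short_exact f g -> g ∘ u = 0 -> exists v, f ∘ v = u.
Proof. by case=> [[_ fK] _] /fK [v [vP _]]; exists v. Qed.

Lemma se_colift (x y z : C) (f : hom x y) (g : hom y z) t (u : hom y t) :
  short_exact f g -> u ∘ f = 0 -> exists v, v ∘ g = u.
Proof. by case=> [_ [_ gK]] /gK [v [vP _]]; exists v. Qed.

Lemma coker_colift (x y z : C) (f : hom x y) (g : hom y z) t (u : hom y t) :
  is_cokernel f g -> u ∘ f = 0 -> exists v, v ∘ g = u.
Proof. by case=> [_ gK] /gK [v [vP _]]; exists v. Qed.

Lemma is_kernel_intro (x y z : C) (f : hom x y) (g : hom y z) :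
  mono f -> g ∘ f = 0 ->
  (forall t (u : hom t y), g ∘ u = 0 -> exists v, f ∘ v = u) -> is_kernel g f.
Proof.
move=> fm gf0 fK; split=> // t u /fK [v vP]; exists v; split=> // v' v'P.
by apply: fm; rewrite vP.
Qed.

Lemma is_cokernel_intro (x y z : C) (f : hom x y) (g : hom y z) :
  epi g -> g ∘ f = 0 ->
  (forall t (u : hom y t), u ∘ f = 0 -> exists v, v ∘ g = u) ->
  is_cokernel f g.
Proof.
move=> ge gf0 gK; split=> // t u /gK [v vP]; exists v; split=> // v' v'P.
by apply: ge; rewrite vP.
Qed.

End Preadditive.

(** * Diagram chases in abelian categories *)

Section AbelianChase.
Variable C : abelian.

Lemma mono_kernel_coker (x y : C) (f : hom x y) :
  mono f -> is_kernel (cokerm f) f.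
Proof.
move=> fm; apply: is_kernel_intro => //; first by case: (cokerP f).
move=> t u cu0; have [z [g [gf0 gK]]] := mono_is_kernel fm.
have [g' g'P] := coker_colift (cokerP f) gf0.
have [|v [vP _]] := gK t u; last by exists v.
by rewrite -g'P -compA cu0 compm0.
Qed.

Lemma epi_cokernel_ker (x y : C) (f : hom x y) :
  epi f -> is_cokernel (kerm f) f.
Proof.
move=> fe; apply: is_cokernel_intro => //; first by case: (kerP f).
move=> t u cu0; have [z [g [gf0 gK]]] := epi_is_cokernel fe.
have [_ /(_ _ _ gf0) [g' [g'P _]]] := kerP f.
have [|v [vP _]] := gK t u; last by exists v.
by rewrite -g'P compA cu0 comp0m.
Qed.

Lemma se_intro (x y z : C) (f : hom x y) (g : hom y z) :
  mono f -> epi g -> g ∘ f = 0 ->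
  (forall t (u : hom t y), g ∘ u = 0 -> exists v, f ∘ v = u) -> short_exact f g.
Proof.
move=> fm ge gf0 fK; split; first exact: is_kernel_intro.
apply: is_cokernel_intro => // t u uf0.
have [v vP] := fK _ (kerm g) (proj1 (kerP g)).
by apply: (coker_colift (epi_cokernel_ker ge)); rewrite -vP compA uf0 comp0m.
Qed.

Lemma mono_se (x y : C) (f : hom x y) : mono f -> short_exact f (cokerm f).
Proof. by move/mono_kernel_coker; split=> //; apply: cokerP. Qed.

Lemma epi_se (x y : C) (f : hom x y) : epi f -> short_exact (kerm f) f.
Proof. by move/epi_cokernel_ker; split=> //; apply: kerP. Qed.

(** Epimorphisms are stable under pullback, so a generalized element of the
    target of an epimorphism lifts along it after passing to a cover of its
    domain. This is what makes diagram chases possible. *)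
Lemma epi_cover (x y t : C) (e : hom x y) (z : hom t y) : epi e ->
  exists (t' : C) (c : hom t' t) (z' : hom t' x), epi c /\ e ∘ z' = z ∘ c.
Proof.
move=> ee; have [b [i1 [i2 [p1 [p2 [p11 p22 p12 p21 b1]]]]]] := dsumP x t.
pose d := e ∘ p1 - z ∘ p2.
have di1 : d ∘ i1 = e by rewrite compBl -!compA p11 p21 compm1 compm0 subr0.
have de : epi d by apply: (@epi_left _ _ _ _ _ i1); rewrite di1.
exists (ker d), (p2 ∘ kerm d), (p1 ∘ kerm d); split; last first.
  by apply/subr0_eq; rewrite !compA -compBl; case: (kerP d).
apply/epi0P => s u uk0.
have [|v vP] := @coker_colift _ _ _ _ _ _ _ (u ∘ p2) (epi_cokernel_ker de).
  by rewrite -compA.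
have v0 : v = 0.
  by apply/(proj1 (epi0P _) ee); rewrite -di1 compA vP -compA p21 compm0.
by rewrite -[u]compm1 -p22 compA -vP v0 !comp0m.
Qed.

(** f is the kernel of its cokernel, and whether z dies in that cokernel can be
    tested on a cover. *)
Lemma mono_cover (x y t s : C) (f : hom x y) (z : hom t y) (c : hom s t) v :
  mono f -> epi c -> f ∘ v = z ∘ c -> exists v', f ∘ v' = z.
Proof.
move=> fm /epi0P ce fv; apply: (se_lift (mono_se fm)); apply: ce.
by rewrite -compA -fv compA (se_comp0 (mono_se fm)) comp0m.
Qed.

Lemma se_cover (x y z t : C) (f : hom x y) (g : hom y z) (u : hom t z) :
  short_exact f g ->
  exists (t' : C) (c : hom t' t) (u' : hom t' y), epi c /\ g ∘ u' = u ∘ c.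
Proof. by move/se_epi/epi_cover. Qed.

Lemma epi_zero (x y z : C) (f : hom x y) (u : hom y z) :
  epi f -> u ∘ f = 0 -> u = 0.
Proof. by move/epi0P; apply. Qed.

Lemma mono_zero (x y z : C) (f : hom x y) (u : hom z x) :
  mono f -> f ∘ u = 0 -> u = 0.
Proof. by move/mono0P; apply. Qed.

Lemma exact_cover (x y z : C) (f : hom x y) (g : hom y z) : exact f g ->
  g ∘ f = 0 /\ forall t (u : hom t y), g ∘ u = 0 ->
    exists t' (c : hom t' t) u', epi c /\ f ∘ u' = u ∘ c.
Proof.
move=> [u [<- [p pP]]]; have [gk0 gK] := kerP g; split.
  by rewrite compA gk0 comp0m.
have ue : epi u.
  apply/epi0P => s v /(coker_colift pP) [w <-].
  by rewrite (proj1 (zobP C) _ w) comp0m.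
move=> t v /gK [v0 [<- _]]; have [t' [c [v' [ce uv]]]] := epi_cover v0 ue.
by exists t', c, v'; rewrite -compA uv compA.
Qed.

Lemma cokernel_by_cover (x y z : C) (f : hom x y) (g : hom y z) :
  epi g -> g ∘ f = 0 ->
  (forall t (u : hom t y), g ∘ u = 0 ->
    exists t' (c : hom t' t) u', epi c /\ f ∘ u' = u ∘ c) -> is_cokernel f g.
Proof.
move=> ge gf0 fK; apply: is_cokernel_intro => // t u uf0.
apply: (coker_colift (epi_cokernel_ker ge)).
have [s [c [v [ce fv]]]] := fK _ (kerm g) (proj1 (kerP g)).
by apply: (epi_zero ce); rewrite -compA -fv compA uf0 comp0m.
Qed.

(** If u vanishes on the image of e, then f factors through the smaller subobject
    ker u of ker p; the cokernel of ker u then kills f, hence kills ker p, so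
    that ker u is all of ker p. *)
Lemma cokernel_image (x y z : C) (f : hom x y) (p : hom y z) :
  is_cokernel f p -> exists e : hom x (ker p), epi e /\ kerm p ∘ e = f.
Proof.
move=> fp; have [kp0 kK] := kerP p.
have [e [eP _]] := kK _ f (proj1 fp); exists e; split=> //.
apply/epi0P => s u ue0; have [_ uK] := kerP u.
have [e' [e'P _]] := uK _ e ue0.
have km : mono (kerm p ∘ kerm u).
  by apply: mono_comp; apply: kernel_mono; apply: kerP.
have ce := mono_se km; set c := cokerm _ in ce.
have [|c' c'P] := @coker_colift _ _ _ _ _ _ _ c fp.
  by rewrite -eP -e'P [kerm p ∘ (_ ∘ _)]compA compA (se_comp0 ce) comp0m.
have [|t tP] := @se_lift _ _ _ _ _ _ _ (kerm p) ce.
  by rewrite -c'P -compA kp0 compm0.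
have kt : kerm u ∘ t = \id.
  by apply: (kernel_mono (kerP p)); rewrite compA tP compm1.
by rewrite -[u]compm1 -kt compA (proj1 (kerP u)) comp0m.
Qed.

Lemma cokernel_cover (x y z t : C) (f : hom x y) (p : hom y z) (u : hom t y) :
  is_cokernel f p -> p ∘ u = 0 ->
  exists t' (c : hom t' t) u', epi c /\ f ∘ u' = u ∘ c.
Proof.
move=> /cokernel_image [e [ee eP]] /(proj2 (kerP p) _ _) [v [<- _]].
have [t' [c [u' [ce eu]]]] := epi_cover v ee.
by exists t', c, u'; rewrite -eP -!compA eu.
Qed.

Lemma exact_cokernel (x y z : C) (f : hom x y) (g : hom y z) :
  exact f g -> epi g -> is_cokernel f g.
Proof.
by move=> /exact_cover [gf0 fK] ge; apply: cokernel_by_cover.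
Qed.

Lemma biprod_ext (x y b t : C) (i1 : hom x b) (i2 : hom y b) (p1 : hom b x)
    (p2 : hom b y) (u v : hom t b) :
  is_biproduct i1 i2 p1 p2 -> p1 ∘ u = p1 ∘ v -> p2 ∘ u = p2 ∘ v -> u = v.
Proof.
move=> [_ _ _ _ b1] e1 e2.
by rewrite -[u]comp1m -[v]comp1m -b1 !compDl -!compA e1 e2.
Qed.

(** The third isomorphism theorem; it is the octahedral axiom before passing to
    the stable category. *)
Lemma se_third (a b c z y x : C) (f : hom a b) (j : hom b z) (g : hom b c)
    (l : hom c x) (m : hom c y) :
  short_exact f j -> short_exact g l -> short_exact (g ∘ f) m ->
  exists (p : hom z y) (q : hom y x),
    [/\ p ∘ j = m ∘ g, q ∘ m = l & short_exact p q].
Proof.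
move=> fj gl gfm.
have [|p pj] := @se_colift _ _ _ _ _ _ _ (m ∘ g) fj.
  by rewrite -compA (se_comp0 gfm).
have [|q qm] := @se_colift _ _ _ _ _ _ _ l gfm.
  by rewrite compA (se_comp0 gl) comp0m.
have pm : mono p.
  apply/mono0P => t u pu0; have [t' [e [v [ee jv]]]] := se_cover u fj.
  have [|w gfw] := @se_lift _ _ _ _ _ _ _ (g ∘ v) gfm.
    by rewrite compA -pj -compA jv compA pu0 comp0m.
  apply: (epi_zero ee); rewrite -jv.
  have -> : v = f ∘ w by apply: (se_mono gl); rewrite compA gfw.
  by rewrite compA (se_comp0 fj) comp0m.
exists p, q; split=> //; apply: se_intro => //.
- by apply: (@epi_left _ _ _ _ _ m); rewrite qm; apply: se_epi gl.
- by apply: (se_epi fj); rewrite -compA pj compA qm (se_comp0 gl) comp0m.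
move=> t u qu0; have [t' [e [v [ee mv]]]] := se_cover u gfm.
have [|w gw] := @se_lift _ _ _ _ _ _ _ v gl.
  by rewrite -qm -compA mv compA qu0 comp0m.
by apply: (@mono_cover _ _ _ _ _ _ e (j ∘ w)) => //; rewrite compA pj -compA gw.
Qed.

(** The cokernel c of a -> b ⊕ w is the pushout of f along i, hence an extension
    of s by b. This keeps cones inside a class that is closed under
    extensions. *)
Lemma se_pushout (a b w s e c : C) (i : hom a w) (p : hom w s) (f : hom a b)
    (i1 : hom b e) (i2 : hom w e) (p1 : hom e b) (p2 : hom e w) (q : hom e c) :
  short_exact i p -> is_biproduct i1 i2 p1 p2 ->
  short_exact (i1 ∘ f + i2 ∘ i) q ->
  exists r : hom c s, short_exact (q ∘ i1) r.
Proof.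
move=> ip bi fq; have [p11 p22 p12 p21 _] := bi; set f1 := _ + _ in fq.
have p2f : p2 ∘ f1 = i.
  by rewrite compDr !compA p21 p22 comp0m comp1m add0r.
have [|r rq] := @se_colift _ _ _ _ _ _ _ (p ∘ p2) fq.
  by rewrite -compA p2f (se_comp0 ip).
have qm : mono (q ∘ i1).
  apply/mono0P => t u qu0; have [|z zP] := @se_lift _ _ _ _ _ _ _ (i1 ∘ u) fq.
    by rewrite compA.
  have z0 : z = 0.
    by apply: (mono_zero (se_mono ip)); rewrite -p2f -compA zP compA p21 comp0m.
  by rewrite -[u]comp1m -p11 -compA -zP z0 !compm0.
exists r; apply: se_intro => //.
- apply: (@epi_left _ _ _ _ _ q); rewrite rq; apply: epi_comp (se_epi ip) _.
  by apply: (@epi_left _ _ _ _ _ i2); rewrite p22; apply: epi_id.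
- by rewrite compA rq -compA p21 compm0.
move=> t u ru0; have [t' [d [y [de qy]]]] := se_cover u fq.
have [|z zP] := @se_lift _ _ _ _ _ _ _ (p2 ∘ y) ip.
  by rewrite compA -rq -compA qy compA ru0 comp0m.
apply: (@mono_cover _ _ _ _ _ _ d (p1 ∘ (y - f1 ∘ z))) => //.
rewrite -qy -[RHS]subr0 -[0 in RHS](comp0m _ z) -(se_comp0 fq) -[in RHS]compA.
rewrite -compBr -!compA; congr comp; set v := _ - _.
apply: (biprod_ext bi); first by rewrite compA p11 comp1m.
by rewrite compA p21 comp0m compBr [p2 ∘ (f1 ∘ _)]compA p2f zP subrr.
Qed.

(** The square formed by g, k, d and p is bicartesian, because g and p have the
    same kernel a. The resulting sequence 0 -> b -> c ⊕ w -> s -> 0 is what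
    becomes the rotated triangle. *)
Lemma se_pullback (a b c w s e : C) (f : hom a b) (g : hom b c) (i : hom a w)
    (p : hom w s) (k : hom b w) (d : hom c s)
    (i1 : hom c e) (i2 : hom w e) (p1 : hom e c) (p2 : hom e w) :
  short_exact f g -> short_exact i p -> k ∘ f = i -> d ∘ g = p ∘ k ->
  is_biproduct i1 i2 p1 p2 ->
  short_exact (i1 ∘ g + i2 ∘ k) (d ∘ p1 - p ∘ p2).
Proof.
move=> fg ip kf dg bi; have [p11 p22 p12 p21 _] := bi.
set f1 := _ + _; set g1 := _ - _.
have p1f : p1 ∘ f1 = g.
  by rewrite compDr !compA p11 p12 comp0m comp1m addr0.
have p2f : p2 ∘ f1 = k.
  by rewrite compDr !compA p21 p22 comp0m comp1m add0r.
have f1m : mono f1.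
  apply/mono0P => t u u0; have [|z zP] := @se_lift _ _ _ _ _ _ _ u fg.
    by rewrite -p1f -compA u0 compm0.
  rewrite -zP (_ : z = 0) ?compm0 //; apply: (mono_zero (se_mono ip)).
  by rewrite -kf -compA zP -p2f -compA u0 compm0.
apply: se_intro => //.
- apply: (@epi_left _ _ _ _ _ i2).
  have -> : g1 ∘ i2 = - p.
    by rewrite compBl -!compA p12 p22 compm0 compm1 sub0r.
  by move=> r u v; rewrite !compNr => /oppr_inj; apply: (se_epi ip).
- by rewrite compBl -!compA p1f p2f dg subrr.
move=> t u u0; have [t' [h [y [he gy]]]] := se_cover (p1 ∘ u) fg.
have [|z zP] := @se_lift _ _ _ _ _ _ _ (k ∘ y - p2 ∘ u ∘ h) ip.
  rewrite compBr [p ∘ (k ∘ y)]compA -dg -compA gy !compA -!compBl.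
  by move: u0; rewrite compBl => ->; rewrite comp0m.
apply: (@mono_cover _ _ _ _ _ _ h (y - f ∘ z)) => //.
apply: (biprod_ext bi); rewrite compA ?p1f ?p2f compBr compA.
  by rewrite (se_comp0 fg) comp0m subr0 gy compA.
by rewrite kf zP opprB addrC subrK compA.
Qed.

(** * Splittings and direct sums *)

Lemma biprod_se (x y b : C) (i1 : hom x b) (i2 : hom y b) (p1 : hom b x)
    (p2 : hom b y) : is_biproduct i1 i2 p1 p2 -> short_exact i1 p2.
Proof.
move=> [p11 p22 p12 p21 b1]; apply: se_intro => //.
- by apply: (@mono_right _ _ _ _ p1); rewrite p11; apply: mono_id.
- by apply: (@epi_left _ _ _ _ _ i2); rewrite p22; apply: epi_id.
move=> t u pu0; exists (p1 ∘ u).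
by rewrite compA -[RHS]comp1m -b1 compDl -[i2 ∘ p2 ∘ u]compA pu0 compm0 addr0.
Qed.

Lemma retract_split (x y z : C) (f : hom x y) (g : hom y z) (r : hom y x) :
  short_exact f g -> r ∘ f = \id -> exists s, is_biproduct f s r g.
Proof.
move=> fg rf; have [|s sP] := @se_colift _ _ _ _ _ _ _ (idm y - f ∘ r) fg.
  by rewrite compBl comp1m -compA rf compm1 subrr.
exists s; split=> //; last by rewrite sP addrC subrK.
- apply: (se_epi fg); rewrite -compA sP compBr compA (se_comp0 fg) comp0m subr0.
  by rewrite compm1 comp1m.
- apply: (se_epi fg); rewrite -compA sP compBr compA rf comp1m compm1 subrr.
  by rewrite comp0m.
- exact: se_comp0 fg.
Qed.

Lemma closed_retract (X : C -> Prop) (x y : C) (f : hom x y) (r : hom y x) :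
  closed_summands X -> r ∘ f = \id -> X y -> X x.
Proof.
move=> Xs rf Xy.
have fm : mono f by apply: (@mono_right _ _ _ _ r); rewrite rf; apply: mono_id.
have [s sP] := retract_split (mono_se fm) rf.
by apply: Xs Xy; do 4! eexists; apply: sP.
Qed.

(** * Vanishing of Ext in degree one *)

(** This is the content in degree one of the condition that w is in X^⊥. It
    mentions no projective resolution and can therefore be verified in the comma
    category component by component. *)
Definition rel_injective (X : C -> Prop) (w : C) : Prop :=
  forall (a b c : C) (f : hom a b) (g : hom b c), short_exact f g -> X c ->
  forall u : hom a w, exists v, v ∘ f = u.

Definition rel_projective (X : C -> Prop) (w : C) : Prop :=
  forall (a b c : C) (f : hom a b) (g : hom b c), short_exact f g -> X a ->
  forall u : hom w c, exists v, g ∘ v = u.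

(** Lifting the augmentation of a projective resolution P of c along b -> c
    presents b as the cokernel of P_1 -> a ⊕ P_0. Any additive functor that
    preserves cokernels, or Hom(-,w), can thus be evaluated on b. *)
Lemma resolution_presentation (a b c : C) (f : hom a b) (g : hom b c)
    (P : projective_resolution c) :
  short_exact f g ->
  exists (l : hom (P 0) b) (t : hom (P 1%N) a), t ∘ pr_d P 1 = 0 /\
  forall (m : C) (i1 : hom a m) (i2 : hom (P 0) m) p1 p2,
    is_biproduct i1 i2 p1 p2 ->
    is_cokernel (i1 ∘ t - i2 ∘ pr_d P 0) (f ∘ p1 + l ∘ p2).
Proof.
move=> fg.
have [l gl] := @pr_projective _ _ P 0 _ _ _ (pr_aug P) (se_epi fg).
have [ad dK] := exact_cover (pr_exact0 P).
have [dd _] := exact_cover (pr_exactS P 0).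
have [|t ft] := @se_lift _ _ _ _ _ _ _ (l ∘ pr_d P 0) fg.
  by rewrite compA gl ad.
exists l, t; split.
  by apply: (mono_zero (se_mono fg)); rewrite compA ft -compA dd compm0.
move=> m i1 i2 p1 p2 bi; have [p11 p22 p12 p21 _] := bi.
set d := f ∘ p1 + _; set k := i1 ∘ t - _.
have di1 : d ∘ i1 = f by rewrite compDl -!compA p11 p21 compm1 compm0 addr0.
have di2 : d ∘ i2 = l by rewrite compDl -!compA p12 p22 compm1 compm0 add0r.
have p1k : p1 ∘ k = t by rewrite compBr !compA p11 p12 comp1m comp0m subr0.
have p2k : p2 ∘ k = - pr_d P 0.
  by rewrite compBr !compA p21 p22 comp1m comp0m sub0r.
apply: cokernel_by_cover.
- apply/epi0P => r v vd0.
  have [|v' v'P] := @se_colift _ _ _ _ _ _ _ v fg.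
    by rewrite -di1 compA vd0 comp0m.
  rewrite -v'P (_ : v' = 0) ?comp0m //.
  apply: (epi_zero (@pr_aug_epi _ _ P)).
  by rewrite -gl compA v'P -di2 compA vd0 comp0m.
- by rewrite compBr !compA di1 di2 ft subrr.
move=> s z dz0; have fz : f ∘ (p1 ∘ z) = - (l ∘ (p2 ∘ z)).
  by apply/eqP; rewrite -addr_eq0 !compA -compDl dz0.
have [|t' [e [p [ee dp]]]] := dK _ (p2 ∘ z).
  by rewrite -gl -compA -[l ∘ _]opprK -fz compNr compA (se_comp0 fg) comp0m oppr0.
exists t', e, (- p); split=> //; apply: (biprod_ext bi); rewrite compA.
  rewrite p1k; apply: (se_mono fg); rewrite !compNr compA ft -compA dp.
  by have := congr1 (fun r => r ∘ e) fz; rewrite /= compNl -!compA => ->.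
by rewrite p2k compNl compNr opprK dp compA.
Qed.

(** The obstruction to extending u from a to b is the cocycle u ∘ t on P_1. If
    it is the coboundary of s, then u and s glue to a morphism on b, by the
    presentation above. *)
Lemma Ext1_injective (X : C -> Prop) (w : C) :
  right_orth X w -> rel_injective X w.
Proof.
move=> Xw a b c f g fg Xc u.
have [P PP] := Xw c 1 Xc isT.
have [l [t [td dK]]] := resolution_presentation P fg.
have [|s utE] := PP (u ∘ t); first by rewrite -compA td compm0.
have [m [i1 [i2 [p1 [p2 bi]]]]] := dsumP a (P 0%N).
have [p11 p22 p12 p21 _] := bi.
have [|v vd] := @coker_colift _ _ _ _ _ _ _ (u ∘ p1 + s ∘ p2) (dK _ _ _ _ _ bi).
  rewrite compBr !compDl -!compA ![p1 ∘ (_ ∘ _)]compA ![p2 ∘ (_ ∘ _)]compA.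
  by rewrite p11 p12 p21 p22 !comp1m !comp0m !compm0 addr0 add0r utE subrr.
exists v; transitivity (v ∘ (f ∘ p1 + l ∘ p2) ∘ i1).
  by rewrite -compA compDl -!compA p11 p21 compm1 compm0 addr0.
by rewrite vd compDl -!compA p11 p21 compm1 compm0 addr0.
Qed.

Lemma Ext1_projective (X : C -> Prop) (w : C) :
  left_orth X w -> rel_projective X w.
Proof.
move=> Xw a b c f g fg Xa u.
have [P PP] := Xw a 1 Xa isT.
have [l gl] := @pr_projective _ _ P 0 _ _ _ (u ∘ pr_aug P) (se_epi fg).
have [ad _] := exact_cover (pr_exact0 P).
have [dd _] := exact_cover (pr_exactS P 0).
have [|t ft] := @se_lift _ _ _ _ _ _ _ (l ∘ pr_d P 0) fg.
  by rewrite compA gl -compA ad compm0.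
have [|s ts] := PP t.
  by apply: (mono_zero (se_mono fg)); rewrite compA ft -compA dd compm0.
have [|v vP] := @coker_colift _ _ _ _ _ _ _ (l - f ∘ s)
  (exact_cokernel (pr_exact0 P) (@pr_aug_epi _ _ P)).
  by rewrite compBl -compA -ts ft subrr.
exists v; apply: (@pr_aug_epi _ _ P).
by rewrite -compA vP compBr compA (se_comp0 fg) comp0m subr0.
Qed.

End AbelianChase.

(** * Formal properties of right triangles *)

Section FormalTriangles.
Variable C : candidate.
Local Notation S := (Susp C).

(** Mapping a triangle to 0 -> t = t -> Σ0 shows that Hom(-,t) is a cohomological
    functor. It is a rotation of the triangle on an identity only if t is a
    suspension. *)
Definition tr_id_shift : Prop :=
  forall t : C, exists z : C, is_zero z /\
    Delta (0 : hom z t) (idm t) (0 : hom t (S z)).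

(** The axioms that the five lemma needs. They imply uniqueness of cones, which
    reduces the octahedral axiom to convenient representatives. *)
Record pretriangulated : Prop := Pretriangulated {
  pt_iso : tr_iso C;
  pt_id : forall a : C, exists z : C, is_zero z /\
    Delta (idm a) (0 : hom a z) (0 : hom z (S a));
  pt_id_shift : tr_id_shift;
  pt_rotate : tr_rotate C;
  pt_morphism : tr_morphism C }.

Hypothesis pt : pretriangulated.

Lemma tr_comp0 (a b c : C) (f : hom a b) (g : hom b c) (h : hom c (S a)) :
  Delta f g h -> g ∘ f = 0.
Proof.
move=> fgh; have [z [z0 idz]] := pt_id pt a.
have [|w [wP _]] := pt_morphism pt (u := idm a) (v := f) idz fgh.
  by rewrite !compm1.
by rewrite wP (proj1 z0 _ w) comp0m.
Qed.

Lemma tr_colift (a b c : C) (f : hom a b) (g : hom b c) (h : hom c (S a)) t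
    (v : hom b t) :
  Delta f g h -> v ∘ f = 0 -> exists w, w ∘ g = v.
Proof.
move=> fgh vf0; have [z [z0 idz]] := pt_id_shift pt t.
have [|w [wP _]] := pt_morphism pt (u := (0 : hom a z)) (v := v) fgh idz.
  by rewrite vf0 comp0m.
by exists w; rewrite -wP comp1m.
Qed.

(** The usual argument with Hom(-,t), applied to f, g, h, Σf: it involves only
    forward rotations, so Σ need not be an equivalence. *)
Lemma tr_five (a b c a' b' c' : C)
    (f : hom a b) (g : hom b c) (h : hom c (S a))
    (f' : hom a' b') (g' : hom b' c') (h' : hom c' (S a'))
    (u : hom a a') (v : hom b b') (w : hom c c') :
  Delta f g h -> Delta f' g' h' ->
  f' ∘ u = v ∘ f -> g' ∘ v = w ∘ g -> h' ∘ w = fmap S u ∘ h ->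
  is_iso u -> is_iso v -> is_iso w.
Proof.
move=> D D' fu gv hw [u' [u'u uu']] [v' [v'v vv']].
have R := pt_rotate pt D; have R' := pt_rotate pt D'.
have RR := pt_rotate pt R; have RR' := pt_rotate pt R'.
have SuK : fmap S u ∘ fmap S u' = \id by rewrite -fmapM uu' fmap1.
have Su'K : fmap S u' ∘ fmap S u = \id by rewrite -fmapM u'u fmap1.
have fv' : f ∘ u' = v' ∘ f'.
  by rewrite -[f']compm1 -uu' [f' ∘ _]compA fu -!compA (comp_post _ v'v) comp1m.
have w_inj t (r : hom c' t) : r ∘ w = 0 -> r = 0.
  move=> rw0.
  have [|s sP] := @tr_colift _ _ _ _ _ _ _ r R'.
    by rewrite -[g']compm1 -vv' [g' ∘ _]compA gv !compA rw0 !comp0m.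
  have [|s' s'P] := @tr_colift _ _ _ _ _ _ _ (s ∘ fmap S u) RR.
    by rewrite -compA -hw compA sP rw0.
  rewrite -sP; have -> : s = s' ∘ fmap S v' ∘ (- fmap S f').
    rewrite -[s]compm1 -SuK compA -s'P !compNr !compNl -!compA -!fmapM.
    by rewrite -fv'.
  by rewrite -compA (tr_comp0 RR') compm0.
have w_ext t (r : hom c t) : exists s, s ∘ w = r.
  have [|s sP] := @tr_colift _ _ _ _ _ _ _ (r ∘ g ∘ v') D'.
    by rewrite -!compA -fv' (comp_post _ (tr_comp0 D)) comp0m compm0.
  have [|s' s'P] := @tr_colift _ _ _ _ _ _ _ (r - s ∘ w) R.
    rewrite compBl -!compA -gv compA sP -!compA v'v compm1 subrr //.
  exists (s + s' ∘ fmap S u' ∘ h').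
  by rewrite compDl -!compA hw (comp_post _ Su'K) comp1m s'P addrC subrK.
have [w' w'w] := w_ext _ (idm c); exists w'; split=> //.
apply/subr0_eq/w_inj.
by rewrite compBl -compA w'w compm1 comp1m subrr.
Qed.

Lemma tr_cone_iso (a b c a' b' c' : C)
    (f : hom a b) (g : hom b c) (h : hom c (S a))
    (f' : hom a' b') (g' : hom b' c') (h' : hom c' (S a'))
    (u : hom a a') (v : hom b b') :
  Delta f g h -> Delta f' g' h' -> f' ∘ u = v ∘ f -> is_iso u -> is_iso v ->
  exists w : hom c c',
    [/\ is_iso w, g' ∘ v = w ∘ g & h' ∘ w = fmap S u ∘ h].
Proof.
move=> D D' fu ui vi; have [w [gv hw]] := pt_morphism pt D D' fu.
by exists w; split=> //; apply: tr_five D D' fu gv hw ui vi.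
Qed.

Lemma tr_cone_zero (a b c : C) (f : hom a b) (g : hom b c) (h : hom c (S a)) :
  Delta f g h -> is_zero a -> is_zero b -> is_zero c.
Proof.
move=> D [_ a0] [b0 _]; apply/is_zeroP.
have [|w <-] := @tr_colift _ _ _ _ _ _ _ (idm c) (pt_rotate pt D).
  by rewrite (b0 _ g) compm0.
rewrite -[h]comp1m (_ : idm (S a) = 0) ?comp0m ?compm0 //.
by rewrite -fmap1 (a0 _ (idm a)) fmap0.
Qed.

(** Since cones are unique up to isomorphism, the octahedral axiom for a pair
    of composable morphisms follows from one instance of it for an isomorphic
    pair. *)
Lemma octahedron_transport (a b c z y x a1 b1 c1 z1 y1 x1 : C)
    (f : hom a b) (j : hom b z) (k : hom z (S a))
    (g : hom b c) (l : hom c x) (i : hom x (S b))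
    (m : hom c y) (n : hom y (S a))
    (f1 : hom a1 b1) (j1 : hom b1 z1) (k1 : hom z1 (S a1))
    (g1 : hom b1 c1) (l1 : hom c1 x1) (i1 : hom x1 (S b1))
    (m1 : hom c1 y1) (n1 : hom y1 (S a1))
    (p1 : hom z1 y1) (q1 : hom y1 x1)
    (u : hom a a1) (v : hom b b1) (w : hom c c1) :
  Delta f j k -> Delta g l i -> Delta (g ∘ f) m n ->
  Delta f1 j1 k1 -> Delta g1 l1 i1 -> Delta (g1 ∘ f1) m1 n1 ->
  f1 ∘ u = v ∘ f -> g1 ∘ v = w ∘ g -> is_iso u -> is_iso v -> is_iso w ->
  [/\ Delta p1 q1 (fmap S j1 ∘ i1), p1 ∘ j1 = m1 ∘ g1, n1 ∘ p1 = k1,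
      q1 ∘ m1 = l1 & i1 ∘ q1 = fmap S f1 ∘ n1] ->
  exists (p : hom z y) (q : hom y x),
    [/\ Delta p q (fmap S j ∘ i),
        p ∘ j = m ∘ g, n ∘ p = k, q ∘ m = l & i ∘ q = fmap S f ∘ n].
Proof.
move=> Df Dg Dgf Df1 Dg1 Dgf1 fu gv ui vi wi [D1 pj np qm iq].
have [Z [Zi jZ kZ]] := tr_cone_iso Df Df1 fu ui vi.
have [Xi_ [Xi lX iX]] := tr_cone_iso Dg Dg1 gv vi wi.
have [|Y [Yi mY nY]] := tr_cone_iso (u := u) (v := w) Dgf Dgf1 _ ui wi.
  by rewrite -compA fu !compA gv.
have [u' [u'u uu']] := ui; have [v' [v'v vv']] := vi.
have [Z' [Z'Z ZZ']] := Zi; have [Y' [Y'Y YY']] := Yi.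
have [X' [X'X XX']] := Xi.
have Sui := fmap_iso S ui; have Svi := fmap_iso S vi.
exists (Y' ∘ p1 ∘ Z), (X' ∘ q1 ∘ Y); split.
- apply: (pt_iso pt (u := Z') (v := Y') (w := X')) D1;
    try by eexists; split; eassumption.
  + by rewrite -!compA ZZ' compm1.
  + by rewrite -!compA YY' compm1.
  + apply: (iso_epi Xi); apply: (iso_mono (fmap_iso S Zi)).
    rewrite -!compA X'X compm1 compA -fmapM -jZ fmapM -compA -iX.
    by rewrite (comp_post _ (esym (fmapM _ _ _))) ZZ' fmap1 comp1m.
- apply: (iso_mono Yi); rewrite -!compA (comp_post _ YY') comp1m -jZ compA pj.
  by rewrite -compA gv compA mY compA.
- apply: (iso_mono Sui); rewrite -kZ -np -!compA compA -nY -!compA.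
  by rewrite (comp_post _ YY') comp1m.
- apply: (iso_mono Xi); rewrite -!compA (comp_post _ XX') comp1m -mY compA qm.
  by rewrite lX.
- apply: (iso_mono Svi); rewrite -!compA compA -iX -!compA (comp_post _ XX').
  rewrite comp1m compA iq -compA nY !compA -!fmapM fu //.
Qed.

(** * Triangulated categories and fully faithful functors *)

Definition full (D E : precat) (F : functor D E) : Prop :=
  forall (x y : D) (g : hom (F x) (F y)), exists f, fmap F f = g.

Definition faithful (D E : precat) (F : functor D E) : Prop :=
  forall (x y : D) (f : hom x y), fmap F f = 0 -> f = 0.

Definition essentially_surjective (D E : precat) (F : functor D E) : Prop :=
  forall y : E, exists x, isomorphic (F x) y.

Lemma faithful_inj (D E : precat) (F : functor D E) (x y : D) (f g : hom x y) :
  faithful F -> fmap F f = fmap F g -> f = g.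
Proof. by move=> Ff fg; apply/subr0_eq/Ff; rewrite fmapB fg subrr. Qed.

Lemma ff_iso (D E : precat) (F : functor D E) (x y : D) (f : hom x y) :
  full F -> faithful F -> is_iso (fmap F f) -> is_iso f.
Proof.
move=> Fu Fa [g' [g'f fg']]; have [g gP] := Fu _ _ g'.
exists g; split; apply: (faithful_inj Fa); rewrite fmapM fmap1 gP //.
Qed.

Lemma full_faithful_bij (D E : precat) (F : functor D E) :
  full F -> faithful F -> fully_faithful F.
Proof.
move=> Fu Fa x y; have [G GP] := choice (Fu x y).
by exists G => f; rewrite ?GP //; apply: (faithful_inj Fa); rewrite GP.
Qed.

(** Rotating a triangle g, h, -Σf forward three times exhibits its cone as the
    image under Σ of the cone of f; a fully faithful Σ reflects this. *)
Lemma tr_rotate_back_ff :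
  tr_cone C -> full S -> faithful S -> tr_rotate_back C.
Proof.
move=> cone Sfull Sfaith a b c f g h D.
have [c1 [g1 [h1 D1]]] := cone _ _ f.
have R := pt_rotate pt (pt_rotate pt D).
have R1 := pt_rotate pt (pt_rotate pt (pt_rotate pt D1)).
have [|w [wi gw hw]] := tr_cone_iso R1 R _ (is_iso_id _) (is_iso_id _).
  by rewrite compm1 comp1m.
have [w0 w0P] := Sfull _ _ w; subst w.
apply: (pt_iso pt (u := idm a) (v := idm b) (w := w0)) D1.
- exact: is_iso_id.
- exact: is_iso_id.
- exact: ff_iso wi.
- by rewrite comp1m compm1.
- apply: (faithful_inj Sfaith); rewrite !fmapM fmap1 compm1.
  by apply/oppr_inj; rewrite -compNr -gw compm1.
- apply: (faithful_inj Sfaith); rewrite !fmapM !fmap1 comp1m.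
  by apply/oppr_inj; rewrite -compNl hw fmap1 comp1m.
Qed.

End FormalTriangles.

Section Functors.
Variables (D E : precat) (F : functor D E).

Lemma ff_equivalence : full F -> faithful F -> essentially_surjective F ->
  equivalence F.
Proof.
move=> Fu Fa Fs.
pose pre (x y : D) (g : hom (F x) (F y)) : hom x y := projT1 (cid (Fu x y g)).
have preK x y g : fmap F (pre x y g) = g by rewrite /pre; case: cid.
have {Fs} Fs y : {x : D & {eps : hom (F x) y & {eps' : hom y (F x) |
    eps' ∘ eps = \id /\ eps ∘ eps' = \id}}}.
  have [x xP] := cid (Fs y); have [e eP] := cid xP; have [e' e'P] := cid eP.
  by exists x, e, e'.
pose G0 y := projT1 (Fs y); pose eps y : hom (F (G0 y)) y := projT1 (projT2 (Fs y)).
pose eps' y : hom y (F (G0 y)) := sval (projT2 (projT2 (Fs y))).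
have eps'K y : eps' y ∘ eps y = \id.
  exact: (proj1 (svalP (projT2 (projT2 (Fs y))))).
have epsK y : eps y ∘ eps' y = \id.
  exact: (proj2 (svalP (projT2 (projT2 (Fs y))))).
pose Gm x y (g : hom x y) := pre _ _ (eps' y ∘ g ∘ eps x).
have G1 x : Gm _ _ (idm x) = idm (G0 x).
  by apply: (faithful_inj Fa); rewrite preK compm1 eps'K fmap1.
have GM x y z (g : hom y z) (f : hom x y) : Gm _ _ (g ∘ f) = Gm _ _ g ∘ Gm _ _ f.
  apply: (faithful_inj Fa); rewrite fmapM !preK -!compA.
  by rewrite (comp_post _ (epsK _)) comp1m.
have GD x y (g f : hom x y) : Gm _ _ (g + f) = Gm _ _ g + Gm _ _ f.
  by apply: (faithful_inj Fa); rewrite fmapD !preK compDr compDl.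
exists (Functor G1 GM GD), (fun x => pre _ _ (eps' (F x))), eps; split => /=.
- move=> x; apply: ff_iso => //; rewrite preK; exists (eps (F x)).
  by rewrite eps'K epsK.
- by move=> y; exists (eps' y).
- move=> x x' f; apply: (faithful_inj Fa); rewrite !fmapM !preK -!compA.
  by rewrite epsK compm1.
- by move=> y y' g; rewrite preK -!compA (comp_post _ (epsK _)) comp1m.
Qed.

End Functors.

(** * Adjunctions *)

Section Adjunctions.
Variables (C D : precat) (L : functor C D) (R : functor D C).
Variables (eta : forall x : C, hom x (R (L x))).
Variables (eps : forall y : D, hom (L (R y)) y).

Definition adjunction : Prop :=
  [/\ forall (x x' : C) (f : hom x x'), eta x' ∘ f = fmap R (fmap L f) ∘ eta x,
      forall (y y' : D) (g : hom y y'), eps y' ∘ fmap L (fmap R g) = g ∘ eps y,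
      forall x, eps (L x) ∘ fmap L (eta x) = \id
    & forall y, fmap R (eps y) ∘ eta (R y) = \id].

Hypothesis adj : adjunction.

Lemma adjunction_adjoint : adjoint L R.
Proof. by exists eta, eps. Qed.

Lemma counit_iso_right_ff : (forall y, is_iso (eps y)) -> fully_faithful R.
Proof.
move=> epsI; case: adj => etaN epsN _ tri.
apply: full_faithful_bij => y y' g.
  have [e [ee' e'e]] := epsI y.
  exists (eps y' ∘ fmap L g ∘ e); rewrite !fmapM.
  have -> : fmap R e = eta (R y).
    apply: (iso_mono (fmap_iso R (epsI y))).
    by rewrite tri -fmapM e'e fmap1.
  by rewrite -compA -etaN compA tri comp1m.
move=> g0; apply/(proj1 (epi0P _) (iso_epi (epsI y))).
by rewrite -epsN g0 fmap0 compm0.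
Qed.

Lemma unit_iso_left_ff : (forall x, is_iso (eta x)) -> fully_faithful L.
Proof.
move=> etaI; case: adj => etaN epsN tri _.
apply: full_faithful_bij => x x' g.
  have [e [ee' e'e]] := etaI x'.
  exists (e ∘ fmap R g ∘ eta x); rewrite !fmapM.
  have -> : fmap L e = eps (L x').
    apply: (iso_epi (fmap_iso L (etaI x'))).
    by rewrite tri -fmapM ee' fmap1.
  by rewrite epsN -compA tri compm1.
move=> g0; apply/(proj1 (mono0P _) (iso_mono (etaI x'))).
by rewrite etaN g0 fmap0 comp0m.
Qed.

End Adjunctions.

(** The right adjoint r of e need not preserve right triangles for formal
    reasons. Here p controls the essential image of r: an object is in it as
    soon as p kills it, so it is closed under suspension and cones, and e is
    fully faithful on it. *)
Section RightAdjoint.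
Variables (A' C B' : candidate).
Hypotheses (ptA : pretriangulated A') (ptC : pretriangulated C).
Hypotheses (ptB : pretriangulated B') (cone : tr_cone C).
Variables (e : functor C B') (r : functor B' C) (p : functor C A').
Variables (eta : forall x : C, hom x (r (e x))).
Variables (eps : forall y : B', hom (e (r y)) y).
Hypotheses (adj : adjunction eta eps) (epsI : forall y, is_iso (eps y)).
Hypotheses (eT : right_triangle_functor e) (pT : right_triangle_functor p).
Hypothesis pr0 : forall y, is_zero (p (r y)).
Hypothesis etaI : forall x, is_zero (p x) -> is_iso (eta x).

Lemma right_adjoint_triangle : right_triangle_functor r.
Proof.
have [phi [phiI phiN phiD]] := eT; have [psi [psiI _ psiD]] := pT.
case: adj => etaN epsN _ tri.
pose th y : hom (Susp C (r y)) (r (Susp B' y)) :=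
  fmap r (fmap (Susp B') (eps y) ∘ phi (r y)) ∘ eta (Susp C (r y)).
have thI y : is_iso (th y).
  apply: is_iso_comp; last first.
    apply: etaI; have [u [uK Ku]] := psiI (r y).
    apply: (is_zero_iso (f := u)); first by exists (psi (r y)).
    by apply/is_zeroP; rewrite -fmap1 (proj2 (pr0 y) _ \id) fmap0.
  by apply/fmap_iso/is_iso_comp => //; apply/fmap_iso.
have thN y y' (g : hom y y') :
    th y' ∘ fmap (Susp C) (fmap r g) = fmap r (fmap (Susp B') g) ∘ th y.
  rewrite /th -compA etaN !compA -!fmapM; congr (fmap r _ ∘ _).
  by rewrite -compA phiN !compA -!fmapM epsN.
pose ph y := projT1 (cid (thI y)).
have phK y : ph y ∘ th y = \id by rewrite /ph; case: cid => ? [].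
have thK y : th y ∘ ph y = \id by rewrite /ph; case: cid => ? [].
have phI y : is_iso (ph y) by exists (th y).
exists ph; split=> // [x y f|a b c f g h D].
  apply: (iso_mono (thI y)); rewrite compA thK comp1m compA thN -compA thK.
  by rewrite compm1.
have [c1 [g1 [h1 D1]]] := cone (fmap r f).
have c1I : is_iso (eta c1).
  by apply: etaI; apply: (tr_cone_zero ptA (psiD _ _ _ _ _ _ D1)); apply: pr0.
have [|w [wi gw hw]] := tr_cone_iso (u := eps a) (v := eps b) ptB
    (phiD _ _ _ _ _ _ D1) D _ (epsI a) (epsI b); first by rewrite epsN.
apply: (pt_iso ptC (u := idm _) (v := idm _) (w := fmap r w ∘ eta c1)) D1.
- exact: is_iso_id.
- exact: is_iso_id.
- exact/is_iso_comp/c1I/fmap_iso.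
- by rewrite comp1m compm1.
- rewrite compm1 -compA etaN compA -fmapM -gw fmapM -compA tri compm1 //.
- apply: (iso_mono (thI a)); rewrite fmap1 comp1m !compA thK comp1m.
  by rewrite -fmapM hw /th -[RHS]compA etaN [RHS]compA -[in RHS]fmapM compA.
Qed.

End RightAdjoint.

(** * The stable category *)

Section StableHom.
Variables (C : precat) (X W : C -> Prop).
Implicit Types x y z : stable X W.

Lemma scls_surj x y (q : hom x y) : exists f, scls X W f = q.
Proof. exact: cls_surj. Qed.

Lemma sclsP x y (f g : hom (sval x) (sval y)) :
  scls X W (x := x) (y := y) f = scls X W (x := x) (y := y) g <->
  null W (f - g).
Proof. exact: clsP. Qed.

Lemma sclsM x y z (g : hom (sval y) (sval z)) (f : hom (sval x) (sval y)) :
  scls X W (x := y) (y := z) g ∘ scls X W (x := x) (y := y) f =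
  scls X W (x := x) (y := z) (g ∘ f).
Proof. exact: stable_compE. Qed.

Lemma scls1 x : scls X W (x := x) (y := x) (idm (sval x)) = idm x.
Proof. by []. Qed.

Lemma sclsD x y (f g : hom (sval x) (sval y)) :
  scls X W (x := x) (y := y) (f + g) =
  scls X W (x := x) (y := y) f + scls X W (x := x) (y := y) g.
Proof. exact: clsD. Qed.

Lemma scls0 x y : scls X W (x := x) (y := y) 0 = 0.
Proof.
apply/eqP; rewrite -[_ == _](inj_eq (addrI (scls X W (x := x) (y := y) 0))).
by rewrite -sclsD !addr0.
Qed.

Lemma scls0P x y (f : hom (sval x) (sval y)) :
  scls X W (x := x) (y := y) f = 0 <-> null W f.
Proof. by rewrite -scls0 sclsP subr0. Qed.

Lemma sclsN x y (f : hom (sval x) (sval y)) :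
  scls X W (x := x) (y := y) (- f) = - scls X W (x := x) (y := y) f.
Proof. by apply/eqP; rewrite -addr_eq0 -sclsD addNr scls0. Qed.

Lemma scls_iso x y (f : hom (sval x) (sval y)) (g : hom (sval y) (sval x)) :
  null W (g ∘ f - \id) -> null W (f ∘ g - \id) ->
  is_iso (scls X W (x := x) (y := y) f).
Proof.
move=> /sclsP gf /sclsP fg.
by exists (scls X W (x := y) (y := x) g); rewrite !sclsM gf fg.
Qed.

Lemma biprod_iso x y w (i1 : hom (sval x) (sval y)) (i2 : hom w (sval y))
    (p1 : hom (sval y) (sval x)) (p2 : hom (sval y) w) :
  W w -> is_biproduct i1 i2 p1 p2 ->
  is_iso (scls X W (x := x) (y := y) i1) /\
  is_iso (scls X W (x := y) (y := x) p1).
Proof.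
move=> Ww [p11 _ _ _ e1].
have n1 : null W (p1 ∘ i1 - \id) by rewrite p11 subrr; apply: null_zero.
have n2 : null W (i1 ∘ p1 - \id).
  by rewrite -e1 opprD addrA subrr sub0r; apply/null_opp/null_factor.
by split; apply: scls_iso; eassumption.
Qed.

Lemma induced_cls (D : precat) (X' W' : D -> Prop) F0 R
    (F : @induced_functor C D X W X' W' F0 R) x y
    (f : hom (sval x) (sval y)) (g : hom (F0 x) (F0 y)) :
  R x y f g ->
  fmap F (scls X W (x := x) (y := y) f) = scls X' W' (x := F x) (y := F y) g.
Proof. exact: if_cls. Qed.

Lemma stable_zero x : W (sval x) -> is_zero x.
Proof.
move=> Wx; apply/is_zeroP; rewrite -scls1; apply/scls0P.
by rewrite -[\id]comp1m; apply: null_factor.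
Qed.

End StableHom.

(** The part of the definition of a left Frobenius pair that makes X/W right
    triangulated, once embeddings into objects of W are chosen. Ext is replaced
    by relative injectivity, which is accessible in the comma category. *)
Record cogenerated (C : abelian) (X W : C -> Prop) : Prop := Cogenerated {
  cg_zero : X (zob C);
  cg_ext : closed_ext X;
  cg_sub : forall w, W w -> X w;
  cg_inj : forall w, W w -> rel_injective X w }.

Section StableTriangulated.
Variables (C : abelian) (X W : C -> Prop) (cg : cogenerated X W).
Variables (ch : cosyzygies X W) (S : stable_shift ch).
Local Notation St := (stableT S).
Implicit Types x y z : stable X W.

Local Notation cl f := (scls X W f).
Local Notation mkX Xx := (exist X _ Xx : stable X W).

Lemma cg_sum (x y e : C) (i1 : hom x e) (i2 : hom y e) (p1 : hom e x)
    (p2 : hom e y) : is_biproduct i1 i2 p1 p2 -> X x -> X y -> X e.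
Proof. by move/biprod_se/(cg_ext cg). Qed.

(** Objects of W are injective relative to X, so a single embedding of x into an
    object of W serves for all null morphisms that start at x. *)
Lemma null_extend (x y w s : C) (f : hom x y) (i : hom x w) (p : hom w s) :
  short_exact i p -> X s -> null W f -> exists t, t ∘ i = f.
Proof.
move=> ip Xs; elim=> [v h k Wv||h k _ [t tP] _ [u uP]].
- by have [t <-] := cg_inj cg Wv ip Xs k; exists (h ∘ t); rewrite compA.
- by exists 0; rewrite comp0m.
- by exists (t - u); rewrite compBl tP uP.
Qed.

Lemma null_cs x (y : C) (f : hom (sval x) y) :
  null W f -> exists t, t ∘ cs_i ch x = f.
Proof. exact: null_extend (cs_exact ch x) (cs_inX ch x). Qed.

(** * Connecting morphisms *)

(** b is a connecting morphism of the short exact sequence (f, g): it is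
    obtained by extending the identity of x1 to a morphism into the chosen
    sequence of x1. *)
Definition connecting x1 x2 x3 (f : hom (sval x1) (sval x2))
    (g : hom (sval x2) (sval x3)) (a : hom (sval x2) (cs_W ch x1))
    (b : hom (sval x3) (cs_S ch x1)) : Prop :=
  [/\ short_exact f g, a ∘ f = cs_i ch x1 & b ∘ g = cs_p ch x1 ∘ a].

Lemma connecting_exists x1 x2 x3 (f : hom (sval x1) (sval x2))
    (g : hom (sval x2) (sval x3)) :
  short_exact f g -> exists a b, connecting f g a b.
Proof.
move=> fg.
have [a af] := cg_inj cg (cs_inW ch x1) fg (svalP x3) (cs_i ch x1).
have [|b bg] := @se_colift _ _ _ _ _ _ _ (cs_p ch x1 ∘ a) fg.
  by rewrite -compA af (se_comp0 (cs_exact ch x1)).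
by exists a, b.
Qed.

(** Two morphisms from x2 to the chosen object of W that agree on x1 differ by
    one that factors through x3; hence the two composites x3 -> Σ x1' differ by a
    morphism through W. *)
Lemma connecting_natural x1 x2 x3 x1' x2' x3' (f : hom (sval x1) (sval x2))
    (g : hom (sval x2) (sval x3)) a b (f' : hom (sval x1') (sval x2'))
    (g' : hom (sval x2') (sval x3')) a' b' (u : hom (sval x1) (sval x1'))
    (v : hom (sval x2) (sval x2')) (w : hom (sval x3) (sval x3')) :
  connecting f g a b -> connecting f' g' a' b' ->
  f' ∘ u = v ∘ f -> g' ∘ v = w ∘ g ->
  (scls X W (x := x3') (y := S x1') b' : @hom St _ _) ∘ cl w =
  fmap S (cl u) ∘ scls X W (x := x3) (y := S x1) b.
Proof.
move=> [fg af bg] [fg' af' bg'] fu gv.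
have [s sP] := if_exists S u; have [k [ki sp]] := sP.
rewrite (induced_cls S sP) (sclsM (z := S x1') b' w).
rewrite (sclsM (y := S x1) (z := S x1') s b); apply/sclsP.
have [|m mg] := @se_colift _ _ _ _ _ _ _ (a' ∘ v - k ∘ a) fg.
  by rewrite compBl -!compA -fu af [a' ∘ _]compA af' ki subrr.
have -> : b' ∘ w - s ∘ b = cs_p ch x1' ∘ m.
  apply: (se_epi fg); rewrite compBl -!compA mg bg -gv compBr compA bg' -compA.
  by rewrite ![cs_p _ _ ∘ (_ ∘ _)]compA -sp compA.
by apply: null_factor; apply: cs_inW.
Qed.

Lemma connecting_Delta x1 x2 x3 (f : hom (sval x1) (sval x2))
    (g : hom (sval x2) (sval x3)) a b :
  connecting f g a b ->
  @Delta St _ _ _ (cl f) (cl g) (scls X W (x := x3) (y := S x1) b).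
Proof.
move=> [fg af bg]; exists x1, x2, x3, f, g, a, b; split=> //.
exists \id, \id, \id; split; last by rewrite fmap1 comp1m compm1.
- by split; apply: is_iso_id.
- by rewrite comp1m compm1.
- by rewrite comp1m compm1.
Qed.

(** A square that commutes up to a morphism through W commutes strictly after a
    change of v inside its class: the defect extends along the embedding of x1
    into W and can be absorbed into v. *)
Lemma connecting_morphism x1 x2 x3 x1' x2' x3' (f : hom (sval x1) (sval x2))
    (g : hom (sval x2) (sval x3)) a b (f' : hom (sval x1') (sval x2'))
    (g' : hom (sval x2') (sval x3')) a' b' (u : hom x1 x1') (v : hom x2 x2') :
  connecting f g a b -> connecting f' g' a' b' -> cl f' ∘ u = v ∘ cl f ->
  exists w : hom x3 x3', cl g' ∘ v = w ∘ cl g /\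
    (scls X W (x := x3') (y := S x1') b' : @hom St _ _) ∘ w =
    fmap S u ∘ scls X W (x := x3) (y := S x1) b.
Proof.
move=> c c'; have [fg af bg] := c; have [fg' af' bg'] := c'.
have [u0 <-] := scls_surj u; have [v0 <-] := scls_surj v; rewrite !sclsM.
move=> /sclsP /null_cs [t tP].
have {}tP : f' ∘ u0 = (v0 + t ∘ a) ∘ f.
  by rewrite compDl -compA af tP addrC subrK.
have vE : scls X W (v0 + t ∘ a) = scls X W v0.
  by apply/sclsP; rewrite addrC addKr; apply: null_factor; apply: cs_inW.
have [|w wg] := @se_colift _ _ _ _ _ _ _ (g' ∘ (v0 + t ∘ a)) fg.
  by rewrite -compA -tP compA (se_comp0 fg') comp0m.
exists (cl w); split; last exact: (connecting_natural c c' tP (esym wg)).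
by rewrite -sclsM -vE !sclsM wg.
Qed.

(** * The axioms of a right triangulated category *)

Lemma stable_tr_iso : tr_iso St.
Proof.
move=> a b c a' b' c' f g h f' g' h' u v w ui vi wi fu gv hw.
move=> [x1 [x2 [x3 [f0 [g0 [a0 [b0
  [D [u0 [v0 [w0 [[u0i v0i w0i] fu0 gv0 hw0]]]]]]]]]]]].
exists x1, x2, x3, f0, g0, a0, b0; split=> //.
exists (u ∘ u0), (v ∘ v0), (w ∘ w0); split.
- by split; apply: is_iso_comp.
- by rewrite compA fu -!compA fu0.
- by rewrite compA gv -!compA gv0.
- by rewrite compA hw -!compA hw0 compA fmapM.
Qed.

Lemma stable_tr_id : tr_id St.
Proof.
move=> a z z0; have Z := zobP C.
have D : short_exact (idm (sval a)) (0 : hom (sval a) (zob C)).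
  apply: se_intro; first exact: mono_id.
  - by apply/epi0P => t u _; apply: (proj1 Z).
  - by rewrite compm1.
  - by move=> t u _; exists u; rewrite comp1m.
have [a0 [b0 c0]] := connecting_exists (x3 := mkX (cg_zero cg)) D.
apply: (stable_tr_iso (u := idm a) (v := idm a)
  (w := (0 : hom (mkX (cg_zero cg)) z)) _ _ _ _ _ _ (connecting_Delta c0)).
- exact: is_iso_id.
- exact: is_iso_id.
- exists 0; split; last by rewrite (proj1 z0 _ \id) compm0.
  rewrite compm0; apply/esym/scls0P; rewrite (proj1 Z _ \id); exact: null_zero.
- by rewrite ?comp1m ?compm1.
- by rewrite comp0m comp0m.
- by rewrite comp0m (proj1 Z _ b0) (scls0 _ (S a)) compm0.
Qed.

Lemma stable_tr_id_shift : tr_id_shift St.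
Proof.
move=> t; have Z := zobP C; pose z : St := mkX (cg_zero cg).
have D : short_exact (0 : hom (zob C) (sval t)) (idm (sval t)).
  apply: se_intro.
  - by apply/mono0P => s u _; apply: (proj2 Z).
  - exact: epi_id.
  - by rewrite compm0.
  - by move=> s u; rewrite comp1m => ->; exists 0; rewrite compm0.
have [a0 [b0 c0]] := connecting_exists (x1 := mkX (cg_zero cg)) D.
have z0 : is_zero z.
  by apply/is_zeroP/scls0P; rewrite (proj1 Z _ \id); apply: null_zero.
exists z; split=> //.
apply: (stable_tr_iso (u := idm z) (v := idm t) (w := idm t) _ _ _ _ _ _
  (connecting_Delta c0)); try exact: is_iso_id.
- by rewrite comp1m compm1 scls0.
- by [].
- rewrite comp0m; apply/esym.
  by rewrite -[fmap S _]compm1 -fmap1 (proj2 z0 _ \id) fmap0 compm0 comp0m.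
Qed.

(** Every morphism is, up to a summand in W of its target, an admissible
    monomorphism. *)
Lemma inflation x y (f : hom (sval x) (sval y)) :
  exists (e c : stable X W) (f1 : hom (sval x) (sval e))
    (q : hom (sval e) (sval c)) (p : hom (sval e) (sval y)),
  [/\ short_exact f1 q, p ∘ f1 = f & is_iso (cl p)].
Proof.
have ip := cs_exact ch x.
have [e [i1 [i2 [p1 [p2 bi]]]]] := dsumP (sval y) (cs_W ch x).
have [p11 p22 p12 p21 _] := bi.
pose f1 := i1 ∘ f + i2 ∘ cs_i ch x.
have f1m : mono f1.
  apply: (@mono_right _ _ _ _ p2).
  by rewrite compDr !compA p21 p22 comp0m comp1m add0r; apply: se_mono ip.
have [r yr] := se_pushout ip bi (mono_se f1m).
have Xe : X e := cg_sum bi (svalP y) (cg_sub cg (cs_inW ch x)).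
have Xc : X (coker f1) := cg_ext cg yr (svalP y) (cs_inX ch x).
exists (mkX Xe), (mkX Xc), f1, (cokerm f1), p1; split; first exact: mono_se.
  by rewrite compDr !compA p11 p12 comp0m comp1m addr0.
by have [_] := biprod_iso (x := y) (y := mkX Xe) (cs_inW ch x) bi.
Qed.

Lemma stable_tr_cone : tr_cone St.
Proof.
move=> x y f; have [f0 <-] := scls_surj f.
have [e [c [f1 [q [p [D pf pI]]]]]] := inflation f0.
have [p' [p'p pp']] := pI.
have [a [b D']] := connecting_exists D.
exists c, (cl q ∘ p'), (scls X W (x := c) (y := S x) b).
apply: (stable_tr_iso (u := idm x) (v := cl p) (w := idm c) _ pI _ _ _ _
  (connecting_Delta D')); try exact: is_iso_id.
- by rewrite compm1 sclsM pf.
- by rewrite -compA p'p comp1m compm1.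
- by rewrite fmap1 comp1m compm1.
Qed.

Lemma stable_tr_morphism : tr_morphism St.
Proof.
move=> a b c a' b' c' f g h f' g' h' u v.
move=> [x1 [x2 [x3 [f0 [g0 [a0 [b0
  [D [u0 [v0 [w0 [[u0i v0i w0i] fu0 gv0 hw0]]]]]]]]]]]].
move=> [y1 [y2 [y3 [f1 [g1 [a1 [b1
  [E [u1 [v1 [w1 [[u1i v1i w1i] fu1 gv1 hw1]]]]]]]]]]]].
move=> fu.
have [u1' [u1K Ku1]] := u1i; have [v1' [v1K Kv1]] := v1i.
have [w0' [w0K Kw0]] := w0i; have [u0' [u0K Ku0]] := u0i.
have [v0' [v0K Kv0]] := v0i.
have [|w [gw hw]] := connecting_morphism (u := u1' ∘ u ∘ u0) (v := v1' ∘ v ∘ v0) D E.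
  apply: (iso_mono v1i); rewrite !compA -fu1 Kv1 comp1m -!compA.
  by rewrite [u1 ∘ (u1' ∘ _)]compA Ku1 comp1m -fu0 !compA fu.
exists (w1 ∘ w ∘ w0'); split.
  apply: (iso_epi v0i); rewrite -!compA gv0 [w0' ∘ _]compA w0K comp1m -gw.
  by rewrite [RHS]compA -gv1 -!compA [v1 ∘ (v1' ∘ _)]compA Kv1 comp1m.
apply: (iso_epi w0i); rewrite -!compA w0K compm1 compA hw1 -compA hw !compA.
by rewrite -!fmapM !compA Ku1 comp1m fmapM -compA hw0 compA.
Qed.

(** The extension of the inclusion of x2 to a morphism from the second term of
    0 -> x2 -> x3 ⊕ W1 -> Σ x1 -> 0 is built from a lift of f to the chosen
    sequences; the sign in the second map of that sequence is the sign of the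
    rotation axiom. *)
Lemma stable_tr_rotate : tr_rotate St.
Proof.
move=> a b c f g h.
move=> [x1 [x2 [x3 [f0 [g0 [a0 [b0
  [D [u0 [v0 [w0 [[u0i v0i w0i] fu0 gv0 hw0]]]]]]]]]]]].
have [fg0 af0 bg0] := D; have ip := cs_exact ch x1.
have [e [i1 [i2 [p1 [p2 bi]]]]] := dsumP (sval x3) (cs_W ch x1).
have Xe : X e := cg_sum bi (svalP x3) (cg_sub cg (cs_inW ch x1)).
have E := se_pullback fg0 ip af0 bg0 bi.
have [i1I _] := biprod_iso (x := x3) (y := mkX Xe) (cs_inW ch x1) bi.
have [i1' [i1K Ki1]] := i1I.
have [s sP] := if_exists S f0; have [k [ki sp]] := sP.
have SfE := induced_cls S sP.
have [|m mg] := @se_colift _ _ _ _ _ _ _ (cs_i ch x2 - k ∘ a0) fg0.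
  by rewrite compBl -compA af0 ki subrr.
have [p11 p22 p12 p21 _] := bi.
have E' : connecting (x2 := mkX Xe) (x3 := S x1)
    (i1 ∘ g0 + i2 ∘ a0) (b0 ∘ p1 - cs_p ch x1 ∘ p2) (m ∘ p1 + k ∘ p2) (- s).
  split=> //.
    rewrite compDl !compDr -!compA ![_ ∘ (i1 ∘ _)]compA ![_ ∘ (i2 ∘ _)]compA.
    by rewrite p11 p12 p21 p22 !comp0m !comp1m !compm0 addr0 add0r mg subrK.
  rewrite compNl compBr compDr opprB addrC !compA sp; congr (_ + _).
  rewrite -compNl; congr (_ ∘ _); apply: (se_epi fg0).
  rewrite compNl -!compA bg0 mg compBr (se_comp0 (cs_exact ch x2)) sub0r.
  by rewrite !compA sp.
apply: (stable_tr_iso (u := v0) (v := w0 ∘ i1') (w := fmap S u0) _ _ _ _ _ _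
  (connecting_Delta E')) => //.
- by apply: is_iso_comp => //; exists (scls X W (y := mkX Xe) i1).
- exact: fmap_iso.
- rewrite gv0 -compA; congr (_ ∘ _); apply: (iso_mono i1I).
  rewrite compA Ki1 comp1m sclsM; apply/sclsP.
  rewrite -opprB addrAC subrr add0r; apply/null_opp.
  by apply: null_factor; apply: cs_inW.
- apply: (iso_epi i1I); rewrite compA -!compA i1K compm1 hw0 sclsM; congr (_ ∘ _).
  rewrite compBl -!compA p11 p21 compm0 subr0 compm1 //.
- by rewrite compNl -fmapM fu0 fmapM (sclsN (x := S x1) (y := S x2)) compNr SfE.
Qed.

Lemma stable_pretriangulated : pretriangulated St.
Proof.
split; [exact: stable_tr_iso| |exact: stable_tr_id_shift
       |exact: stable_tr_rotate|exact: stable_tr_morphism].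
move=> a; pose z : St := mkX (cg_zero cg).
have z0 : is_zero z.
  by apply/is_zeroP/scls0P; rewrite (proj1 (zobP C) _ \id); apply: null_zero.
by exists z; split=> //; apply: stable_tr_id.
Qed.

(** Both morphisms can be replaced by admissible monomorphisms. The third
    isomorphism theorem then provides the octahedron, whose connecting morphisms
    are compatible by naturality. *)
Lemma stable_tr_octahedron : tr_octahedron St.
Proof.
move=> a b c z y x f j k g l i m n Df Dg Dgf.
have [f0 fE] := scls_surj f; have [g0 gE] := scls_surj g.
have [e1 [z1 [f1 [j1 [p1 [Df1 pf p1I]]]]]] := inflation f0.
have [e2 [x1 [g1 [l1 [p2 [Dg1 pg p2I]]]]]] := inflation (x := e1) (g0 ∘ p1).
have gfm := mono_se (mono_comp (se_mono Dg1) (se_mono Df1)).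
have [p [q [pj qm pq]]] := se_third Df1 Dg1 gfm.
pose y1 : stable X W := mkX (cg_ext cg pq (svalP z1) (svalP x1)).
have [a1 [n1 [_ af1 nm1]]] := connecting_exists (x3 := y1) gfm.
have [a2 [i1 Cg]] := connecting_exists Dg1.
have [a3 [d Cpq]] := connecting_exists (x2 := y1) pq.
have Cgf : connecting (x3 := y1) (g1 ∘ f1) (cokerm (g1 ∘ f1)) a1 n1 by [].
have Cf : connecting f1 j1 (a1 ∘ g1) (n1 ∘ p).
  split=> //; first by rewrite -compA.
  by rewrite -[LHS]compA pj [LHS]compA nm1 compA.
have [p1' [p1K Kp1]] := p1I; have [p2' [p2K Kp2]] := p2I.
have Dgf1 : @Delta St a e2 y1 (cl g1 ∘ cl f1)
    (scls X W (x := e2) (y := y1) (cokerm (g1 ∘ f1)))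
    (scls X W (x := y1) (y := S a) n1).
  by rewrite sclsM; apply: (connecting_Delta Cgf).
have oct : [/\ @Delta St z1 y1 x1 (scls X W (x := z1) (y := y1) p)
      (scls X W (x := y1) (y := x1) q)
      (fmap (Susp St) (cl j1) ∘ scls X W (x := x1) (y := S e1) i1),
    scls X W (x := z1) (y := y1) p ∘ cl j1 =
      scls X W (x := e2) (y := y1) (cokerm (g1 ∘ f1)) ∘ cl g1,
    (scls X W (x := y1) (y := S a) n1 : @hom St _ _) ∘
      scls X W (x := z1) (y := y1) p = scls X W (x := z1) (y := S a) (n1 ∘ p),
    scls X W (x := y1) (y := x1) q ∘
      scls X W (x := e2) (y := y1) (cokerm (g1 ∘ f1)) = cl l1
  & (scls X W (x := x1) (y := S e1) i1 : @hom St _ _) ∘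
      scls X W (x := y1) (y := x1) q =
    fmap (Susp St) (cl f1) ∘ scls X W (x := y1) (y := S a) n1].
  split.
  - have := connecting_natural (x2' := y1) (u := j1)
      (v := cokerm (g1 ∘ f1)) (w := \id) Cg Cpq pj _.
    rewrite scls1 compm1 => <-; last by rewrite comp1m.
    exact: connecting_Delta Cpq.
  - by rewrite !sclsM pj.
  - exact: (sclsM (z := S a)).
  - by rewrite sclsM qm.
  - apply: (connecting_natural (u := f1) (v := \id) Cgf Cg); rewrite ?comp1m //.
    by rewrite compm1.
apply: (octahedron_transport (u := idm a) (v := p1') (w := p2')
  stable_pretriangulated Df Dg Dgf (connecting_Delta Cf) (connecting_Delta Cg)
  Dgf1 _ _ _ _ _ oct).
- by apply: (iso_mono p1I); rewrite compm1 compA Kp1 comp1m sclsM pf fE.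
- apply: (iso_mono p2I); rewrite [RHS]compA Kp2 comp1m compA sclsM pg -sclsM.
  by rewrite -compA Kp1 compm1 gE.
- exact: is_iso_id.
- by exists (cl p1).
- by exists (cl p2).
Qed.

Lemma stable_additive : additive_category (stable X W).
Proof.
split.
  exists (mkX (cg_zero cg)); apply/is_zeroP/scls0P.
  by rewrite (proj1 (zobP C) _ \id); apply: null_zero.
move=> x y; have [e [i1 [i2 [p1 [p2 bi]]]]] := dsumP (sval x) (sval y).
pose s := mkX (cg_sum bi (svalP x) (svalP y)); exists s.
have [p11 p22 p12 p21 e1] := bi.
exists (scls X W (y := s) i1), (scls X W (y := s) i2).
exists (scls X W (x := s) p1), (scls X W (x := s) p2).
split; rewrite !sclsM ?p11 ?p22 ?p12 ?p21 ?scls0 //.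
by rewrite -sclsD e1.
Qed.

Lemma stable_right_triangulated : right_triangulated St.
Proof.
split; first exact: stable_additive.
split; [exact: stable_tr_iso|split|exact: stable_tr_rotate
  |exact: stable_tr_morphism|exact: stable_tr_octahedron].
  exact: stable_tr_id.
exact: stable_tr_cone.
Qed.

(** * Strong Frobenius pairs *)

Section Strong.
Hypothesis Wproj : forall w, W w -> rel_projective X w.
Hypothesis Wgen : forall x : C, X x -> exists (x' w : C) (f : hom x' w)
  (g : hom w x), [/\ short_exact f g, W w & X x'].

Lemma null_lift (x w s y : C) (f : hom y x) (i : hom s w) (p : hom w x) :
  short_exact i p -> X s -> null W f -> exists t, p ∘ t = f.
Proof.
move=> ip Xs; elim=> [v h k Wv||h k _ [t tP] _ [u uP]].
- by have [t <-] := Wproj Wv ip Xs h; exists (t ∘ k); rewrite compA.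
- by exists 0; rewrite compm0.
- by exists (t - u); rewrite compBr tP uP.
Qed.

(** A morphism Σx -> Σy lifts to the middle terms of the chosen sequences, since
    the middle term for x is projective relative to X; restrict the lift to
    x. *)
Lemma shift_full : full (Susp St).
Proof.
move=> x y g; have [g0 <-] := scls_surj g.
have [k kP] := Wproj (cs_inW ch x) (cs_exact ch y) (svalP y) (g0 ∘ cs_p ch x).
have [|f fP] := @se_lift _ _ _ _ _ _ _ (k ∘ cs_i ch x) (cs_exact ch y).
  by rewrite compA kP -compA (se_comp0 (cs_exact ch x)) compm0.
exists (cl f); apply: (induced_cls S (f := f)).
by exists k; rewrite fP kP.
Qed.

Lemma shift_faithful : faithful (Susp St).
Proof.
move=> x y f; have [f0 <-] := scls_surj f.
have [s sP] := if_exists S f0; have [k [ki sp]] := sP.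
have SfE := induced_cls S sP; rewrite /= in SfE *.
rewrite SfE => /(proj1 (@scls0P _ X W (S x) (S y) s)).
move=> /(null_lift (cs_exact ch y) (svalP y)) [t tP].
have [|r rP] := @se_lift _ _ _ _ _ _ _ (k - t ∘ cs_p ch x) (cs_exact ch y).
  by rewrite compBr -sp -tP compA subrr.
apply/scls0P.
have -> : f0 = r ∘ cs_i ch x.
  apply: (se_mono (cs_exact ch y)); rewrite -ki [RHS]compA rP compBl -compA.
  by rewrite (se_comp0 (cs_exact ch x)) compm0 subr0.
by apply: null_factor; apply: cs_inW.
Qed.

(** Given 0 -> y -> w -> x -> 0 with w in W, this sequence and the chosen one of
    y are two embeddings of y into objects of W, which are compared using
    relative injectivity both ways. Hence Σy is isomorphic to x. *)
Lemma shift_surjective : essentially_surjective (Susp St).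
Proof.
move=> x; have [x' [w [f [g [fg Ww Xx']]]]] := Wgen (svalP x).
pose y : stable X W := mkX Xx'; exists y.
have [a [b [_ af bg]]] := connecting_exists (x1 := y) (x2 := mkX (cg_sub cg Ww)) fg.
have ip := cs_exact ch y.
have [a' a'i] := cg_inj cg Ww ip (cs_inX ch y) f.
have [|b' b'p] := @se_colift _ _ _ _ _ _ _ (g ∘ a') ip.
  by rewrite -compA a'i (se_comp0 fg).
exists (scls X W (x := S y) (y := x) b').
apply: (scls_iso (x := S y) (g := b)).
  have [|m mp] := @se_colift _ _ _ _ _ _ _ (a ∘ a' - \id) ip.
    by rewrite compBl -compA a'i af comp1m subrr.
  rewrite (_ : _ - _ = cs_p ch y ∘ m); first by apply: null_factor; apply: cs_inW.
  apply: (se_epi ip).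
  by rewrite compBl -!compA b'p [b ∘ _]compA bg mp compBr comp1m compm1 compA.
have [|m mg] := @se_colift _ _ _ _ _ _ _ (a' ∘ a - \id) fg.
  by rewrite compBl -compA af a'i comp1m subrr.
rewrite (_ : _ - _ = g ∘ m); first exact: null_factor.
apply: (se_epi fg).
by rewrite compBl -!compA bg [b' ∘ _]compA b'p mg compBr comp1m compm1 compA.
Qed.

Lemma stable_triangulated : triangulated St.
Proof.
split; first exact: stable_right_triangulated.
  exact: ff_equivalence shift_full shift_faithful shift_surjective.
exact: (tr_rotate_back_ff stable_pretriangulated stable_tr_cone
  shift_full shift_faithful).
Qed.

End Strong.
End StableTriangulated.

(** * Functors induced between stable categories *)

Section InducedFunctor.
Variables (C D : precat) (X W : C -> Prop) (X' W' : D -> Prop).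
Variable F0 : {x : C | X x} -> D.
Variable R : forall x y : {x : C | X x},
  hom (sval x) (sval y) -> hom (F0 x) (F0 y) -> Prop.
Hypothesis F0X : forall x, X' (F0 x).
Hypothesis Rtotal : forall x y (f : hom (sval x) (sval y)),
  exists g, R (x := x) (y := y) f g.
Hypothesis Rid : forall x, R (idm (sval x)) (idm (F0 x)).
Hypothesis Rcomp : forall x y z (g : hom (sval y) (sval z))
    (f : hom (sval x) (sval y)) (g' : hom (F0 y) (F0 z))
    (f' : hom (F0 x) (F0 y)),
  R g g' -> R f f' -> R (g ∘ f) (g' ∘ f').
Hypothesis Rsub : forall x y (f g : hom (sval x) (sval y))
    (f' g' : hom (F0 x) (F0 y)), R f f' -> R g g' -> R (f - g) (f' - g').
Hypothesis Rnull : forall x y (f : hom (sval x) (sval y)) f',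
  R (x := x) (y := y) f f' -> null W f -> null W' f'.

Local Notation obF x := (exist X' (F0 x) (F0X x) : stable X' W').

Definition induced_map (x y : stable X W) (q : hom x y) : hom (obF x) (obF y) :=
  scls X' W' (x := obF x) (y := obF y) (projT1 (cid (Rtotal (repr q)))).

Lemma induced_mapE (x y : stable X W) (f : hom (sval x) (sval y)) f' :
  R (x := x) (y := y) f f' ->
  induced_map (scls X W (x := x) (y := y) f) =
  scls X' W' (x := obF x) (y := obF y) f'.
Proof.
move=> ff'; rewrite /induced_map; case: cid => /= g fg.
apply/(@sclsP _ X' W' (obF x) (obF y)).
apply: Rnull (Rsub fg ff') _; apply/clsP.
exact: reprK (scls X W (x := x) (y := y) f).
Qed.

Lemma induced_functor_exists : inhabited (@induced_functor C D X W X' W' F0 R).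
Proof.
split; exists F0X induced_map => // [x|x y z g f|x y f g|x y f g].
- exact: induced_mapE (Rid x).
- have [f0 <-] := scls_surj f; have [g0 <-] := scls_surj g.
  have [f' ff'] := Rtotal f0; have [g' gg'] := Rtotal g0.
  rewrite sclsM (induced_mapE (Rcomp gg' ff')) (induced_mapE ff').
  by rewrite (induced_mapE gg') sclsM.
- have [f0 <-] := scls_surj f; have [g0 <-] := scls_surj g.
  have [f' ff'] := Rtotal f0; have [g' gg'] := Rtotal g0.
  rewrite -sclsD (induced_mapE ff') (induced_mapE gg') -sclsD.
  apply: induced_mapE.
  have RN : R (- g0) (- g').
    rewrite -[- g0]sub0r -[- g']sub0r -(subrr g0) -(subrr g').
    by apply: (Rsub (Rsub gg' gg') gg').
  by rewrite -[g0]opprK -[g']opprK; apply: Rsub.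
- exact: induced_mapE.
Qed.

End InducedFunctor.

Lemma stable_shift_exists (C : abelian) (X W : C -> Prop)
    (cg : cogenerated X W) (ch : cosyzygies X W) : inhabited (stable_shift ch).
Proof.
apply: induced_functor_exists.
- exact: cs_inX.
- move=> x y f; have [a af] :=
    cg_inj cg (cs_inW ch y) (cs_exact ch x) (cs_inX ch x) (cs_i ch y ∘ f).
  have [|b bP] := @se_colift _ _ _ _ _ _ _ (cs_p ch y ∘ a) (cs_exact ch x).
    by rewrite -compA af compA (se_comp0 (cs_exact ch y)) comp0m.
  by exists b, a.
- by move=> x; exists \id; rewrite !compm1 !comp1m.
- move=> x y z g f g' f' [a [ai ap]] [b [bi bp]]; exists (a ∘ b).
  by rewrite -!compA bi bp !compA ai ap.
- move=> x y f g f' g' [a [ai ap]] [b [bi bp]]; exists (a - b).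
  by rewrite !compBl !compBr ai ap bi bp.
move=> x y f f' [a [ai ap]] /(null_cs cg) => /(_ ch) [t tP].
have [|m mP] := @se_colift _ _ _ _ _ _ _ (a - cs_i ch y ∘ t) (cs_exact ch x).
  by rewrite compBl ai -compA tP subrr.
have -> : f' = cs_p ch y ∘ m.
  apply: (se_epi (cs_exact ch x)); rewrite ap -compA mP compBr compA.
  by rewrite (se_comp0 (cs_exact ch y)) comp0m subr0.
by apply: null_factor; apply: cs_inW.
Qed.

Section Subcat.
Variables (C : precat) (X : C -> Prop).

(** Taking cokernels, or applying T, is a functor before passing to the stable
    category, but with good properties only on objects of X. *)
Program Definition subcat : precat := @Precat {x : C | X x}
  (fun x y => hom (sval x) (sval y)) (fun x => idm (sval x))
  (fun x y z g f => g ∘ f) _ _ _ _ _.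
Next Obligation. exact: compA. Qed.
Next Obligation. exact: comp1m. Qed.
Next Obligation. exact: compm1. Qed.
Next Obligation. exact: compDl. Qed.
Next Obligation. exact: compDr. Qed.

Definition exact_functor (D : precat) (G : functor subcat D) : Prop :=
  forall (x y z : subcat) (f : hom (sval x) (sval y)) (g : hom (sval y) (sval z)),
  short_exact f g ->
  short_exact (fmap G (f : @hom subcat x y)) (fmap G (g : @hom subcat y z)).

End Subcat.

Section FunctorOnSubcat.
Variables (C D : precat) (X W : C -> Prop) (X' W' : D -> Prop).
Hypothesis WX : forall w, W w -> X w.
Variable G : functor (subcat X) D.
Hypothesis GX : forall x, X' (G x).
Hypothesis GW : forall x : subcat X, W (sval x) -> W' (G x).
Variable R : forall x y : {x : C | X x},
  hom (sval x) (sval y) -> hom (G x) (G y) -> Prop.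
Hypothesis RG : forall (x y : subcat X) (f : hom x y), R f (fmap G f).

Lemma fmap_null (x y : subcat X) (f : hom (sval x) (sval y)) :
  null W f -> null W' (fmap G (f : hom x y)).
Proof.
elim=> [w h k Ww||h k _ IHh _ IHk].
- pose w' : subcat X := exist X w (WX Ww).
  rewrite (fmapM G (h : hom w' y) (k : hom x w')).
  by apply: null_factor; apply: GW.
- by rewrite (fmap0 G x y); apply: null_zero.
- by rewrite (fmapB G (h : hom x y) k); apply: null_sub.
Qed.

Lemma functor_induced :
  (forall (x y : subcat X) (f : hom x y) g, R f g -> g = fmap G f) ->
  inhabited (@induced_functor C D X W X' W' G R).
Proof.
move=> RE; apply: induced_functor_exists => //.
- by move=> x y f; exists (fmap G (f : @hom (subcat X) x y)).
- by move=> x; rewrite -(fmap1 G); apply: RG.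
- move=> x y z g f g' f' /RE -> /RE ->.
  by rewrite -(fmapM G); apply: RG.
- by move=> x y f g f' g' /RE -> /RE ->; rewrite -(fmapB G); apply: RG.
- by move=> x y f f' /RE ->; apply: fmap_null.
Qed.

End FunctorOnSubcat.

(** An exact functor sends the chosen sequence of x to one that starts with the
    image of x and has its middle term in W'; its connecting morphism compares
    the two suspensions. *)
Section ExactFunctor.
Variables (C D : abelian) (X W : C -> Prop) (X' W' : D -> Prop).
Hypotheses (cg : cogenerated X W) (cg' : cogenerated X' W').
Variables (ch : cosyzygies X W) (ch' : cosyzygies X' W').
Variables (S : stable_shift ch) (S' : stable_shift ch').
Variable G : functor (subcat X) D.
Hypothesis Gexact : exact_functor G.
Hypothesis GW : forall x : subcat X, W (sval x) -> W' (G x).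
Variable R : forall x y : {x : C | X x},
  hom (sval x) (sval y) -> hom (G x) (G y) -> Prop.
Hypothesis RG : forall (x y : subcat X) (f : hom x y), R f (fmap G f).
Variable F : @induced_functor C D X W X' W' G R.

Local Notation St := (stableT S).
Local Notation St' := (stableT S').

Lemma induced_scls (x y : stable X W) (f : hom (sval x) (sval y)) :
  fmap F (scls X W (x := x) (y := y) f) =
  scls X' W' (x := F x) (y := F y) (fmap G (f : @hom (subcat X) x y)).
Proof. exact/induced_cls/RG. Qed.

Let Gm (x y : stable X W) (f : hom (sval x) (sval y)) :
  hom (sval (F x)) (sval (F y)) := fmap G (f : @hom (subcat X) x y).

Let wob (x : stable X W) : stable X W :=
  exist X (cs_W ch x) (cg_sub cg (cs_inW ch x)).

Lemma exact_functor_triangle : @right_triangle_functor St St' F.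
Proof.
pose Gi x := fmap G (cs_i ch x : @hom (subcat X) x (wob x)).
pose Gp x := fmap G (cs_p ch x : @hom (subcat X) (wob x) (S x)).
have GiGp x : short_exact (Gi x) (Gp x).
  exact: (Gexact (x := x) (y := wob x) (z := S x) (cs_exact ch x)).
have conn x : exists b a, connecting (ch := ch') (x1 := F x) (x2 := F (wob x))
    (x3 := F (S x)) (Gi x) (Gp x) a b.
  have [a [b ab]] := connecting_exists cg' ch' (x1 := F x) (x2 := F (wob x))
    (x3 := F (S x)) (GiGp x).
  by exists b, a.
pose phi0 x := projT1 (cid (conn x)).
have phiP x : exists a, connecting (ch := ch') (x1 := F x) (x2 := F (wob x))
    (x3 := F (S x)) (Gi x) (Gp x) a (phi0 x) by exact: projT2 (cid (conn x)).
pose phi (x : St) : @hom St' (F (S x)) (S' (F x)) :=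
  scls X' W' (x := F (S x)) (y := S' (F x)) (phi0 x).
have phiI x : is_iso (phi x).
  have [a [fg af bg]] := phiP x.
  have ip := cs_exact ch' (F x).
  have [a' a'i] := cg_inj cg' (GW (x := wob x) (cs_inW ch x)) ip (cs_inX ch' (F x))
    (Gi x).
  have [|b' b'p] := @se_colift _ _ _ _ _ _ _ (Gp x ∘ a') ip.
    by rewrite -compA a'i (se_comp0 fg).
  apply: (scls_iso (x := F (S x)) (y := S' (F x)) (g := b')).
    have [|m mg] := @se_colift _ _ _ _ _ _ _ (a' ∘ a - \id) fg.
      by rewrite compBl -compA af a'i comp1m subrr.
    rewrite (_ : _ - _ = Gp x ∘ m).
      by apply: null_factor; apply: (GW (x := wob x)); apply: cs_inW.
    apply: (se_epi fg).
    by rewrite compBl -!compA bg [b' ∘ _]compA b'p mg compBr comp1m compm1 compA.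
  have [|m mp] := @se_colift _ _ _ _ _ _ _ (a ∘ a' - \id) ip.
    by rewrite compBl -compA a'i af comp1m subrr.
  rewrite (_ : _ - _ = cs_p ch' (F x) ∘ m).
    by apply: null_factor; apply: cs_inW.
  apply: (se_epi ip).
  by rewrite compBl -!compA b'p [phi0 x ∘ _]compA bg mp compBr comp1m compm1 compA.
have phiN (x y : stable X W) (f : hom x y) :
    phi y ∘ fmap F (fmap (Susp St) f) = fmap (Susp St') (fmap F f) ∘ phi x.
  have [f0 <-] := scls_surj f.
  have [s sP] := if_exists S f0; have [k [ki sp]] := sP.
  have [a1 c1] := phiP x; have [a2 c2] := phiP y.
  rewrite (induced_cls S sP) !induced_scls.
  have N := connecting_natural S' c1 c2 (u := Gm f0)
    (v := Gm (x := wob x) (y := wob y) k) (w := Gm (x := S x) (y := S y) s).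
  apply: N; rewrite -!(fmapM G); congr fmap; exact/esym.
exists phi; split=> // a b c f g h.
  move=> [x1 [x2 [x3 [f0 [g0 [a0 [b0
    [[fg af bg] [u [v [w [[ui vi wi] fu gv hw]]]]]]]]]]]].
  have [a1 c1] := phiP x1.
  have GD : short_exact (Gm f0) (Gm g0).
    exact: (Gexact (x := x1) (y := x2) (z := x3) fg).
  have [a2 [b2 c2]] := connecting_exists cg' ch' GD.
  have N : scls X' W' (x := F x3) (y := S' (F x1)) b2 =
      (phi x1 ∘ fmap F (scls X W (x := x3) (y := S x1) b0) : @hom St' _ _).
    rewrite induced_scls; apply: esym.
    have := connecting_natural S' (u := idm (sval (F x1)))
      (v := Gm (y := wob x1) a0) (w := Gm (y := S x1) b0) c2 c1.
    rewrite scls1 fmap1 comp1m; apply.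
      by rewrite compm1 /Gi -af; apply: (fmapM G).
    by rewrite -!(fmapM G); congr fmap; apply/esym.
  apply: (stable_tr_iso (u := fmap F u) (v := fmap F v) (w := fmap F w)
    _ _ _ _ _ _ (connecting_Delta S' c2)); try exact: fmap_iso.
  + by rewrite -(induced_scls f0) -!(fmapM F) fu.
  + by rewrite -(induced_scls g0) -!(fmapM F) gv.
  + rewrite N [RHS]compA -phiN -[RHS]compA -[LHS]compA.
    by congr (_ ∘ _); rewrite -!(fmapM F) hw.
Qed.

End ExactFunctor.

(** * Exactness of T *)

Section RightExact.
Variables (A B : abelian) (T : functor B A) (T_rexact : right_exact T).

Lemma T_epi (x y : B) (f : hom x y) : epi f -> epi (fmap T f).
Proof. by move=> /epi_se /T_rexact []. Qed.

Lemma T_cokernel (x y z : B) (f : hom x y) (p : hom y z) :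
  is_cokernel f p -> is_cokernel (fmap T f) (fmap T p).
Proof.
move=> fp; have pe := cokernel_epi fp; have Tp := T_epi pe.
have [e [ee eP]] := cokernel_image fp.
have [/exact_cokernel /(_ Tp) [Tkp0 TkK] _] := T_rexact (epi_se pe).
apply: is_cokernel_intro => //; first by rewrite -fmapM (proj1 fp) fmap0.
move=> t u; rewrite -eP fmapM compA => /(epi_zero (T_epi ee)) /TkK [v [vP _]].
by exists v.
Qed.

(** In the presentation of y as the cokernel of P_1 -> x ⊕ P_0, an element of
    T(x) killed by T(f) comes from a cycle of T(P_1). Such a cycle comes from
    T(P_2), and the composite P_2 -> P_1 -> x vanishes. *)
Lemma L1T_mono (x y z : B) (f : hom x y) (g : hom y z) :
  left_derived T 1 z (zob A) -> short_exact f g -> mono (fmap T f).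
Proof.
move=> [P /exact_cover [Td0 TdK]] fg.
have [l [t [td dK]]] := resolution_presentation P fg.
have [m [i1 [i2 [p1 [p2 bi]]]]] := dsumP x (P 0%N).
have TK := T_cokernel (dK _ _ _ _ _ bi).
have [p11 p22 p12 p21 _] := bi.
apply/mono0P => s z0 fz0.
have [|s1 [e1 [q [e1e qP]]]] := cokernel_cover (u := fmap T i1 ∘ z0) TK.
  by rewrite compA -fmapM compDl -!compA p11 p21 compm0 compm1 addr0.
have [|s2 [e2 [r [e2e rP]]]] := TdK _ q.
  apply/oppr_inj; rewrite oppr0 -compNl -fmapN.
  have -> : - pr_d P 0 = p2 ∘ (i1 ∘ t - i2 ∘ pr_d P 0).
    by rewrite compBr !compA p21 p22 comp1m comp0m sub0r.
  by rewrite fmapM -compA qP !compA -fmapM p21 fmap0 !comp0m.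
apply: (epi_zero (epi_comp e1e e2e)).
have zE : z0 ∘ e1 = fmap T t ∘ q.
  have := congr1 (comp (fmap T p1)) qP; rewrite !compA -!fmapM compBr !compA.
  by rewrite p11 p12 comp1m comp0m subr0 fmap1 comp1m => ->.
by rewrite compA zE -compA -rP compA -fmapM td fmap0 comp0m.
Qed.

Lemma L1T_exact (x y z : B) (f : hom x y) (g : hom y z) :
  left_derived T 1 z (zob A) -> short_exact f g ->
  short_exact (fmap T f) (fmap T g).
Proof.
move=> Lz fg; have Tf := L1T_mono Lz fg.
have TK := T_cokernel (proj2 fg); split=> //.
apply: is_kernel_intro => // [|t u gu0]; first by case: TK.
have [t' [c [v [ce vP]]]] := cokernel_cover TK gu0.
exact: mono_cover Tf ce vP.
Qed.

(** * The comma category is abelian *)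

Local Notation K := (comma T).
Implicit Types L M N : K.

Definition mkhom M N (a : hom (cA M) (cA N)) (b : hom (cB M) (cB N))
    (ab : cphi N ∘ fmap T b = a ∘ cphi M) : hom M N :=
  @CommaHom B A T M N (a, b) (introT eqP ab).

(** Morphisms from (x, 0) and from (Ty, y)_id detect the two components of an
    object of the comma category, and morphisms to (0, y) and (x, 0) the
    components of an epimorphism. *)
Definition inA (x : A) : K := @CommaOb B A T x (zob B) 0.
Definition inB (y : B) : K := @CommaOb B A T (zob A) y 0.
Definition inT (y : B) : K := @CommaOb B A T (T y) y \id.

Lemma T_zob (x : A) (f : hom (T (zob B)) x) : f = 0.
Proof.
rewrite -[f]compm1 -fmap1 (proj1 (zobP B) _ \id) fmap0 compm0 //.
Qed.

Fact inA_subproof (x : A) M (u : hom x (cA M)) :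
  cphi M ∘ fmap T (0 : hom (zob B) (cB M)) = u ∘ cphi (inA x).
Proof. by rewrite fmap0 !compm0. Qed.
Definition inA_hom (x : A) M (u : hom x (cA M)) : hom (inA x) M :=
  mkhom (M := inA x) (inA_subproof u).

Fact inT_subproof (y : B) M (u : hom y (cB M)) :
  cphi M ∘ fmap T u = (cphi M ∘ fmap T u) ∘ cphi (inT y).
Proof. by rewrite compm1. Qed.
Definition inT_hom (y : B) M (u : hom y (cB M)) : hom (inT y) M :=
  mkhom (M := inT y) (inT_subproof u).

Fact to_inA_subproof (x : A) M (u : hom (cA M) x) (u0 : u ∘ cphi M = 0) :
  cphi (inA x) ∘ fmap T (0 : hom (cB M) (zob B)) = u ∘ cphi M.
Proof. by rewrite u0 comp0m. Qed.
Definition to_inA (x : A) M (u : hom (cA M) x) (u0 : u ∘ cphi M = 0) :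
  hom M (inA x) := mkhom (N := inA x) (to_inA_subproof u0).

Fact to_inB_subproof (y : B) M (u : hom (cB M) y) :
  cphi (inB y) ∘ fmap T u = (0 : hom (cA M) (zob A)) ∘ cphi M.
Proof. by rewrite !comp0m. Qed.
Definition to_inB (y : B) M (u : hom (cB M) y) : hom M (inB y) :=
  mkhom (N := inB y) (to_inB_subproof u).

Lemma comma_mono M N (f : hom M N) : mono f -> mono (homA f) /\ mono (homB f).
Proof.
move=> /mono0P fm; split; apply/mono0P => t u fu0.
  have /(congr1 (@homA _ _ _ _ _)) // : inA_hom u = 0.
  by apply: fm; apply: comma_hom_eq => //; apply: (proj1 (zobP B)).
have /(congr1 (@homB _ _ _ _ _)) // : inT_hom u = 0.
apply: fm; apply: comma_hom_eq => //.
change (homA f ∘ (cphi M ∘ fmap T u) = 0).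
by rewrite compA -comma_homP -compA -fmapM fu0 fmap0 compm0.
Qed.

Lemma comma_epi M N (f : hom M N) : epi f -> epi (homA f) /\ epi (homB f).
Proof.
move=> /epi0P fe.
have fB : epi (homB f).
  apply/epi0P => t u uf0; have /(congr1 (@homB _ _ _ _ _)) // : to_inB u = 0.
  by apply: fe; apply: comma_hom_eq => //; apply: (proj2 (zobP A)).
split=> //; apply/epi0P => t u uf0.
have u0 : u ∘ cphi N = 0.
  apply: (epi_zero (T_epi fB)).
  by rewrite -compA comma_homP compA uf0 comp0m.
have /(congr1 (@homA _ _ _ _ _)) // : to_inA u0 = 0.
by apply: fe; apply: comma_hom_eq => //; apply: (proj2 (zobP B)).
Qed.

Lemma comma_mono_intro M N (f : hom M N) :
  mono (homA f) -> mono (homB f) -> mono f.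
Proof.
move=> fA fB L u v uv; apply: comma_hom_eq.
  by apply: fA; move: (congr1 (@homA _ _ _ _ _) uv).
by apply: fB; move: (congr1 (@homB _ _ _ _ _) uv).
Qed.

Lemma comma_epi_intro M N (f : hom M N) :
  epi (homA f) -> epi (homB f) -> epi f.
Proof.
move=> fA fB L u v uv; apply: comma_hom_eq.
  by apply: fA; move: (congr1 (@homA _ _ _ _ _) uv).
by apply: fB; move: (congr1 (@homB _ _ _ _ _) uv).
Qed.

Lemma comma_kernel_intro L M N (f : hom L M) (g : hom M N) :
  is_kernel (homA g) (homA f) -> is_kernel (homB g) (homB f) -> is_kernel g f.
Proof.
move=> kA kB; have mA := kernel_mono kA.
apply: is_kernel_intro.
- exact: comma_mono_intro mA (kernel_mono kB).
- by apply: comma_hom_eq; [exact: (proj1 kA)|exact: (proj1 kB)].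
move=> K u gu0.
have [a [aP _]] := proj2 kA _ (homA u) (congr1 (@homA _ _ _ _ _) gu0).
have [b [bP _]] := proj2 kB _ (homB u) (congr1 (@homB _ _ _ _ _) gu0).
have ab : cphi L ∘ fmap T b = a ∘ cphi K.
  apply: mA; rewrite !compA -comma_homP -compA -fmapM bP comma_homP aP //.
by exists (mkhom ab); apply: comma_hom_eq.
Qed.

Lemma comma_cokernel_intro L M N (f : hom L M) (g : hom M N) :
  is_cokernel (homA f) (homA g) -> is_cokernel (homB f) (homB g) ->
  is_cokernel f g.
Proof.
move=> kA kB; have eA := cokernel_epi kA; have eB := cokernel_epi kB.
apply: is_cokernel_intro.
- exact: comma_epi_intro.
- by apply: comma_hom_eq; [exact: (proj1 kA)|exact: (proj1 kB)].
move=> K u gu0.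
have [a [aP _]] := proj2 kA _ (homA u) (congr1 (@homA _ _ _ _ _) gu0).
have [b [bP _]] := proj2 kB _ (homB u) (congr1 (@homB _ _ _ _ _) gu0).
have ab : cphi K ∘ fmap T b = a ∘ cphi N.
  apply: (T_epi eB).
  by rewrite -!compA -fmapM bP comma_homP comma_homP compA aP.
by exists (mkhom ab); apply: comma_hom_eq.
Qed.

Lemma comma_zero : is_zero (inA (zob A) : K).
Proof.
apply/is_zeroP; apply: comma_hom_eq; first exact: (proj1 (zobP A)).
exact: (proj1 (zobP B)).
Qed.

Lemma comma_biprod M N (b : K) (i1 : hom M b) (i2 : hom N b) (p1 : hom b M)
    (p2 : hom b N) :
  is_biproduct (homA i1) (homA i2) (homA p1) (homA p2) ->
  is_biproduct (homB i1) (homB i2) (homB p1) (homB p2) ->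
  is_biproduct i1 i2 p1 p2.
Proof. by move=> [? ? ? ? ?] [? ? ? ? ?]; split; apply: comma_hom_eq. Qed.

Lemma comma_dsum M N : exists b, direct_sum M N b.
Proof.
have [a [i1 [i2 [p1 [p2 ia]]]]] := dsumP (cA M) (cA N).
have [b [j1 [j2 [q1 [q2 jb]]]]] := dsumP (cB M) (cB N).
have [p11 p22 p12 p21 _] := ia; have [q11 q22 q12 q21 _] := jb.
pose s : K := @CommaOb B A T a b
  (i1 ∘ cphi M ∘ fmap T q1 + i2 ∘ cphi N ∘ fmap T q2).
have h1 : cphi s ∘ fmap T j1 = i1 ∘ cphi M.
  by rewrite compDl -!compA -!fmapM q11 q21 fmap1 fmap0 !compm0 compm1 addr0.
have h2 : cphi s ∘ fmap T j2 = i2 ∘ cphi N.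
  by rewrite compDl -!compA -!fmapM q12 q22 fmap1 fmap0 !compm0 compm1 add0r.
have h3 : cphi M ∘ fmap T q1 = p1 ∘ cphi s.
  by rewrite compDr !compA p11 p12 !comp0m comp1m addr0.
have h4 : cphi N ∘ fmap T q2 = p2 ∘ cphi s.
  by rewrite compDr !compA p21 p22 !comp0m comp1m add0r.
exists s, (mkhom (N := s) h1), (mkhom (N := s) h2), (mkhom (M := s) h3),
  (mkhom (M := s) h4).
exact: comma_biprod.
Qed.

Section KerCoker.
Variables (M N : K) (f : hom M N).

Fact ker_subproof : exists phi : hom (T (ker (homB f))) (ker (homA f)),
  cphi M ∘ fmap T (kerm (homB f)) = kerm (homA f) ∘ phi.
Proof.
have [|phi [phiP _]] := proj2 (kerP (homA f)) _ (cphi M ∘ fmap T (kerm (homB f))).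
  by rewrite compA -comma_homP -compA -fmapM (proj1 (kerP (homB f))) fmap0 compm0.
by exists phi.
Qed.
Definition comma_ker : K := CommaOb (projT1 (cid ker_subproof)).
Definition comma_kerm : hom comma_ker M :=
  mkhom (M := comma_ker) (projT2 (cid ker_subproof)).

Lemma comma_kerP : is_kernel f comma_kerm.
Proof. by apply: comma_kernel_intro; apply: kerP. Qed.

Fact coker_subproof : exists phi : hom (T (coker (homB f))) (coker (homA f)),
  phi ∘ fmap T (cokerm (homB f)) = cokerm (homA f) ∘ cphi N.
Proof.
apply: (coker_colift (T_cokernel (cokerP (homB f)))).
by rewrite -compA comma_homP compA (proj1 (cokerP (homA f))) comp0m.
Qed.
Definition comma_coker : K := CommaOb (projT1 (cid coker_subproof)).
Definition comma_cokerm : hom N comma_coker :=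
  mkhom (N := comma_coker) (projT2 (cid coker_subproof)).

Lemma comma_cokerP : is_cokernel f comma_cokerm.
Proof. by apply: comma_cokernel_intro; apply: cokerP. Qed.

Lemma comma_mono_is_kernel : mono f -> exists z (g : hom N z), is_kernel g f.
Proof.
move=> /comma_mono [fA fB]; exists comma_coker, comma_cokerm.
by apply: comma_kernel_intro; apply: mono_kernel_coker.
Qed.

Lemma comma_epi_is_cokernel : epi f -> exists z (g : hom z M), is_cokernel g f.
Proof.
move=> /comma_epi [fA fB]; exists comma_ker, comma_kerm.
by apply: comma_cokernel_intro; apply: epi_cokernel_ker.
Qed.

End KerCoker.

Definition comma_abelian : abelian :=
  @Abelian K (inA (zob A)) comma_zero comma_dsum comma_ker comma_kerm comma_kerP
    comma_coker comma_cokerm comma_cokerP comma_mono_is_kernel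
    comma_epi_is_cokernel.

Lemma comma_se_intro L M N (f : hom L M) (g : hom M N) :
  short_exact (homA f) (homA g) -> short_exact (homB f) (homB g) ->
  short_exact f g.
Proof.
move=> [kA cA] [kB cB].
by split; [apply: comma_kernel_intro|apply: comma_cokernel_intro].
Qed.

Lemma comma_seP L M N (f : hom L M) (g : hom M N) :
  short_exact f g ->
  short_exact (homA f) (homA g) /\ short_exact (homB f) (homB g).
Proof.
move=> fg; have [mA mB] := comma_mono (se_mono fg).
have [eA eB] := comma_epi (se_epi fg).
split; apply: se_intro => //.
- exact: (congr1 (@homA _ _ _ _ _) (se_comp0 fg)).
- move=> t u gu0; have [|v vP] := @se_lift _ _ _ _ _ _ _ (inA_hom u) fg.
    by apply: comma_hom_eq => //; apply: (proj1 (zobP B)).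
  by exists (homA v); apply: (congr1 (@homA _ _ _ _ _) vP).
- exact: (congr1 (@homB _ _ _ _ _) (se_comp0 fg)).
- move=> t u gu0; have [|v vP] := @se_lift _ _ _ _ _ _ _ (inT_hom u) fg.
    apply: comma_hom_eq => //; change (homA g ∘ (cphi M ∘ fmap T u) = 0).
    by rewrite compA -comma_homP -compA -fmapM gu0 fmap0 compm0.
  by exists (homB v); apply: (congr1 (@homB _ _ _ _ _) vP).
Qed.

End RightExact.

(** * Cokernels of monomorphisms of short exact sequences *)

Lemma isomorphic_cokernel (C : abelian) (X0 : C -> Prop) (x y c : C) (f : hom x y)
    (p : hom y c) :
  subcategory X0 -> is_cokernel f p -> X0 c -> X0 (coker f).
Proof.
move=> [X0iso _] fp; apply: X0iso.
have [u uP] := coker_colift fp (proj1 (cokerP f)).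
have [v vP] := coker_colift (cokerP f) (proj1 fp).
exists u, v; split; [apply: (cokernel_epi fp)|apply: (cokernel_epi (cokerP f))].
  by rewrite -compA uP vP comp1m.
by rewrite -compA vP uP comp1m.
Qed.

Section ThreeByThree.
Variable C : abelian.
Variables (a1 a2 a3 b1 b2 b3 c1 c2 c3 : C).
Variables (f : hom a1 a2) (g : hom a2 a3) (f' : hom b1 b2) (g' : hom b2 b3).
Variables (h1 : hom a1 b1) (h2 : hom a2 b2) (h3 : hom a3 b3).
Variables (p1 : hom b1 c1) (p2 : hom b2 c2) (p3 : hom b3 c3).
Hypotheses (fg : short_exact f g) (fg' : short_exact f' g').
Hypotheses (hf : h2 ∘ f = f' ∘ h1) (hg : h3 ∘ g = g' ∘ h2).

Lemma se_middle_mono : mono h1 -> mono h3 -> mono h2.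
Proof.
move=> m1 m3; apply/mono0P => t u hu0.
have [|v fv] := @se_lift _ _ _ _ _ _ _ u fg.
  by apply: (mono_zero m3); rewrite compA hg -compA hu0 compm0.
rewrite -fv (_ : v = 0) ?compm0 //; apply: (mono_zero m1).
by apply: (mono_zero (se_mono fg')); rewrite compA -hf -compA fv.
Qed.

Lemma se_cokernels (r : hom c1 c2) (s : hom c2 c3) :
  is_cokernel h1 p1 -> is_cokernel h2 p2 -> is_cokernel h3 p3 -> mono h3 ->
  r ∘ p1 = p2 ∘ f' -> s ∘ p2 = p3 ∘ g' -> short_exact r s.
Proof.
move=> k1 k2 k3 m3 rP sP.
have e1 := cokernel_epi k1; have e2 := cokernel_epi k2.
have e3 := cokernel_epi k3; have mf := se_mono fg'.
have rm : mono r.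
  apply/mono0P => t u ru0; have [t' [d [v [de pv]]]] := epi_cover u e1.
  have [|s1 [d1 [w [d1e hw]]]] := cokernel_cover (u := f' ∘ v) k2.
    by rewrite compA -rP -compA pv compA ru0 comp0m.
  have [|x fx] := @se_lift _ _ _ _ _ _ _ w fg.
    apply: (mono_zero m3); rewrite compA hg -compA hw !compA (se_comp0 fg').
    by rewrite !comp0m.
  apply: (epi_zero (epi_comp de d1e)); rewrite compA -pv -compA.
  have -> : v ∘ d1 = h1 ∘ x by apply: mf; rewrite compA -hw -fx !compA hf.
  by rewrite compA (proj1 k1) comp0m.
apply: se_intro => //.
- by apply: (@epi_left _ _ _ _ _ p2); rewrite sP; apply: epi_comp e3 (se_epi fg').
- by apply: e1; rewrite -compA rP compA sP -compA (se_comp0 fg') compm0 comp0m.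
move=> t u su0; have [t' [d [v [de pv]]]] := epi_cover u e2.
have [|s1 [d1 [w [d1e hw]]]] := cokernel_cover (u := g' ∘ v) k3.
  by rewrite compA -sP -compA pv compA su0 comp0m.
have [s2 [d2 [x [d2e gx]]]] := se_cover w fg.
have [|y fy] := @se_lift _ _ _ _ _ _ _ (v ∘ d1 ∘ d2 - h2 ∘ x) fg'.
  by rewrite compBr !compA -hg -hw -!compA gx subrr.
apply: (mono_cover (c := d ∘ d1 ∘ d2) (v := p1 ∘ y) rm).
  by do 2 apply: epi_comp => //.
rewrite compA rP -compA fy compBr [p2 ∘ (h2 ∘ _)]compA (proj1 k2) comp0m subr0.
by rewrite !compA pv.
Qed.

End ThreeByThree.

(** * Left Frobenius pairs *)

Section FrobeniusPair.
Variables (C : abelian) (X W : C -> Prop).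
Hypotheses (subX : subcategory X) (fr : left_Frobenius_pair X W).

Lemma frobenius_cogenerated : cogenerated X W.
Proof.
have [Xext _ _ _ [WX _]] := fr; split=> //.
- by apply: (proj2 subX); apply: zobP.
- by move=> w /WX [].
- by move=> w /WX [_ /Ext1_injective].
Qed.

(** Conversely to the definition, objects of X that are injective relative to X
    split off from an object of W. *)
Lemma frobenius_injective (x : C) : X x -> rel_injective X x -> W x.
Proof.
have [_ _ _ Ws [_ emb]] := fr => Xx xinj.
have [w [x' [f [g [fg Ww Xx']]]]] := emb x Xx.
by have [r rf] := xinj _ _ _ _ _ fg Xx' \id; apply: closed_retract rf Ww.
Qed.

Lemma frobenius_ext : closed_ext W.
Proof.
move=> x y z f g fg Wx Wz; have cg := frobenius_cogenerated.
apply: frobenius_injective.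
  by apply: (cg_ext cg fg); apply: (cg_sub cg).
have [r rf] := cg_inj cg Wx fg (cg_sub cg Wz) \id.
have [s [_ _ _ _ y1]] := retract_split fg rf.
move=> a b c h k hk Xc u.
have [v1 v1P] := cg_inj cg Wx hk Xc (r ∘ u).
have [v2 v2P] := cg_inj cg Wz hk Xc (g ∘ u).
exists (f ∘ v1 + s ∘ v2).
by rewrite compDl -!compA v1P v2P !compA -compDl y1 comp1m.
Qed.

Lemma frobenius_coker (x y z : C) (f : hom x y) (g : hom y z) :
  short_exact f g -> W x -> W y -> X z -> W z.
Proof.
move=> fg Wx Wy Xz; have cg := frobenius_cogenerated.
have [r rf] := cg_inj cg Wx fg Xz \id.
have [s [_ gs _ _ _]] := retract_split fg rf.
by have [_ _ _ Ws _] := fr; apply: closed_retract Ws gs Wy.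
Qed.

End FrobeniusPair.

(** * The Frobenius pair in the comma category *)

Section FrakB.
Variables (A B : abelian) (T : functor B A) (T_rexact : right_exact T).
Variables (W X : A -> Prop) (V Y : B -> Prop).
Hypotheses (subW : subcategory W) (subX : subcategory X).
Hypothesis subY : subcategory Y.
Hypotheses (TVW : forall v, V v -> W (T v)) (TYX : forall y, Y y -> X (T y)).
Hypothesis L1T : forall y, Y y -> left_derived T 1 y (zob A).
Hypotheses (frA : left_Frobenius_pair X W) (frB : left_Frobenius_pair Y V).

Local Notation K := (comma T).
Local Notation BXY := (frakB T X Y).
Local Notation BWV := (frakB T W V).
Implicit Types L M N : K.

Let cgA := frobenius_cogenerated subX frA.
Let cgB := frobenius_cogenerated subY frB.

Lemma T_exact (x y z : B) (f : hom x y) (g : hom y z) :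
  Y z -> short_exact f g -> short_exact (fmap T f) (fmap T g).
Proof. by move=> /L1T; apply: L1T_exact. Qed.

Lemma frakB_se M : BXY M -> short_exact (cphi M) (cokerm (cphi M)).
Proof. by case=> _ m _; apply: mono_se. Qed.

Lemma frakB_cA M : BXY M -> X (cA M).
Proof.
move=> MP; have [YM _ XM] := MP.
exact: (cg_ext cgA (frakB_se MP) (TYX YM) XM).
Qed.

Lemma frakB_WV_sub M : BWV M -> BXY M.
Proof.
move=> [VM m WM].
by split; [apply: (cg_sub cgB)| |apply: (cg_sub cgA)].
Qed.

Lemma frakB_WV_cA M : BWV M -> W (cA M).
Proof.
move=> [VM m WM].
exact: (frobenius_ext subX frA (mono_se m) (TVW VM) WM).
Qed.

Lemma inA_frakB (X0 : A -> Prop) (Y0 : B -> Prop) (x : A) :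
  subcategory X0 -> subcategory Y0 -> X0 x -> frakB T X0 Y0 (inA T x).
Proof.
move=> subX0 subY0 Xx; split; first by apply: (proj2 subY0); apply: zobP.
  by apply/mono0P => t u _; rewrite -[u]comp1m -fmap1 (T_zob (fmap T \id)) comp0m.
apply: (isomorphic_cokernel (p := idm x)) => //; apply: is_cokernel_intro.
- exact: epi_id.
- exact: compm0.
- by move=> t u _; exists u; rewrite compm1.
Qed.

Lemma inT_frakB (X0 : A -> Prop) (Y0 : B -> Prop) (y : B) :
  subcategory X0 -> Y0 y -> frakB T X0 Y0 (inT T y).
Proof.
move=> subX0 Yy; split=> //; first exact: mono_id.
apply: (isomorphic_cokernel (p := (0 : hom (T y) (zob A)))) => //.
  apply: is_cokernel_intro.
  - by apply/epi0P => t u _; apply: (proj1 (zobP A)).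
  - exact: comp0m.
  - by move=> t u; rewrite compm1 => ->; exists 0; rewrite comp0m.
by apply: (proj2 subX0); apply: zobP.
Qed.

Lemma frakB_coker_se L M N (f : hom L M) (g : hom M N)
    (r : hom (coker (cphi L)) (coker (cphi M)))
    (s : hom (coker (cphi M)) (coker (cphi N))) :
  short_exact f g -> BXY N ->
  r ∘ cokerm (cphi L) = cokerm (cphi M) ∘ homA f ->
  s ∘ cokerm (cphi M) = cokerm (cphi N) ∘ homA g -> short_exact r s.
Proof.
move=> /(comma_seP T_rexact) [fgA fgB] [YN mN _].
by apply: (se_cokernels (T_exact YN fgB) fgA (comma_homP f) (comma_homP g))
  => //; apply: cokerP.
Qed.

Lemma coker_map M N (f : hom M N) :
  exists r : hom (coker (cphi M)) (coker (cphi N)),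
    r ∘ cokerm (cphi M) = cokerm (cphi N) ∘ homA f.
Proof.
apply: (coker_colift (cokerP (cphi M))).
by rewrite -compA -comma_homP compA (proj1 (cokerP (cphi N))) comp0m.
Qed.

Lemma frakB_ext : closed_ext BXY.
Proof.
move=> L M N f g fg [YL mL XL] NP; have [YN mN XN] := NP.
have [fgA fgB] := comma_seP T_rexact fg.
have [r rP] := coker_map f; have [s sP] := coker_map g.
split.
- exact: (cg_ext cgB fgB YL YN).
- exact: (se_middle_mono (T_exact YN fgB) fgA (comma_homP f) (comma_homP g)).
- exact: (cg_ext cgA (frakB_coker_se fg NP rP sP) XL XN).
Qed.

(** The B-component extends because V is injective relative to Y. An extension
    a of the A-component need not commute with the structure maps, but its
    defect factors through T(Y_N), and extends along φ_N because W is injective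
    relative to X. *)
Lemma frakB_WV_injective J :
  BWV J -> rel_injective (C := comma_abelian T_rexact) BXY J.
Proof.
move=> JP L M N f g fg NP u; have [VJ _ _] := JP; have WJ := frakB_WV_cA JP.
have [YN mN XN] := NP; have [fgA fgB] := comma_seP T_rexact fg.
have [b bP] := cg_inj cgB VJ fgB YN (homB u).
have [a aP] := cg_inj cgA WJ fgA (frakB_cA NP) (homA u).
have [|d dP] := @se_colift _ _ _ _ _ _ _
    (cphi J ∘ fmap T b - a ∘ cphi M) (T_exact YN fgB).
  rewrite compBl -!compA -fmapM bP (comma_homP f) (comma_homP u) compA aP.
  by rewrite subrr.
have [d' d'P] := cg_inj cgA WJ (mono_se mN) XN d.
have ab : cphi J ∘ fmap T b = (a + d' ∘ homA g) ∘ cphi M.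
  by rewrite compDl -compA -comma_homP compA d'P dP addrC subrK.
exists (mkhom ab); apply: comma_hom_eq => //=.
change ((a + d' ∘ homA g) ∘ homA f = homA u).
by rewrite compDl aP -compA (se_comp0 fgA) compm0 addr0.
Qed.

Lemma frakB_cogenerated : cogenerated (C := comma_abelian T_rexact) BXY BWV.
Proof.
split.
- by apply: inA_frakB => //; apply: cg_zero cgA.
- exact: frakB_ext.
- exact: frakB_WV_sub.
- exact: frakB_WV_injective.
Qed.

(** Embed Y into V and Coker φ into W. As TV is injective relative to X, the map
    TY -> TV extends along φ, and (X, Y)_φ embeds into (TV ⊕ W, V). *)
Lemma frakB_embedding M : BXY M ->
  exists (J N : K) (f : hom M J) (g : hom J N),
    [/\ short_exact f g, BWV J & BXY N].
Proof.
move=> MP; have [YM mM XM] := MP.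
have [_ _ _ _ [_ embA]] := frA; have [_ _ _ _ [_ embB]] := frB.
have [v [y [j [k [jk Vv Yy]]]]] := embB _ YM.
have [w [x [i [p [ip Ww Xx]]]]] := embA _ XM.
have [t tP] := cg_inj cgA (TVW Vv) (mono_se mM) XM (fmap T j).
have [e [i1 [i2 [p1 [p2 bi]]]]] := dsumP (T v) w.
have [p11 p22 p12 p21 e1] := bi.
pose J : K := @CommaOb B A T e v i1.
pose c := cokerm (cphi M).
have cphi0 : c ∘ cphi M = 0 by case: (cokerP (cphi M)).
have fh : cphi J ∘ fmap T j = (i1 ∘ t + i2 ∘ (i ∘ c)) ∘ cphi M.
  by rewrite compDl -!compA tP cphi0 !compm0 addr0.
pose f : hom M J := mkhom (N := J) fh.
have se1 := biprod_se bi.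
have JP : BWV J.
  split=> //; first exact: se_mono se1.
  exact: (isomorphic_cokernel subW (proj2 se1)).
have Tjk := T_exact Yy jk.
(* The sequence 0 -> TY -> X -> Coker φ -> 0 maps into 0 -> TV -> TV ⊕ W -> W -> 0
   by monomorphisms. *)
have fA : mono (homA f).
  apply: (se_middle_mono (mono_se mM) se1 (h1 := fmap T j) (h3 := i)).
  - by rewrite -(comma_homP f).
  - by rewrite compDr !compA p21 p22 comp0m comp1m add0r.
  - exact: se_mono Tjk.
  - exact: se_mono ip.
have fm : mono f by apply: comma_mono_intro => //; apply: se_mono jk.
have fse := mono_se (C := comma_abelian T_rexact) fm.
pose N : K := comma_coker T_rexact f.
have p2f : p2 ∘ homA f = i ∘ c.
  by rewrite compDr !compA p21 p22 comp0m comp1m add0r.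
have [|s sP] := @coker_colift _ _ _ _ _ _ _ (p ∘ p2) (cokerP (homA f)).
  by rewrite -compA p2f compA (se_comp0 ip) comp0m.
have NP : short_exact (cphi N) s.
  apply: (se_cokernels (mono_se mM) se1 (h1 := fmap T j) (h2 := homA f) (h3 := i)
    (p1 := fmap T (cokerm j)) (p2 := cokerm (homA f)) (p3 := p)) => //.
  - exact: (T_cokernel T_rexact (cokerP j)).
  - exact: cokerP.
  - exact: (proj2 ip).
  - exact: se_mono ip.
  - exact: (comma_homP (comma_cokerm T_rexact f)).
exists J, N, f, (comma_cokerm T_rexact f); split=> //; split.
- exact: (isomorphic_cokernel subY (proj2 jk)).
- exact: se_mono NP.
- exact: (isomorphic_cokernel subX (proj2 NP)).
Qed.

Lemma cosyzygies_exist (C : precat) (X0 W0 : C -> Prop) :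
  (forall x, X0 x -> exists (w x' : C) (f : hom x w) (g : hom w x'),
     [/\ short_exact f g, W0 w & X0 x']) -> inhabited (cosyzygies X0 W0).
Proof.
move=> emb.
have F (x : {x : C | X0 x}) : {w : C & {x' : C & {f : hom (sval x) w &
    {g : hom w x' | [/\ short_exact f g, W0 w & X0 x']}}}}.
  have [w wP] := cid (emb _ (svalP x)); have [x' x'P] := cid wP.
  by have [f fP] := cid x'P; have [g gP] := cid fP; exists w, x', f, g.
split; exists (fun x => projT1 (F x)) (fun x => projT1 (projT2 (F x)))
  (fun x => projT1 (projT2 (projT2 (F x))))
  (fun x => sval (projT2 (projT2 (projT2 (F x))))) => x;
  by case: (svalP (projT2 (projT2 (projT2 (F x))))).
Qed.

(** * The strong Frobenius pair in the comma category *)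

Section Strong.
Hypothesis Wproj : forall w, W w -> rel_projective X w.
Hypothesis Vproj : forall v, V v -> rel_projective Y v.

(** Dually to the injectivity of BWV; the defect of commutation is now a
    morphism from T(B_J), which extends along the split monomorphism φ_J. *)
Lemma frakB_WV_projective J :
  BWV J -> rel_projective (C := comma_abelian T_rexact) BXY J.
Proof.
move=> JP L M N f g fg LP u; have [VJ mJ WJc] := JP; have WJ := frakB_WV_cA JP.
have [fgA fgB] := comma_seP T_rexact fg; have [YL _ _] := LP.
have [b bP] := Vproj VJ fgB YL (homB u).
have [a aP] := Wproj WJ fgA (frakB_cA LP) (homA u).
have [|d dP] := @se_lift _ _ _ _ _ _ _ (cphi M ∘ fmap T b - a ∘ cphi J) fgA.
  rewrite compBr !compA -comma_homP -compA -fmapM bP aP (comma_homP u).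
  by rewrite subrr.
have [r rP] := cg_inj cgA (TVW VJ) (mono_se mJ) (cg_sub cgA WJc) \id.
have ab : cphi M ∘ fmap T b = (a + homA f ∘ d ∘ r) ∘ cphi J.
  by rewrite compDl -!compA rP compm1 dP addrC subrK.
exists (mkhom ab); apply: comma_hom_eq => //=.
change (homA g ∘ (a + homA f ∘ d ∘ r) = homA u).
by rewrite compDr aP !compA (se_comp0 fgA) !comp0m addr0.
Qed.

Hypothesis Wgen : forall x, X x -> exists (x' w : A) (f : hom x' w) (g : hom w x),
  [/\ short_exact f g, W w & X x'].
Hypothesis Vgen : forall y, Y y -> exists (y' v : B) (f : hom y' v) (g : hom v y),
  [/\ short_exact f g, V v & Y y'].

(** Dually to the embedding, (X, Y)_φ is a quotient of (TV ⊕ W, V), with W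
    covering the cokernel of φ. The kernel stays in 𝔅 because X and Y are closed
    under kernels of epimorphisms. *)
Lemma frakB_generated M : BXY M ->
  exists (N J : K) (f : hom N J) (g : hom J M),
    [/\ short_exact f g, BWV J & BXY N].
Proof.
move=> MP; have [YM mM XM] := MP.
have [y [v [j [k [jk Vv Yy]]]]] := Vgen YM.
have [x [w [i [p [ip Ww Xx]]]]] := Wgen XM.
have seM := mono_se mM; set c := cokerm (cphi M) in seM.
have [t tP] := Wproj Ww seM (TYX YM) p.
have [e [i1 [i2 [p1 [p2 bi]]]]] := dsumP (T v) w.
have [p11 p22 p12 p21 e1] := bi.
pose J : K := @CommaOb B A T e v i1.
have gh : cphi M ∘ fmap T k = (cphi M ∘ fmap T k ∘ p1 + t ∘ p2) ∘ cphi J.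
  by rewrite compDl -!compA p11 p21 compm0 compm1 addr0.
pose g : hom J M := mkhom (M := J) gh.
have se1 := biprod_se bi.
have JP : BWV J.
  split=> //; first exact: se_mono se1.
  exact: (isomorphic_cokernel subW (proj2 se1)).
have Tjk := T_exact YM jk.
have cg : c ∘ homA g = p ∘ p2.
  by rewrite compDr !compA (se_comp0 seM) !comp0m add0r tP.
have gA : epi (homA g).
  apply/epi0P => r u ug0.
  have [|u' u'P] := @se_colift _ _ _ _ _ _ _ u seM.
    apply: (epi_zero (se_epi Tjk)); rewrite -compA (_ : _ ∘ _ = homA g ∘ i1).
      by rewrite compA ug0 comp0m.
    by rewrite compDl -!compA p11 p21 compm0 compm1 addr0.
  rewrite -u'P (_ : u' = 0) ?comp0m //; apply: (epi_zero (se_epi ip)).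
  by rewrite -[p]compm1 -p22 [p ∘ _]compA -cg !compA u'P ug0 comp0m.
have ge : epi g by apply: comma_epi_intro => //; apply: se_epi jk.
pose N : K := comma_ker g; pose f : hom N J := comma_kerm g.
have fg : short_exact f g := epi_se (C := comma_abelian T_rexact) ge.
have [fgA fgB] := comma_seP T_rexact fg.
have [_ XK _ _ _] := frA; have [_ YK _ _ _] := frB.
have [r rP] := coker_map f.
have TN := T_exact YM fgB.
exists N, J, f, g; split=> //; split.
- exact: (YK _ _ _ _ _ fgB (cg_sub cgB Vv)).
- apply: (@mono_right _ _ _ _ (homA f)); rewrite -(comma_homP f).
  exact: mono_comp (se_mono se1) (se_mono TN).
have [q qP] := coker_colift (cokerP (cphi J)) (proj1 (proj2 se1)).
have [q' q'P] := coker_colift (proj2 se1) (proj1 (cokerP (cphi J))).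
have rp : short_exact r (p ∘ q).
  apply: (frakB_coker_se fg MP rP).
  by rewrite -compA qP -cg.
have Xw : X (coker (cphi J)) := cg_sub cgA (isomorphic_cokernel subW (proj2 se1) Ww).
exact: XK rp Xw XM.
Qed.

End Strong.
End FrakB.

(** * The six functors *)

Section Recollement.
Variables (A B : abelian) (T : functor B A) (T_rexact : right_exact T).
Variables (W X : A -> Prop) (V Y : B -> Prop).
Hypotheses (subW : subcategory W) (subX : subcategory X).
Hypotheses (subV : subcategory V) (subY : subcategory Y).
Hypotheses (TVW : forall v, V v -> W (T v)) (TYX : forall y, Y y -> X (T y)).
Hypothesis L1T : forall y, Y y -> left_derived T 1 y (zob A).
Hypotheses (frA : left_Frobenius_pair X W) (frB : left_Frobenius_pair Y V).

Local Notation K := (comma T).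
Local Notation BXY := (frakB T X Y).
Local Notation BWV := (frakB T W V).

Let cgA := frobenius_cogenerated subX frA.
Let cgB := frobenius_cogenerated subY frB.
Let cgM : cogenerated (C := comma_abelian T_rexact) BXY BWV :=
  frakB_cogenerated T_rexact subX subY TVW TYX L1T frA frB.

Lemma from_zob_eq (y : B) (f g : hom (zob B) y) : f = g.
Proof. by rewrite [f](proj1 (zobP B)) [g](proj1 (zobP B)). Qed.

Definition inA_map (x y : A) (f : hom x y) : hom (inA T x) (inA T y) :=
  inA_hom (M := inA T y) f.

Program Definition GZ : functor (subcat X) K :=
  @Functor (subcat X) K (fun x => @CommaOb B A T (sval x) (zob B) 0)
    (fun x y f => inA_map f) _ _ _.
Next Obligation. by apply: comma_hom_eq => //; apply: from_zob_eq. Qed.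
Next Obligation. by apply: comma_hom_eq => //; apply: from_zob_eq. Qed.
Next Obligation. by apply: comma_hom_eq => //; apply: from_zob_eq. Qed.

Definition coker_fun (M N : K) (f : hom M N) := projT1 (cid (coker_map f)).

Lemma coker_funP (M N : K) (f : hom M N) :
  coker_fun f ∘ cokerm (cphi M) = cokerm (cphi N) ∘ homA f.
Proof. exact: projT2 (cid (coker_map f)). Qed.

Lemma coker_fun_unique (M N : K) (f : hom M N) c :
  c ∘ cokerm (cphi M) = cokerm (cphi N) ∘ homA f -> c = coker_fun f.
Proof.
by move=> cf; apply: (cokernel_epi (cokerP (cphi M))); rewrite cf coker_funP.
Qed.

Program Definition Gq : functor (subcat BXY) A :=
  @Functor (subcat BXY) A (fun M => coker (cphi (sval M)))
    (fun M N f => coker_fun f) _ _ _.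
Next Obligation.
by apply/esym/coker_fun_unique; rewrite comp1m; apply/esym/compm1.
Qed.
Next Obligation.
apply/esym/coker_fun_unique.
by rewrite -compA coker_funP compA coker_funP -compA.
Qed.
Next Obligation.
by apply/esym/coker_fun_unique; rewrite compDl !coker_funP -compDr.
Qed.

Program Definition GUA : functor (subcat BXY) A :=
  @Functor (subcat BXY) A (fun M => cA (sval M)) (fun M N f => homA f) _ _ _.

Program Definition GUB : functor (subcat BXY) B :=
  @Functor (subcat BXY) B (fun M => cB (sval M)) (fun M N f => homB f) _ _ _.

Fact inT_map_subproof (x y : B) (f : hom x y) :
  cphi (inT T y) ∘ fmap T f = fmap T f ∘ cphi (inT T x).
Proof. by rewrite comp1m compm1. Qed.

Definition inT_map (x y : B) (f : hom x y) : hom (inT T x) (inT T y) :=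
  mkhom (M := inT T x) (N := inT T y) (inT_map_subproof f).

Program Definition GTB : functor (subcat Y) K :=
  @Functor (subcat Y) K (fun y => @CommaOb B A T (T (sval y)) (sval y) \id)
    (fun x y f => inT_map f) _ _ _.
Next Obligation. by apply: comma_hom_eq => //; apply: fmap1. Qed.
Next Obligation. by apply: comma_hom_eq => //; apply: fmapM. Qed.
Next Obligation. by apply: comma_hom_eq => //; apply: fmapD. Qed.

Lemma GZ_exact : exact_functor GZ.
Proof.
move=> x y z f g fg; apply: (comma_se_intro T_rexact) => //.
have Z := zobP B; apply: se_intro.
- by apply/mono0P => t u _; apply: (proj2 Z).
- by apply/epi0P => t u _; apply: (proj1 Z).
- exact: comp0m.
- by move=> t u _; exists u; rewrite [u](proj2 Z) compm0.
Qed.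

Lemma Gq_exact : exact_functor Gq.
Proof.
move=> L M N f g fg.
by apply: (frakB_coker_se T_rexact L1T fg (svalP N)); apply: coker_funP.
Qed.

Lemma GUA_exact : exact_functor GUA.
Proof. by move=> L M N f g /(comma_seP T_rexact) []. Qed.

Lemma GUB_exact : exact_functor GUB.
Proof. by move=> L M N f g /(comma_seP T_rexact) []. Qed.

Lemma GTB_exact : exact_functor GTB.
Proof.
move=> x y z f g fg; apply: (comma_se_intro T_rexact) => //.
exact: (T_exact T_rexact L1T (svalP z) fg).
Qed.

Lemma Z_exists : inhabited (Z_functor T W X V Y).
Proof.
apply: (functor_induced (G := GZ) (cg_sub cgA)) => //.
- by move=> x; apply: inA_frakB => //; apply: svalP.
- by move=> x Wx; apply: inA_frakB.
- move=> x y f m mf; apply: comma_hom_eq => //.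
  exact: from_zob_eq.
Qed.

Lemma q_exists : inhabited (q_functor T W X V Y).
Proof.
apply: (functor_induced (G := Gq) (cg_sub cgM)) => //.
- by move=> M; case: (svalP M).
- by move=> M [].
- by move=> M N f; apply: (coker_funP (M := sval M) (N := sval N) f).
- by move=> M N f c; apply: (coker_fun_unique (M := sval M) (N := sval N)).
Qed.

Lemma UA_exists : inhabited (UA_functor T W X V Y).
Proof.
apply: (functor_induced (G := GUA) (cg_sub cgM)) => //.
- by move=> M; apply: (frakB_cA subX TYX frA (svalP M)).
- by move=> M; apply: (frakB_WV_cA subX TVW frA).
Qed.

Lemma UB_exists : inhabited (UB_functor T W X V Y).
Proof.
apply: (functor_induced (G := GUB) (cg_sub cgM)) => //.
- by move=> M; case: (svalP M).
- by move=> M [].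
Qed.

Lemma TB_exists : inhabited (TB_functor T W X V Y).
Proof.
apply: (functor_induced (G := GTB) (cg_sub cgB)) => //.
- by move=> y; apply: inT_frakB => //; apply: svalP.
- by move=> y Vy; apply: inT_frakB.
- by move=> x y f m [mA mB]; apply: comma_hom_eq.
Qed.

Variables (chA : cosyzygies X W) (chB : cosyzygies Y V).
Variables (chM : cosyzygies BXY BWV) (sc : s_choice T X W Y).

Definition s_ob (y : {y : B | Y y}) : K :=
  @CommaOb B A T (s_W sc y) (sval y) (s_sigma sc y).

Lemma s_ob_frakB y : BXY (s_ob y).
Proof. by split; [apply: svalP|apply: s_mono|apply: s_coker]. Qed.

Lemma s_ob_WV y : V (sval y) -> BWV (s_ob y).
Proof.
move=> Vy; split; [exact: Vy|exact: s_mono|].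
have fg := mono_se (@s_mono _ _ _ _ _ _ sc y).
exact: (frobenius_coker subX frA fg (TVW Vy) (s_inW sc y) (@s_coker _ _ _ _ _ _ sc y)).
Qed.

(** A morphism into an object with A-component in W is determined in the stable
    category by its B-component: if that vanishes, it factors through (W, 0). *)
Lemma homB_null (M N : K) (f : hom M N) : W (cA N) -> homB f = 0 -> null BWV f.
Proof.
move=> WN f0; have u0 : homA f ∘ cphi M = 0.
  by rewrite -comma_homP f0 fmap0 compm0.
have -> : f = inA_hom (M := N) (idm (cA N)) ∘ to_inA u0.
  apply: comma_hom_eq; first by apply/esym/comp1m.
  by rewrite f0; apply/esym/comp0m.
by apply: null_factor; apply: inA_frakB.
Qed.

Lemma lift_to_s (M : K) (y : {y : B | Y y}) (g : hom (cB M) (sval y)) :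
  BXY M -> exists f : hom M (s_ob y), homB f = g.
Proof.
move=> [YM mM XM].
have [a aP] := cg_inj cgA (s_inW sc y) (mono_se mM) XM (s_sigma sc y ∘ fmap T g).
by exists (mkhom (N := s_ob y) (esym aP)).
Qed.

(** A null morphism factors through the chosen embedding x -> v with v in V; its
    lift can be compared with one that factors through s(v). *)
Lemma s_exists : inhabited (s_functor V sc).
Proof.
apply: induced_functor_exists.
- exact: s_ob_frakB.
- by move=> x y f; exact: (lift_to_s (M := s_ob x) (y := y) f (s_ob_frakB x)).
- by [].
- by move=> x y z g f g' f' <- <-.
- by move=> x y f g f' g' <- <-.
move=> x y f m mf /(null_extend cgB (cs_exact chB x) (cs_inX chB x)) [t tP].
pose v : {y : B | Y y} := exist Y (cs_W chB x) (cg_sub cgB (cs_inW chB x)).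
have [m1 m1P] := lift_to_s (M := s_ob x) (y := v) (cs_i chB x) (s_ob_frakB x).
have [m2 m2P] := lift_to_s (M := s_ob v) (y := y) t (s_ob_frakB v).
rewrite -[m](subrK (m2 ∘ m1 : hom (s_ob x) (s_ob y))); apply: null_add.
  apply: homB_null; first exact: s_inW.
  change (homB m - homB m2 ∘ homB m1 = 0).
  by rewrite mf m1P m2P tP subrr.
by apply: null_factor; apply: s_ob_WV; apply: cs_inW.
Qed.

(** * The recollement *)

Variables (SA : stable_shift chA) (SB : stable_shift chB).
Variables (SM : stable_shift chM).
Variables (Z : Z_functor T W X V Y) (q : q_functor T W X V Y).
Variables (UA : UA_functor T W X V Y) (UB : UB_functor T W X V Y).
Variables (TB : TB_functor T W X V Y) (s : s_functor V sc).

Local Notation DA := (stableT SA).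
Local Notation DB := (stableT SB).
Local Notation DM := (stableT SM).

Lemma Z_triangle : @right_triangle_functor DA DM Z.
Proof.
apply: (exact_functor_triangle cgA cgM SA SM GZ_exact) => //.
by move=> x Wx; apply: inA_frakB.
Qed.

Lemma q_triangle : @right_triangle_functor DM DA q.
Proof.
apply: (exact_functor_triangle cgM cgA SM SA Gq_exact) => //.
  by move=> M [].
by move=> M N f; apply: (coker_funP (M := sval M) (N := sval N) f).
Qed.

Lemma UA_triangle : @right_triangle_functor DM DA UA.
Proof.
apply: (exact_functor_triangle cgM cgA SM SA GUA_exact) => //.
by move=> M; apply: (frakB_WV_cA subX TVW frA).
Qed.

Lemma UB_triangle : @right_triangle_functor DM DB UB.
Proof.
apply: (exact_functor_triangle cgM cgB SM SB GUB_exact) => //.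
by move=> M [].
Qed.

Lemma TB_triangle : @right_triangle_functor DB DM TB.
Proof.
apply: (exact_functor_triangle cgB cgM SB SM GTB_exact) => //.
by move=> y Vy; apply: inT_frakB.
Qed.


Lemma Z_scls (x y : stable X W) (f : hom (sval x) (sval y)) :
  fmap Z (scls X W (x := x) (y := y) f) =
  scls BXY BWV (x := Z x) (y := Z y) (inA_map f).
Proof. exact: (induced_cls Z). Qed.

Lemma q_scls (M N : stable BXY BWV) (f : hom (sval M) (sval N)) c :
  c ∘ cokerm (cphi (sval M)) = cokerm (cphi (sval N)) ∘ homA f ->
  fmap q (scls BXY BWV (x := M) (y := N) f) = scls X W (x := q M) (y := q N) c.
Proof. exact: (induced_cls q). Qed.

Lemma UA_scls (M N : stable BXY BWV) (f : hom (sval M) (sval N)) :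
  fmap UA (scls BXY BWV (x := M) (y := N) f) =
  scls X W (x := UA M) (y := UA N) (homA f).
Proof. exact: (induced_cls UA). Qed.

Lemma UB_scls (M N : stable BXY BWV) (f : hom (sval M) (sval N)) :
  fmap UB (scls BXY BWV (x := M) (y := N) f) =
  scls Y V (x := UB M) (y := UB N) (homB f).
Proof. exact: (induced_cls UB). Qed.

Lemma TB_scls (x y : stable Y V) (f : hom (sval x) (sval y)) :
  fmap TB (scls Y V (x := x) (y := y) f) =
  scls BXY BWV (x := TB x) (y := TB y) (inT_map f).
Proof. by apply: (induced_cls TB). Qed.

Lemma s_scls (x y : stable Y V) (f : hom (sval x) (sval y))
    (m : hom (s_ob x) (s_ob y)) :
  homB m = f ->
  fmap s (scls Y V (x := x) (y := y) f) = scls BXY BWV (x := s x) (y := s y) m.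
Proof. exact: (induced_cls s). Qed.

Definition Z_UA_unit (x : stable X W) : hom x (UA (Z x)) :=
  scls X W (x := x) (y := UA (Z x)) (idm (sval x)).

Definition Z_UA_counit (M : stable BXY BWV) : hom (Z (UA M)) M :=
  scls BXY BWV (x := Z (UA M)) (y := M) (inA_hom (M := sval M) (idm (cA (sval M)))).

Lemma Z_UA_adjunction : adjunction Z_UA_unit Z_UA_counit.
Proof.
split=> [x x' f|M M' f|x|M].
- have [f0 <-] := scls_surj f; rewrite Z_scls UA_scls.
  rewrite (sclsM (x := x) (y := x') (z := UA (Z x'))).
  rewrite (sclsM (x := x) (y := UA (Z x)) (z := UA (Z x'))).
  by rewrite comp1m compm1.
- have [f0 <-] := scls_surj f; rewrite UA_scls Z_scls.
  rewrite (sclsM (x := Z (UA M)) (y := Z (UA M')) (z := M')).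
  rewrite (sclsM (x := Z (UA M)) (y := M) (z := M')).
  congr (scls _ _ _); apply: comma_hom_eq; last exact: from_zob_eq.
  change (\id ∘ homA f0 = homA f0 ∘ \id); by rewrite comp1m compm1.
- rewrite Z_scls (sclsM (x := Z x) (y := Z (UA (Z x))) (z := Z x)).
  rewrite -scls1; congr (scls _ _ _); apply: comma_hom_eq; last exact: from_zob_eq.
  exact: comp1m.
- rewrite UA_scls (sclsM (x := UA M) (y := UA (Z (UA M))) (z := UA M)).
  by rewrite -scls1; congr (scls _ _ _); apply: comp1m.
Qed.

Definition q_Z_unit (M : stable BXY BWV) : hom M (Z (q M)) :=
  scls BXY BWV (x := M) (y := Z (q M)) (to_inA (proj1 (cokerP (cphi (sval M))))).

Fact coker_inA_subproof (x : A) :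
  exists e : hom (coker (cphi (inA T x))) x, e ∘ cokerm (cphi (inA T x)) = \id.
Proof. by apply: (coker_colift (cokerP _)); apply: compm0. Qed.

Definition coker_inA (x : A) := projT1 (cid (coker_inA_subproof x)).

Lemma coker_inAK (x : A) : coker_inA x ∘ cokerm (cphi (inA T x)) = \id.
Proof. exact: projT2 (cid (coker_inA_subproof x)). Qed.

Definition q_Z_counit (x : stable X W) : hom (q (Z x)) x :=
  scls X W (x := q (Z x)) (y := x) (coker_inA (sval x)).

Lemma q_Z_adjunction : adjunction q_Z_unit q_Z_counit.
Proof.
split=> [M M' f|x x' f|M|x].
- have [f0 <-] := scls_surj f; rewrite (q_scls (coker_funP f0)) Z_scls.
  rewrite (sclsM (x := M) (y := M') (z := Z (q M'))).
  rewrite (sclsM (x := M) (y := Z (q M)) (z := Z (q M'))).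
  congr (scls _ _ _); apply: comma_hom_eq.
    exact/esym/coker_funP.
  by apply: etrans (comp0m _ _) _; apply/esym/comp0m.
- have [f0 <-] := scls_surj f; rewrite Z_scls (q_scls (coker_funP _)).
  rewrite (sclsM (x := q (Z x)) (y := q (Z x')) (z := x')).
  rewrite (sclsM (x := q (Z x)) (y := x) (z := x')).
  congr (scls _ _ _); apply: (cokernel_epi (cokerP (cphi (inA T (sval x))))).
  rewrite -!compA coker_inAK compm1 coker_funP compA coker_inAK; exact: comp1m.
- rewrite (q_scls (coker_funP _)).
  rewrite (sclsM (x := q M) (y := q (Z (q M))) (z := q M)).
  rewrite -scls1; congr (scls _ _ _).
  apply: (cokernel_epi (cokerP (cphi (sval M)))).
  by rewrite -compA coker_funP compA coker_inAK.
- rewrite Z_scls (sclsM (x := Z x) (y := Z (q (Z x))) (z := Z x)).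
  rewrite -scls1; congr (scls _ _ _); apply: comma_hom_eq; last exact: from_zob_eq.
  exact: coker_inAK.
Qed.

Definition TB_UB_unit (y : stable Y V) : hom y (UB (TB y)) :=
  scls Y V (x := y) (y := UB (TB y)) (idm (sval y)).

Definition TB_UB_counit (M : stable BXY BWV) : hom (TB (UB M)) M :=
  scls BXY BWV (x := TB (UB M)) (y := M) (inT_hom (M := sval M) (idm (cB (sval M)))).

Lemma TB_UB_adjunction : adjunction TB_UB_unit TB_UB_counit.
Proof.
split=> [y y' f|M M' f|y|M].
- have [f0 <-] := scls_surj f; rewrite TB_scls UB_scls.
  rewrite (sclsM (x := y) (y := y') (z := UB (TB y'))).
  rewrite (sclsM (x := y) (y := UB (TB y)) (z := UB (TB y'))).
  by rewrite comp1m compm1.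
- have [f0 <-] := scls_surj f; rewrite UB_scls TB_scls.
  rewrite (sclsM (x := TB (UB M)) (y := TB (UB M')) (z := M')).
  rewrite (sclsM (x := TB (UB M)) (y := M) (z := M')).
  congr (scls _ _ _); apply: comma_hom_eq.
    change (cphi (sval M') ∘ fmap T \id ∘ fmap T (homB f0) =
      homA f0 ∘ (cphi (sval M) ∘ fmap T \id)).
    by rewrite !fmap1 !compm1 comma_homP.
  change (\id ∘ homB f0 = homB f0 ∘ \id); by rewrite comp1m compm1.
- rewrite TB_scls (sclsM (x := TB y) (y := TB (UB (TB y))) (z := TB y)).
  rewrite -scls1; congr (scls _ _ _); apply: comma_hom_eq; last exact: comp1m.
  change (\id ∘ fmap T (idm (sval y)) ∘ fmap T (idm (sval y)) = \id).
  by rewrite !fmap1 !comp1m.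
- rewrite UB_scls (sclsM (x := UB M) (y := UB (TB (UB M))) (z := UB M)).
  by rewrite -scls1; congr (scls _ _ _); apply: comp1m.
Qed.

Lemma scls_homB (M N : stable BXY BWV) (f g : hom (sval M) (sval N)) :
  W (cA (sval N)) -> homB f = homB g ->
  scls BXY BWV (x := M) (y := N) f = scls BXY BWV (x := M) (y := N) g.
Proof.
move=> WN fg; apply/sclsP; apply: homB_null => //.
by change (homB f - homB g = 0); rewrite fg subrr.
Qed.

Definition to_s (M : stable BXY BWV) : hom (sval M) (s_ob (UB M)) :=
  projT1 (cid (lift_to_s (y := UB M) (idm (cB (sval M))) (svalP M))).

Lemma to_sP (M : stable BXY BWV) : homB (to_s M) = \id.
Proof.
exact: projT2 (cid (lift_to_s (y := UB M) (idm (cB (sval M))) (svalP M))).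
Qed.

Definition UB_s_unit (M : stable BXY BWV) : hom M (s (UB M)) :=
  scls BXY BWV (x := M) (y := s (UB M)) (to_s M).

Definition UB_s_counit (y : stable Y V) : hom (UB (s y)) y :=
  scls Y V (x := UB (s y)) (y := y) (idm (sval y)).

Lemma UB_s_adjunction : adjunction UB_s_unit UB_s_counit.
Proof.
split=> [M M' f|y y' f|M|y].
- have [f0 <-] := scls_surj f; rewrite UB_scls.
  have [m mP] := lift_to_s (M := s_ob (UB M)) (y := UB M') (homB f0) (s_ob_frakB _).
  rewrite (s_scls mP) (sclsM (x := M) (y := M') (z := s (UB M'))).
  rewrite (sclsM (x := M) (y := s (UB M)) (z := s (UB M'))).
  apply: scls_homB; first exact: s_inW.
  change (homB (to_s M') ∘ homB f0 = homB m ∘ homB (to_s M)).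
  by rewrite !to_sP mP comp1m compm1.
- have [f0 <-] := scls_surj f.
  have [m mP] := lift_to_s (M := s_ob y) (y := y') f0 (s_ob_frakB _).
  rewrite (s_scls mP) UB_scls mP.
  rewrite (sclsM (x := UB (s y)) (y := UB (s y')) (z := y')).
  rewrite (sclsM (x := UB (s y)) (y := y) (z := y')).
  by rewrite comp1m compm1.
- rewrite UB_scls (sclsM (x := UB M) (y := UB (s (UB M))) (z := UB M)).
  by rewrite to_sP comp1m.
- have [m mP] := lift_to_s (M := s_ob (UB (s y))) (y := y) (idm (sval y)) (s_ob_frakB _).
  rewrite (s_scls (x := UB (s y)) mP).
  rewrite (sclsM (x := s y) (y := s (UB (s y))) (z := s y)) -scls1.
  apply: scls_homB; first exact: s_inW.
  change (homB m ∘ homB (to_s (s y)) = \id).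
  by rewrite to_sP mP comp1m.
Qed.

Lemma stable_zero_inv (M : stable X W) : is_zero M -> W (sval M).
Proof.
move=> /is_zeroP; rewrite -scls1 => /scls0P.
move=> /(null_extend cgA (cs_exact chA M) (cs_inX chA M)) [t tP].
by have [_ _ _ Ws _] := frA; apply: closed_retract Ws tP (cs_inW chA M).
Qed.

(** The first component of M is then in W, hence injective relative to X, which
    gives a morphism back from s(e M); both composites are the identity on second
    components. *)
Lemma UB_s_unit_iso (M : stable BXY BWV) : is_zero (UA M) -> is_iso (UB_s_unit M).
Proof.
move=> /stable_zero_inv /= WM.
have [a aP] := cg_inj cgA WM (mono_se (@s_mono _ _ _ _ _ _ sc (UB M)))
  (@s_coker _ _ _ _ _ _ sc (UB M)) (cphi (sval M)).
have h : cphi (sval M) ∘ fmap T (idm (cB (sval M))) = a ∘ cphi (s_ob (UB M)).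
  by rewrite fmap1 compm1; apply/esym.
pose f : hom (s_ob (UB M)) (sval M) := mkhom (M := s_ob (UB M)) h.
exists (scls BXY BWV (x := s (UB M)) (y := M) f); split.
  rewrite (sclsM (x := M) (y := s (UB M)) (z := M)) -scls1.
  by apply: scls_homB => //; change (\id ∘ homB (to_s M) = \id); rewrite to_sP comp1m.
rewrite (sclsM (x := s (UB M)) (y := M) (z := s (UB M))) -scls1.
apply: scls_homB; first exact: s_inW.
by change (homB (to_s M) ∘ \id = \id); rewrite to_sP comp1m.
Qed.

Lemma scls_id_iso (C : precat) (X0 W0 : C -> Prop) (x : C) (p p' : X0 x) :
  is_iso (scls X0 W0 (x := exist X0 x p) (y := exist X0 x p') \id).
Proof.
by apply: (scls_iso (g := \id)); rewrite /= comp1m subrr; apply: null_zero.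
Qed.

Lemma UB_s_counit_iso y : is_iso (UB_s_counit y).
Proof. by case: y => y p; apply: scls_id_iso. Qed.

Lemma Z_UA_unit_iso x : is_iso (Z_UA_unit x).
Proof. by case: x => x p; apply: scls_id_iso. Qed.

Lemma TB_UB_unit_iso y : is_iso (TB_UB_unit y).
Proof. by case: y => y p; apply: scls_id_iso. Qed.

Lemma s_triangle : @right_triangle_functor DB DM s.
Proof.
have pr0 (y : DB) : @is_zero DA (UA (s y)).
  by apply: stable_zero; apply: s_inW.
have cone : tr_cone DM by exact: (stable_tr_cone cgM).
exact: (@right_adjoint_triangle DA DM DB (stable_pretriangulated cgA SA)
  (stable_pretriangulated cgM SM) (stable_pretriangulated cgB SB)
  cone UB s UA UB_s_unit UB_s_counit UB_s_adjunction
  UB_s_counit_iso UB_triangle UA_triangle pr0 UB_s_unit_iso).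
Qed.

(** If Y is in V then φ splits, and the part (TY, Y) of (X, Y)_φ is in the
    class of zero objects. *)
Lemma Z_image (M : stable BXY BWV) :
  (exists x : stable X W, isomorphic (Z x) M) <-> is_zero (UB M).
Proof.
split=> [[x [f fi]]|/is_zeroP].
  apply: (is_zero_iso (fmap_iso UB fi)); apply: stable_zero.
  by apply: (proj2 subV); apply: zobP.
rewrite -scls1 => /scls0P.
move=> /(null_extend cgB (cs_exact chB (UB M)) (cs_inX chB (UB M))) [t tP].
have VM : V (cB (sval M)).
  by have [_ _ _ Vs _] := frB; apply: closed_retract Vs tP (cs_inW chB (UB M)).
have [_ mM XM] := svalP M.
have [r rP] := cg_inj cgA (TVW VM) (mono_se mM) XM \id.
have [sp [_ csp _ _ e1]] := retract_split (mono_se mM) rP.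
exists (q M).
pose f : hom (inA T (coker (cphi (sval M)))) (sval M) := inA_hom (M := sval M) sp.
pose g : hom (sval M) (inA T (coker (cphi (sval M)))) :=
  to_inA (proj1 (cokerP (cphi (sval M)))).
exists (scls BXY BWV (x := Z (q M)) (y := M) f).
apply: (scls_iso (x := Z (q M)) (g := g)).
  rewrite (_ : g ∘ f = \id) ?subrr; first exact: null_zero.
  by apply: comma_hom_eq; [exact: csp|exact: from_zob_eq].
have hr : cphi (inT T (cB (sval M))) ∘ fmap T (idm (cB (sval M))) = r ∘ cphi (sval M).
  by rewrite fmap1 comp1m rP.
rewrite (_ : _ - _ =
  - (inT_hom (M := sval M) (idm (cB (sval M))) ∘ mkhom (N := inT T _) hr)).
  by apply/null_opp/null_factor; apply: inT_frakB.
apply: comma_hom_eq.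
  change (sp ∘ cokerm (cphi (sval M)) - \id =
    - (cphi (sval M) ∘ fmap T \id ∘ r)).
  by rewrite fmap1 compm1 -e1 opprD addrCA subrr addr0.
change ((0 : hom (zob B) (cB (sval M))) ∘ (0 : hom (cB (sval M)) (zob B)) - \id =
  - (\id ∘ \id)).
by rewrite comp0m comp1m sub0r.
Qed.

Lemma stable_recollement :
  recollement (A' := DA) (C := DM) (B' := DB) Z q UA UB TB s.
Proof.
split.
- split; first exact: (stable_right_triangulated cgA).
    exact: (stable_right_triangulated cgM).
  exact: (stable_right_triangulated cgB).
- split; [exact: Z_triangle|exact: UB_triangle| |].
    by split; [exact: q_triangle|exact: UA_triangle].
  by split; [exact: TB_triangle|exact: s_triangle].
- split; [exact: adjunction_adjoint q_Z_adjunction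
         |exact: adjunction_adjoint Z_UA_adjunction
         |exact: adjunction_adjoint TB_UB_adjunction
         |exact: adjunction_adjoint UB_s_adjunction].
- split; [exact: unit_iso_left_ff Z_UA_adjunction Z_UA_unit_iso
         |exact: unit_iso_left_ff TB_UB_adjunction TB_UB_unit_iso
         |exact: counit_iso_right_ff UB_s_adjunction UB_s_counit_iso].
- exact: Z_image.
Qed.

End Recollement.

Theorem theorem1p2 (A B : abelian)
    (projA : enough_projectives A) (injA : enough_injectives A)
    (projB : enough_projectives B) (injB : enough_injectives B)
    (T : functor B A) (T_rexact : right_exact T)
    (W X : A -> Prop) (V Y : B -> Prop)
    (subW : subcategory W) (subX : subcategory X)
    (subV : subcategory V) (subY : subcategory Y)
    (TVW : forall v, V v -> W (T v))
    (TYX : forall y, Y y -> X (T y))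
    (LTY : forall n y, (1 <= n)%N -> Y y -> left_derived T n y (zob A)) :
  (left_Frobenius_pair X W -> left_Frobenius_pair Y V ->
     inhabited (cosyzygies (frakB T X Y) (frakB T W V)) /\
     forall (chA : cosyzygies X W) (chB : cosyzygies Y V)
       (chM : cosyzygies (frakB T X Y) (frakB T W V))
       (sc : s_choice T X W Y),
     exists (SA : stable_shift chA) (SB : stable_shift chB)
       (SM : stable_shift chM)
       (Z : Z_functor T W X V Y) (q : q_functor T W X V Y)
       (UA : UA_functor T W X V Y) (UB : UB_functor T W X V Y)
       (TB : TB_functor T W X V Y) (s : s_functor V sc),
     recollement (A' := stableT SA) (C := stableT SM) (B' := stableT SB)
       Z q UA UB TB s)
  /\
  (strong_left_Frobenius_pair X W -> strong_left_Frobenius_pair Y V ->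
     forall (chA : cosyzygies X W) (chB : cosyzygies Y V)
       (chM : cosyzygies (frakB T X Y) (frakB T W V))
       (sc : s_choice T X W Y)
       (SA : stable_shift chA) (SB : stable_shift chB)
       (SM : stable_shift chM)
       (Z : Z_functor T W X V Y) (q : q_functor T W X V Y)
       (UA : UA_functor T W X V Y) (UB : UB_functor T W X V Y)
       (TB : TB_functor T W X V Y) (s : s_functor V sc),
     recollement (A' := stableT SA) (C := stableT SM) (B' := stableT SB)
       Z q UA UB TB s ->
     triangulated_recollement (A' := stableT SA) (C := stableT SM)
       (B' := stableT SB) Z q UA UB TB s).
Proof.
have L1T y : Y y -> left_derived T 1 y (zob A) by exact: LTY.
split=> [frA frB|[frA [Wl Wgen]] [frB [Vl Vgen]] chA chB chM sc SA SB SM].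
  have cgM := frakB_cogenerated T_rexact subX subY TVW TYX L1T frA frB.
  split.
    apply: cosyzygies_exist.
    exact: (frakB_embedding T_rexact subW subX subY TVW L1T frA frB).
  move=> chA chB chM sc.
  have [SA] := stable_shift_exists (frobenius_cogenerated subX frA) chA.
  have [SB] := stable_shift_exists (frobenius_cogenerated subY frB) chB.
  have [SM] := stable_shift_exists cgM chM.
  have [Z] := Z_exists T subW subX subV subY frA.
  have [q] := q_exists T_rexact subX subY TVW TYX L1T frA frB.
  have [UA] := UA_exists T_rexact subX subY TVW TYX L1T frA frB.
  have [UB] := UB_exists T_rexact subX subY TVW TYX L1T frA frB.
  have [TB] := TB_exists T subW subX subY frB.
  have [s] := s_exists subW subX subV subY TVW frA frB chB sc.
  exists SA, SB, SM, Z, q, UA, UB, TB, s.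
  exact: (stable_recollement T_rexact).
move=> Z q UA UB TB s rec.
have cgA := frobenius_cogenerated subX frA.
have cgB := frobenius_cogenerated subY frB.
have cgM := frakB_cogenerated T_rexact subX subY TVW TYX L1T frA frB.
have Wproj w : W w -> rel_projective X w by move=> /Wl [_ /Ext1_projective].
have Vproj v : V v -> rel_projective Y v by move=> /Vl [_ /Ext1_projective].
split=> //; split.
- exact: (stable_triangulated cgA SA Wproj Wgen).
- apply: (stable_triangulated cgM SM).
    exact: (frakB_WV_projective subX TVW TYX frA Wproj Vproj).
  exact: (frakB_generated T_rexact subW subX subY TYX L1T frA frB Wproj Wgen Vgen).
- exact: (stable_triangulated cgB SB Vproj Vgen).
Qed.
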